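(* Let $R$ be a commutative Noetherian ring and $M$ be a finitely generated $R$-module. Then: (1) If $\mathrm{mod}(R)$ has an extension generator, then $\mathrm{IID}(M)$ is closed in $\mathrm{Spec}(R)$. Moreover, $\mathrm{Sing}(R)=\mathrm{IID}(G)$ holds for each extension generator $G$ of $\mathrm{mod}(R)$. (2) If $\mathrm{mod}(R)$ has a strong generator, then $\mathrm{IID}(M)=V(\mathrm{coca}_R(M))$.
   Context: $\mathrm{mod}(R)$ is the category of finitely generated $R$-modules; $\mathrm{Spec}(R)$ carries the Zariski topology, with $V(I)=\{\mathfrak p\in\mathrm{Spec}(R)\mid I\subseteq\mathfrak p\}$. $\mathrm{Sing}(R)=\{\mathfrak p\mid R_{\mathfrak p}\text{ is not regular}\}$. Infinite injective dimension locus: $\mathrm{IID}(M)=\{\mathfrak p\in\mathrm{Spec}(R)\mid \mathrm{id}_{R_{\mathfrak p}}(M_{\mathfrak p})=\infty\}$, where $\mathrm{id}$ denotes injective dimension. Co-cohomological annihilator: for $n\ge0$, $\mathrm{coca}^n_R(M)=\{r\in R\mid r\,\mathrm{Ext}^i_R(N,M)=0\text{ for all } i\ge n,\ N\in\mathrm{mod}(R)\}$, and $\mathrm{coca}_R(M)=\bigcup_{n\ge0}\mathrm{coca}^n_R(M)$. Extension generator: $\Omega^s_R(X)$ is the $s$-th syzygy of $X$ in a resolution by finitely generated projectives (up to projective summands; $\Omega^0_R(X)=X$), $\Omega^s_R(\mathrm{mod}(R))=\{\Omega^s_R(X)\mid X\in\mathrm{mod}(R)\}$. For $G\in\mathrm{mod}(R)$: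 $|G|_0=\{0\}$; $|G|_1$ is the class of direct summands of finite direct sums of copies of $G$; for $n\ge2$, $|G|_n$ is the class of $Y\in\mathrm{mod}(R)$ appearing in an exact sequence $0\to Y_1\to Y\oplus Y'\to Y_2\to0$ in $\mathrm{mod}(R)$ with $Y_1\in|G|_{n-1}$, $Y_2\in|G|_1$. $G$ is an extension generator of $\mathrm{mod}(R)$ if there is $s\ge0$ with $\Omega^s_R(\mathrm{mod}(R))\subseteq\bigcup_{t\ge0}|G|_t$. Strong generator: for $X\in\mathcal A=\mathrm{mod}(R)$, $\mathrm{thick}^0_{\mathcal A}(X)=\{0\}$; $\mathrm{thick}^1_{\mathcal A}(X)$ is the class of direct summands of finite direct sums of copies of $X$; for $n\ge2$, $\mathrm{thick}^n_{\mathcal A}(X)$ is the class of direct summands of objects fitting into a short exact sequence (in any of the three positions) whose other two terms are such that one is in $\mathrm{thick}^{n-1}_{\mathcal A}(X)$ and the other is in $\mathrm{thick}^1_{\mathcal A}(X)$. $G$ is a strong generator of $\mathrm{mod}(R)$ if $\mathrm{mod}(R)=\mathrm{thick}^n_{\mathcal A}(G)$ for some $n\ge0$. (It is known, by Iyengar–Takahashi, that $\mathrm{mod}(R)$ has a strong generator if and only if there exist $s,t\ge0$ and $G\in\mathrm{mod}(R)$ with $\Omega^s_R(\mathrm{mod}(R))\subseteq|G|_t$.) *)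

(* Defs.v *)
From HB Require Import structures.
From mathcomp Require Import all_boot all_order all_algebra.
From mathcomp Require Import generic_quotient ring.
From mathcomp Require Import boolp classical_sets filter topology_structure.

Set Implicit Arguments.
Unset Strict Implicit.
Unset Printing Implicit Defensive.

Import GRing.Theory.
Local Open Scope ring_scope.
Local Open Scope classical_set_scope.
Local Open Scope quotient_scope.

(* Rings are comPzRingType, so that the zero ring is allowed.  A module is an *)
(* lmodType; mod(R) is cut out of lmodType R by the predicate fin_gen.        *)

Section Ideals.
Variable R : comPzRingType.

Definition ideal (I : set R) : Prop :=
  [/\ I 0, forall a b, I a -> I b -> I (a + b) & forall a b, I b -> I (a * b)].

Definition prime_ideal (I : set R) : Prop :=
  [/\ ideal I, ~ I 1 & forall a b, I (a * b) -> I a \/ I b].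

Definition maximal_ideal (I : set R) : Prop :=
  [/\ ideal I, ~ I 1 & forall J, ideal J -> ~ J 1 -> I `<=` J -> J = I].

Definition generated_by (V : lmodType R) (A : set V) (n : nat) : Prop :=
  exists x : 'I_n -> V, A = [set v | exists c : 'I_n -> R, v = \sum_i c i *: x i].

Definition fin_gen (V : lmodType R) : Prop := exists n, generated_by [set: V] n.

Definition noetherian : Prop :=
  forall I, ideal I -> exists n, generated_by (I : set R^o) n.

Record Spec := MkSpec {
  spec_set :> set R;
  spec_prime : prime_ideal spec_set
}.

HB.instance Definition _ := gen_eqMixin Spec.
HB.instance Definition _ := gen_choiceMixin Spec.

Definition zariski_V (E : set R) : set Spec := [set p : Spec | E `<=` p].

Definition zariski_open (U : set Spec) : Prop := exists E, ~` U = zariski_V E.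

Lemma zariski_openT : zariski_open setT.
Proof.
exists setT; rewrite setCT; apply/seteqP; split => // p /(_ 1 Logic.I).
by have [_ + _] := spec_prime p.
Qed.

Lemma zariski_openI : setI_closed zariski_open.
Proof.
move=> U W [E UE] [F WF].
exists [set c | exists a b, [/\ E a, F b & c = a * b]].
rewrite setCI UE WF; apply/seteqP; split => p /=.
  have [[_ _ pM] _ _] := spec_prime p.
  move=> [Ep|Fp] _ [a [b [Ea Fb ->]]]; last exact/pM/Fp.
  by rewrite mulrC; apply/pM/Ep.
move=> EFp; apply: contrapT => /not_orP[].
move=> /existsNP[a /not_implyP[Ea pa]] /existsNP[b /not_implyP[Fb pb]].
have [_ _ /(_ a b)] := spec_prime p.
by case=> //; apply: EFp; exists a, b.
Qed.

Lemma zariski_open_bigU (I : Type) (U : I -> set Spec) :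
  (forall i, zariski_open (U i)) -> zariski_open (\bigcup_i U i).
Proof.
move=> /choice[E UE]; exists (\bigcup_i E i).
rewrite setC_bigcup; apply/seteqP; split => p /=.
  by move=> Up a [i _ Ea]; have := Up i Logic.I; rewrite UE => /(_ _ Ea).
by move=> Ep i _; rewrite UE => a Ea; apply: Ep; exists i.
Qed.

HB.instance Definition _ := isOpenTopological.Build Spec
  zariski_openT zariski_openI zariski_open_bigU.

Definition prime_chain (n : nat) (c : nat -> Spec) : Prop :=
  forall i, (i < n)%N -> (c i `<=` c i.+1) /\ ~ (c i.+1 `<=` c i).

Definition krull_dim (d : nat) : Prop :=
  (exists c, prime_chain d c) /\ (forall n c, prime_chain n c -> (n <= d)%N).

(* The minimal number of generators of the maximal ideal is the Krull         *)
(* dimension.                                                                 *)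
Definition regular_local : Prop :=
  noetherian /\
  exists m, [/\ maximal_ideal m, forall J, maximal_ideal J -> J = m &
    exists d, [/\ krull_dim d, generated_by (m : set R^o) d &
      forall n, generated_by (m : set R^o) n -> (d <= n)%N]].

End Ideals.

Section Localization.
Variables (R : comPzRingType) (p : Spec R).

Definition den : Type := {s : R | s \notin (p : set R)}.
HB.instance Definition _ := Choice.on den.

Lemma den1_subproof : (1 : R) \notin (p : set R).
Proof. by rewrite notin_setE; have [] := spec_prime p. Qed.

Lemma denM_subproof (s t : den) : val s * val t \notin (p : set R).
Proof.
case: s t => [s /= +] [t /= +]; rewrite !notin_setE => ps pt.
by have [_ _ pM] := spec_prime p; move=> /pM[].
Qed.

Definition den_val (s : den) : R := val s.
Local Notation "s %:d" := (den_val s) (at level 2, format "s %:d").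

Definition den1 : den := exist _ 1 den1_subproof.
Definition denM (s t : den) : den := exist _ (val s * val t) (denM_subproof s t).

Lemma denE : (den1%:d = 1) * (forall s t, (denM s t)%:d = s%:d * t%:d).
Proof. by []. Qed.

Section LocalizedModule.
Variable M : lmodType R.
Implicit Types (m : M) (s t u : den).

Let scale_cross (k a b c d : R) m m' :
  a *: m = b *: m' -> c = k * a -> d = k * b -> c *: m = d *: m'.
Proof. by move=> mm' -> ->; rewrite -!scalerA mm'. Qed.

Definition loc_eq (x y : M * den) : bool :=
  `[< exists u : den, (u%:d * y.2%:d) *: x.1 = (u%:d * x.2%:d) *: y.1 >].

Lemma loc_eq_equiv : equiv_class_of loc_eq.
Proof.
split=> [x|x y|y x z].
- by apply/asboolP; exists den1.
- by apply/asboolP/asboolP => -[u xy]; exists u.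
move=> /asboolP[u xy] /asboolP[w yz]; apply/asboolP.
exists (denM (denM u w) y.2); rewrite !denE.
transitivity ((w%:d * z.2%:d * (u%:d * x.2%:d)) *: y.1).
  by apply: (scale_cross (k := w%:d * z.2%:d) xy); ring.
by apply: (scale_cross (k := u%:d * x.2%:d) yz); ring.
Qed.

Definition loc_eq_rel : equiv_rel (M * den) := EquivRelPack loc_eq_equiv.

Definition loc : Type := {eq_quot loc_eq_rel}.
HB.instance Definition _ := Choice.on loc.
HB.instance Definition _ := EqQuotient.on loc.
Implicit Types x y z : loc.

Definition locfrac m s : loc := \pi_loc (m, s).

Lemma locfrac_repr x : locfrac (repr x).1 (repr x).2 = x.
Proof. by rewrite /locfrac -surjective_pairing reprK. Qed.

Lemma locfrac_ind (P : loc -> Prop) : (forall m s, P (locfrac m s)) -> forall x, P x.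
Proof. by move=> PP x; rewrite -[x]locfrac_repr. Qed.

Lemma locfracP m m' s s' :
  locfrac m s = locfrac m' s' <-> exists u, (u%:d * s'%:d) *: m = (u%:d * s%:d) *: m'.
Proof.
split => [/eqP|mm']; last apply/eqP; rewrite /locfrac eqmodE.
  by move=> /asboolP.
exact/asboolP.
Qed.

Let locfrac_eq m m' s s' : s'%:d *: m = s%:d *: m' ->
  locfrac m s = locfrac m' s'.
Proof. by move=> mm'; apply/locfracP; exists den1; rewrite !mul1r. Qed.

Let reprP m s : exists u,
  (u%:d * s%:d) *: (repr (locfrac m s)).1 =
  (u%:d * (repr (locfrac m s)).2%:d) *: m.
Proof. exact/locfracP/locfrac_repr. Qed.

Definition loc0 := locfrac 0 den1.
Definition locN x := locfrac (- (repr x).1) (repr x).2.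
Definition locD x y := let: (m, s) := repr x in let: (m', s') := repr y in
  locfrac (s'%:d *: m + s%:d *: m') (denM s s').

Lemma locNE m s : locN (locfrac m s) = locfrac (- m) s.
Proof.
have [u e] := reprP m s; apply/locfracP; exists u.
by rewrite !scalerN e.
Qed.

Lemma locDE m m' s s' : locD (locfrac m s) (locfrac m' s') =
  locfrac (s'%:d *: m + s%:d *: m') (denM s s').
Proof.
rewrite /locD; have := reprP m s; have := reprP m' s'.
case: (repr _) => [n' t'] /= [u' e']; case: (repr _) => [n t] /= [u e].
apply/locfracP; exists (denM u u'); rewrite !denE !scalerDr !scalerA.
congr (_ + _).
  by apply: (scale_cross (k := u'%:d * s'%:d * t'%:d) e); ring.
by apply: (scale_cross (k := u%:d * s%:d * t%:d) e'); ring.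
Qed.

Lemma locDA : associative locD.
Proof.
elim/locfrac_ind => m s; elim/locfrac_ind => m' s'; elim/locfrac_ind => m'' s''.
rewrite !locDE; apply: locfrac_eq; rewrite !denE !scalerDr !scalerA addrA.
by congr (_ *: _ + _ *: _ + _ *: _); ring.
Qed.

Lemma locDC : commutative locD.
Proof.
elim/locfrac_ind => m s; elim/locfrac_ind => m' s'.
by rewrite !locDE; apply: locfrac_eq; rewrite !denE addrC mulrC.
Qed.

Lemma loc0D : left_id loc0 locD.
Proof.
elim/locfrac_ind => m s; rewrite locDE; apply: locfrac_eq.
by rewrite !denE scaler0 add0r scale1r mul1r.
Qed.

Lemma locND : left_inverse loc0 locN locD.
Proof.
elim/locfrac_ind => m s; rewrite locNE locDE; apply: locfrac_eq.
by rewrite !denE scalerN addNr !scaler0.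
Qed.

HB.instance Definition _ := GRing.isZmodule.Build loc locDA locDC loc0D locND.

Lemma locfracD m m' s s' : locfrac m s + locfrac m' s' =
  locfrac (s'%:d *: m + s%:d *: m') (denM s s').
Proof. exact: locDE. Qed.

End LocalizedModule.

Definition loc_scale (M : lmodType R) (a : loc R^o) (x : loc M) : loc M :=
  let: (b, s) := repr a in let: (m, t) := repr x in
  locfrac ((b : R) *: m) (denM s t).

Lemma loc_scaleE (M : lmodType R) (a : R^o) (m : M) s t :
  loc_scale (locfrac a s) (locfrac m t) = locfrac ((a : R) *: m) (denM s t).
Proof.
rewrite /loc_scale.
have [u] := (locfracP _ _ _ _).1 (locfrac_repr (locfrac a s)).
have [u'] := (locfracP _ _ _ _).1 (locfrac_repr (locfrac m t)).
case: (repr _) => [n' t'] /= e'; case: (repr _) => [n t0] /= e.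
have {}e : u%:d * s%:d * (n : R) = u%:d * t0%:d * (a : R) by [].
apply/locfracP; exists (denM u u'); rewrite !denE !scalerA.
rewrite (_ : _ * n = (u%:d * s%:d * (n : R)) * (u'%:d * t%:d)); last by ring.
rewrite e -scalerA e' scalerA; congr (_ *: _); ring.
Qed.

Lemma loc_scaleA (M : lmodType R) (a b : loc R^o) (x : loc M) :
  loc_scale a (loc_scale b x) = loc_scale (loc_scale a b) x.
Proof.
elim/locfrac_ind: a => a s; elim/locfrac_ind: b => b t.
elim/locfrac_ind: x => m u; rewrite !loc_scaleE scalerA -[a *: b]/(a * b).
by apply/locfracP; exists den1; rewrite !denE !scalerA; congr (_ *: _); ring.
Qed.

Definition loc1 : loc R^o := @locfrac R^o 1 den1.

Lemma loc_scale1 (M : lmodType R) (x : loc M) : loc_scale loc1 x = x.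
Proof.
elim/locfrac_ind: x => m s; rewrite loc_scaleE scale1r.
by apply/locfracP; exists den1; rewrite !denE !mul1r.
Qed.

Lemma loc_scaleDr (M : lmodType R) (a : loc R^o) (x y : loc M) :
  loc_scale a (x + y) = loc_scale a x + loc_scale a y.
Proof.
elim/locfrac_ind: a => a s; elim/locfrac_ind: x => m t; elim/locfrac_ind: y => m' t'.
rewrite !loc_scaleE !locfracD loc_scaleE.
apply/locfracP; exists den1; rewrite !denE !scalerDr !scalerA.
by congr (_ *: _ + _ *: _); ring.
Qed.

Lemma loc_scaleDl (M : lmodType R) (a b : loc R^o) (x : loc M) :
  loc_scale (a + b) x = loc_scale a x + loc_scale b x.
Proof.
elim/locfrac_ind: a => a s; elim/locfrac_ind: b => b t; elim/locfrac_ind: x => m u.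
rewrite !loc_scaleE !locfracD loc_scaleE.
apply/locfracP; exists den1; rewrite !denE !scalerDr !scalerA -scalerDl.
congr (_ *: _); rewrite /GRing.scale /=; ring.
Qed.

Lemma loc_scaleC (a b : loc R^o) : loc_scale a b = loc_scale b a.
Proof.
elim/locfrac_ind: a => a s; elim/locfrac_ind: b => b t; rewrite !loc_scaleE.
by apply/locfracP; exists den1; rewrite !denE /GRing.scale /=; ring.
Qed.

(* The ring R_p is the localization of the module R, multiplied by scaling.   *)
Definition loc_ring : Type := loc R^o.
HB.instance Definition _ := GRing.Zmodule.on loc_ring.

Let loc_mul1 : left_id (loc1 : loc_ring) (@loc_scale R^o).
Proof. exact: loc_scale1. Qed.
Let loc_mulDl : left_distributive (@loc_scale R^o) (@GRing.add loc_ring).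
Proof. by move=> a b c; exact: loc_scaleDl. Qed.

HB.instance Definition _ := GRing.Zmodule_isComPzRing.Build loc_ring
  (@loc_scaleA R^o) loc_scaleC loc_mul1 loc_mulDl.

HB.instance Definition _ (M : lmodType R) :=
  GRing.Zmodule_isLmodule.Build loc_ring (loc M)
    (fun a b x => loc_scaleA a b x) (@loc_scale1 M)
    (fun a x y => loc_scaleDr a x y) (fun x a b => loc_scaleDl a b x).

End Localization.

Section Modules.
Variable R : comPzRingType.
Implicit Types L M N U V W X Y G : lmodType R.

Definition zero_module M : Prop := forall x : M, x = 0.

Definition isomorphic U V : Prop := exists f : {linear U -> V}, bijective f.

Definition surjective (A B : Type) (f : A -> B) : Prop :=
  forall y, exists x, f x = y.

Definition exact_at U V W (f : U -> V) (g : V -> W) : Prop :=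
  forall y, g y = 0 <-> exists x, f x = y.

Definition short_exact U V W : Prop :=
  exists (f : {linear U -> V}) (g : {linear V -> W}),
    [/\ injective f, exact_at f g & surjective g].

Definition projective U : Prop :=
  forall V W (g : {linear V -> W}) (h : {linear U -> W}),
    surjective g -> exists h' : {linear U -> V}, forall x, g (h' x) = h x.

Definition injective_module U : Prop :=
  forall V W (g : {linear V -> W}) (h : {linear V -> U}),
    injective g -> exists h' : {linear W -> U}, forall x, h' (g x) = h x.

Record projective_resolution N := ProjectiveResolution {
  pres_obj :> nat -> lmodType R;
  pres_d : forall i, {linear pres_obj i.+1 -> pres_obj i};
  pres_aug : {linear pres_obj 0 -> N};
  pres_projective : forall i, projective (pres_obj i);
  pres_surj : surjective pres_aug;
  pres_exact0 : exact_at (pres_d 0) pres_aug;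
  pres_exact : forall i, exact_at (pres_d i.+1) (pres_d i)
}.

Record injective_resolution M := InjectiveResolution {
  ires_obj :> nat -> lmodType R;
  ires_d : forall i, {linear ires_obj i -> ires_obj i.+1};
  ires_coaug : {linear M -> ires_obj 0};
  ires_injective : forall i, injective_module (ires_obj i);
  ires_inj : injective ires_coaug;
  ires_exact0 : exact_at ires_coaug (ires_d 0);
  ires_exact : forall i, exact_at (ires_d i) (ires_d i.+1)
}.

Definition injdim_le M (n : nat) : Prop :=
  exists I : injective_resolution M, forall i, (n < i)%N -> zero_module (I i).

Definition infinite_injdim M : Prop := forall n, ~ injdim_le M n.

(* Cocycles and coboundaries of degree i of the complex Hom_R(P, M), whose    *)
(* i-th cohomology module is Ext^i_R(N, M).                                   *)
Definition ext_cocycle N M (P : projective_resolution N) (i : nat)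
    (f : P i -> M) : Prop :=
  forall x, f (pres_d P i x) = 0.

Definition ext_coboundary N M (P : projective_resolution N) (i : nat) :
    (P i -> M) -> Prop :=
  match i with
  | 0 => fun f => forall x, f x = 0
  | j.+1 => fun f => exists g : {linear P j -> M}, forall x, f x = g (pres_d P j x)
  end.

(* r Ext^i_R(N, M) = 0: multiplication by r maps cocycles to coboundaries.    *)
Definition kills_ext (r : R) (i : nat) N M : Prop :=
  forall (P : projective_resolution N) (f : {linear P i -> M}),
    ext_cocycle f -> ext_coboundary (fun x => r *: f x).

Definition coca_ge (n : nat) M : set R :=
  [set r | forall i N, (n <= i)%N -> fin_gen N -> kills_ext r i N M].

Definition coca M : set R := \bigcup_n coca_ge n M.

Definition summand Y X : Prop :=
  exists Z : lmodType R, fin_gen Z /\ isomorphic (Y * Z)%type X.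

Definition add_closure G Y : Prop :=
  exists n : nat, summand Y {ffun 'I_n -> G}.

(* Y is an s-th syzygy of X: there is an exact sequence                       *)
(* 0 -> Y -> P_{s-1} -> ... -> P_0 -> X -> 0 with P_i f.g. projective.        *)
Fixpoint syzygy (s : nat) X Y : Prop :=
  match s with
  | 0 => isomorphic Y X
  | s'.+1 => exists P K : lmodType R,
      [/\ fin_gen P, projective P, short_exact K P X & syzygy s' K Y]
  end.

Fixpoint ext_ball G (n : nat) Y : Prop :=
  match n with
  | 0 => zero_module Y
  | 1 => add_closure G Y
  | n'.+1 => fin_gen Y /\ exists Y' Y1 Y2 : lmodType R,
      [/\ fin_gen Y', ext_ball G n' Y1, add_closure G Y2 &
          short_exact Y1 (Y * Y')%type Y2]
  end.

Definition extension_generator G : Prop :=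
  fin_gen G /\ exists s, forall X Y, fin_gen X -> syzygy s X Y ->
    exists t, ext_ball G t Y.

Definition short_exact_any_order U V W : Prop :=
  [\/ short_exact U V W \/ short_exact U W V,
      short_exact V U W \/ short_exact W U V |
      short_exact V W U \/ short_exact W V U].

Fixpoint thick G (n : nat) Y : Prop :=
  match n with
  | 0 => zero_module Y
  | 1 => add_closure G Y
  | n'.+1 => exists X U V : lmodType R,
      [/\ fin_gen X, summand Y X, thick G n' U, add_closure G V &
          short_exact_any_order X U V]
  end.

Definition strong_generator G : Prop :=
  fin_gen G /\ exists n, forall Y, fin_gen Y <-> thick G n Y.

End Modules.

Section Loci.
Variable R : comPzRingType.

Definition Sing : set (Spec R) :=
  [set p : Spec R | ~ regular_local (loc_ring p)].

Definition IID (M : lmodType R) : set (Spec R) :=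
  [set p : Spec R | @infinite_injdim (loc_ring p) (loc p M)].

End Loci.

Arguments Sing : clear implicits.

(* Main.v *)
From HB Require Import structures.
Require Import Defs.
From mathcomp Require Import all_boot all_algebra.
From mathcomp Require Import ring.
From mathcomp Require Import boolp classical_sets topology_structure.

Set Implicit Arguments.
Unset Strict Implicit.
Unset Printing Implicit Defensive.

Import GRing.Theory.
Local Open Scope ring_scope.
Local Open Scope classical_set_scope.

(** Why the theorem holds.

    All statements about Ext are put in the form: [r] annihilates
    [Ext^{i+1}(N, M)] ([annExt]). In this form, the long exact sequences multiply
    annihilators ([annExt_mid], [annExt_left], [annExt_right], [annExt2_mid],
    [annExt2_right]), and a finite injective dimension of [M_p] means that, for
    some [n], each finitely generated [N] has an [r] outside [p] that annihilates
    [Ext^{n+1}(N, M)] ([injdim_loc_annExt], [annExt_injdim_loc]): by Baer's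
    criterion only cyclic modules matter, and Ext commutes with localization.

    The set [IID(M)] is closed ([IID_open]). If [M_p] has finite injective
    dimension, some [f] outside [p] annihilates [Ext^{n+1}(G, M)], hence a power of
    [f] annihilates [Ext^{n+1}(Y, M)] for all [Y] built from [G] by extensions, in
    particular for the [s]-th syzygies [Y] of each [X], hence [Ext^{n+s+1}(X, M)].
    So the injective dimension of [M] is finite at all primes that do not contain
    [f]. For a strong generator ([IID_coca]) one step of the construction can shift
    degrees by one, and the number of steps is bounded: an [f] that annihilates
    [Ext^i(G, M)] in a finite range of degrees has a power that annihilates
    [Ext^i(X, M)] for one [i] and all [X], hence in all larger degrees; this power
    belongs to [coca M].

    It remains to compare [IID(G)] with the singular locus. If [R_p] is regular, its
    maximal ideal is generated by a regular sequence ([chain_regseq], from Krull's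
    principal ideal theorem [pit]); so [Ext^i(k, M)] vanishes for large [i], where
    [k] is the residue field, and therefore so does [Ext^i(N, M)] for all cyclic
    modules [N] ([residue_vanishing]).

    Conversely, let [G_p] have finite injective dimension. The modules that are
    [s]-th syzygies, among them the projective ones, inherit this property from [G],
    and then so does every finitely generated module ([generator_regular]). In
    particular [Ext^i(k, k)] vanishes for large [i], and Serre's theorem
    ([residue_regular]) says that [R_p] is regular. Its proof here builds a regular
    sequence in the maximal ideal [m]. Let [I] be generated by the part found so
    far. If [m] annihilates a nonzero class of [R_p/I], then the vanishing forces [k]
    to be injective over [R_p/I], and [m = I] ([socle_residue]). Otherwise a minimal
    generator of [m] modulo [I] can be chosen to be a nonzerodivisor [c] ([nzd_ex]),
    and the vanishing passes from [R_p/I] to [R_p/(I + c)], because [m/(I + c)] is a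
    summand of the reduction of [m/I] modulo [c] ([residue_mod_nzd]). For the sake of
    this induction, Ext is defined relatively to an ideal [I], in the category of the
    modules killed by [I]. *)

(** * Linear maps, submodules and quotients *)

Section Linear.
Variable R : comPzRingType.
Implicit Types U V W : lmodType R.

Definition Lin U V (f : U -> V) (Hf : linear f) : {linear U -> V} :=
  HB.pack f (GRing.isLinear.Build R U V *:%R f Hf).

Lemma linear_ex U V (f : U -> V) : linear f -> exists g : {linear U -> V}, g =1 f.
Proof. by move=> Hf; exists (Lin Hf). Qed.

Definition submodule V (S : set V) : Prop :=
  S 0 /\ forall a x y, S x -> S y -> S (a *: x + y).

Section Submodule.
Variables (V : lmodType R) (S : set V) (hS : submodule S).

Lemma sub0 : S 0. Proof. by case: hS. Qed.
Lemma subD x y : S x -> S y -> S (x + y).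
Proof. by move=> Sx Sy; rewrite -[x]scale1r; apply: hS.2. Qed.
Lemma subZ a x : S x -> S (a *: x).
Proof. by move=> Sx; rewrite -[_ *: x]addr0; apply: hS.2 => //; exact: sub0. Qed.
Lemma subN x : S x -> S (- x).
Proof. by move=> Sx; rewrite -scaleN1r; apply: subZ. Qed.
Lemma subB x y : S x -> S y -> S (x - y).
Proof. by move=> Sx Sy; apply: subD => //; apply: subN. Qed.
Lemma sub_sum (I : Type) (s : seq I) (P : pred I) (F : I -> V) :
  (forall i, P i -> S (F i)) -> S (\sum_(i <- s | P i) F i).
Proof. by move=> H; elim/big_ind: _ => //; [exact: sub0|exact: subD]. Qed.
Lemma subBC x y : S (x - y) -> S (y - x).
Proof. by move=> /subN; rewrite opprB. Qed.
(** The proof that [S] is a submodule is an argument of the type, so that the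
    module structure can be attached to the type. *)
Definition subT (_ : submodule S) : Type := {x : V | `[< S x >]}.
Local Notation T := (subT hS).
HB.instance Definition _ := Choice.on T.
HB.instance Definition _ := SubType.copy T {x : V | `[< S x >]}.
Definition insub_T x (Sx : S x) : T := exist _ x (asboolT Sx).
Let valS (x : T) : S (val x). Proof. by apply/asboolP; case: x. Qed.
Let T0 := insub_T sub0.
Let TN x := insub_T (subN (valS x)).
Let TD x y := insub_T (subD (valS x) (valS y)).
Let TZ a x := insub_T (subZ a (valS x)).
Let TDA : associative TD. Proof. by move=> *; apply: val_inj; exact: addrA. Qed.
Let TDC : commutative TD. Proof. by move=> *; apply: val_inj; exact: addrC. Qed.
Let T0D : left_id T0 TD. Proof. by move=> *; apply: val_inj; exact: add0r. Qed.
Let TND : left_inverse T0 TN TD.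
Proof. by move=> *; apply: val_inj; exact: addNr. Qed.
HB.instance Definition _ := GRing.isZmodule.Build T TDA TDC T0D TND.
Let TZA a b x : TZ a (TZ b x) = TZ (a * b) x.
Proof. by apply: val_inj; exact: scalerA. Qed.
Let TZ1 x : TZ 1 x = x. Proof. by apply: val_inj; exact: scale1r. Qed.
Let TZDr a x y : TZ a (x + y) = TZ a x + TZ a y.
Proof. by apply: val_inj; exact: scalerDr. Qed.
Let TZDl x a b : TZ (a + b) x = TZ a x + TZ b x.
Proof. by apply: val_inj; exact: scalerDl. Qed.
HB.instance Definition _ := GRing.Zmodule_isLmodule.Build R T TZA TZ1 TZDr TZDl.

Lemma sub_ex : exists (K : lmodType R) (f : {linear K -> V}),
  injective f /\ forall v, S v <-> exists k, f k = v.
Proof.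
have Hf : linear (fun x : T => val x) by [].
exists T, (Lin Hf); split; first exact: val_inj.
move=> v; split=> [Sv|[k <-]]; last exact: valS.
by exists (insub_T Sv).
Qed.

Let canon v := choose (fun w => `[< S (v - w) >]) v.
Let canonP v : S (v - canon v).
Proof.
apply/asboolP; apply: (@chooseP _ (fun w => `[< S (v - w) >])).
by apply/asboolP; rewrite subrr; exact: sub0.
Qed.
Let canon_eq v w : S (v - w) -> canon v = canon w.
Proof.
move=> Svw; rewrite /canon.
transitivity (choose (fun z => `[< S (w - z) >]) v); last first.
  apply: choose_id; apply/asboolP; first exact: subBC.
  by rewrite subrr; exact: sub0.
apply: eq_choose => z; apply/asboolP/asboolP => Sz.
  by rewrite -[w - z](subrKA v); apply: subD => //; exact: subBC.
by rewrite -[v - z](subrKA w); apply: subD.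
Qed.
Definition quotT (_ : submodule S) : Type := {v : V | canon v == v}.
Local Notation Q := (quotT hS).
HB.instance Definition _ := Choice.on Q.
HB.instance Definition _ := SubType.copy Q {v : V | canon v == v}.
Let canonK v : canon (canon v) == canon v.
Proof. by apply/eqP/canon_eq/subBC. Qed.
Let proj v : Q := exist _ (canon v) (canonK v).
Let projE v w : S (v - w) -> proj v = proj w.
Proof. by move=> /canon_eq e; apply: val_inj. Qed.
Let projK (x : Q) : proj (val x) = x.
Proof. by apply: val_inj; case: x => /= v /eqP. Qed.
Let QN (x : Q) := proj (- val x).
Let QD (x y : Q) := proj (val x + val y).
Let QZ a (x : Q) := proj (a *: val x).
Let QDE v w : QD (proj v) (proj w) = proj (v + w).
Proof.
apply: projE => /=.
by rewrite opprD addrACA; apply: subD; apply/subBC/canonP.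
Qed.
Let QNE v : QN (proj v) = proj (- v).
Proof. by apply: projE => /=; rewrite -opprD; apply/subN/subBC/canonP. Qed.
Let QZE a v : QZ a (proj v) = proj (a *: v).
Proof. by apply: projE => /=; rewrite -scalerBr; apply/subZ/subBC/canonP. Qed.
Let QDA : associative QD.
Proof. by move=> x y z; rewrite -[x]projK -[y]projK -[z]projK !QDE addrA. Qed.
Let QDC : commutative QD.
Proof. by move=> x y; rewrite -[x]projK -[y]projK !QDE addrC. Qed.
Let Q0D : left_id (proj 0) QD.
Proof. by move=> x; rewrite -[x]projK !QDE add0r. Qed.
Let QND : left_inverse (proj 0) QN QD.
Proof. by move=> x; rewrite -[x]projK QNE QDE addNr. Qed.
HB.instance Definition _ := GRing.isZmodule.Build Q QDA QDC Q0D QND.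
Let QZA a b x : QZ a (QZ b x) = QZ (a * b) x.
Proof. by rewrite -[x]projK !QZE scalerA. Qed.
Let QZ1 x : QZ 1 x = x. Proof. by rewrite -[x]projK !QZE scale1r. Qed.
Let QZDr a x y : QZ a (x + y) = QZ a x + QZ a y.
Proof.
by rewrite -[x]projK -[y]projK -![(_ + _ : Q)]/(QD _ _) !(QZE, QDE) scalerDr.
Qed.
Let QZDl x a b : QZ (a + b) x = QZ a x + QZ b x.
Proof.
by rewrite -[x]projK -![(_ + _ : Q)]/(QD _ _) !QZE QDE scalerDl.
Qed.
HB.instance Definition _ := GRing.Zmodule_isLmodule.Build R Q QZA QZ1 QZDr QZDl.

Lemma quot_ex : exists (W : lmodType R) (f : {linear V -> W}),
  surjective f /\ forall v, f v = 0 <-> S v.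
Proof.
have Hf : linear proj.
  by move=> a x y; rewrite -[RHS]/(QD (QZ _ _) _) QZE QDE.
exists Q, (Lin Hf); split=> [y|v]; first by exists (val y); exact: projK.
split=> [/(congr1 val)/= v0|Sv]; last first.
  by apply: projE; rewrite subr0.
have c0 : canon v = canon 0 by [].
have := canonP v; rewrite c0; have := canonP 0; rewrite sub0r.
by move=> S0 Sv; have := subB Sv S0; rewrite opprK subrK.
Qed.
End Submodule.

Lemma factor_surj U V W (g : {linear U -> V}) (h : {linear U -> W}) :
  surjective g -> (forall x, g x = 0 -> h x = 0) ->
  exists h' : {linear V -> W}, forall x, h' (g x) = h x.
Proof.
move=> gs ker; have [s sK] := choice gs.
have hE x y : g x = g y -> h x = h y.
  by move=> /eqP; rewrite -subr_eq0 -linearB => /eqP/ker/eqP;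
     rewrite linearB subr_eq0 => /eqP.
have [|h' h'E] := @linear_ex V W (fun y => h (s y)).
  by move=> a x y; rewrite -linearP; apply: hE; rewrite linearP !sK.
by exists h' => x; rewrite h'E; apply: hE.
Qed.

Lemma factor_inj U V W (f : {linear V -> W}) (h : {linear U -> W}) :
  injective f -> (forall x, exists y, f y = h x) ->
  exists h' : {linear U -> V}, forall x, f (h' x) = h x.
Proof.
move=> fi /choice[s sK]; have [|h' h'E] := @linear_ex U V s; last first.
  by exists h' => x; rewrite h'E.
by move=> a x y; apply: fi; rewrite linearP !sK linearP.
Qed.

Lemma lin_id U : exists h : {linear U -> U}, forall x, h x = x.
Proof. exact: linear_ex. Qed.

Lemma lin_zero U V : exists h : {linear U -> V}, forall x, h x = 0.
Proof. by apply: linear_ex => a x y; rewrite scaler0 addr0. Qed.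

Lemma lin_inl U V : exists h : {linear U -> (U * V)%type}, forall x, h x = (x, 0).
Proof. by apply: linear_ex => a x y; apply: (congr1 (pair _)); rewrite /= scaler0 addr0. Qed.

Lemma lin_inr U V : exists h : {linear V -> (U * V)%type}, forall x, h x = (0, x).
Proof. by apply: linear_ex => a x y; apply: (congr1 (pair^~ _)); rewrite /= scaler0 addr0. Qed.

Lemma lin_fst U V : exists h : {linear (U * V)%type -> U}, forall x, h x = x.1.
Proof. exact: linear_ex. Qed.

Lemma lin_snd U V : exists h : {linear (U * V)%type -> V}, forall x, h x = x.2.
Proof. exact: linear_ex. Qed.

Lemma ker0_inj U V (f : {linear U -> V}) : (forall x, f x = 0 -> x = 0) -> injective f.
Proof.
move=> ker x y /eqP; rewrite -subr_eq0 -linearB => /eqP/ker/eqP.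
by rewrite subr_eq0 => /eqP.
Qed.

Lemma lin_comp U V W (g : {linear V -> W}) (f : {linear U -> V}) :
  exists h : {linear U -> W}, forall x, h x = g (f x).
Proof. by apply: linear_ex => a x y; rewrite !linearP. Qed.

Lemma lin_sub U V (f g : {linear U -> V}) :
  exists h : {linear U -> V}, forall x, h x = f x - g x.
Proof.
by apply: linear_ex => a x y; rewrite 2!linearP scalerBr opprD addrACA.
Qed.

Lemma lin_add U V (f g : {linear U -> V}) :
  exists h : {linear U -> V}, forall x, h x = f x + g x.
Proof. by apply: linear_ex => a x y; rewrite !linearP scalerDr addrACA. Qed.

Lemma lin_scale U V (r : R) (f : {linear U -> V}) :
  exists h : {linear U -> V}, forall x, h x = r *: f x.
Proof.
by apply: linear_ex => a x y; rewrite linearP scalerDr !scalerA mulrC.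
Qed.

Lemma lin_pair U V W (f : {linear U -> W}) (g : {linear V -> W}) :
  exists h : {linear (U * V)%type -> W}, forall x, h x = f x.1 + g x.2.
Proof. by apply: linear_ex => a [x x'] [y y']; rewrite !linearP /= scalerDr addrACA. Qed.

Lemma lin_copair U V W (f : {linear U -> V}) (g : {linear U -> W}) :
  exists h : {linear U -> (V * W)%type}, forall x, h x = (f x, g x).
Proof. by apply: linear_ex => a x y; rewrite !linearP. Qed.

Lemma submodule_ker U V (f : {linear U -> V}) : submodule [set x | f x = 0].
Proof.
by split=> [|a x y /= fx fy]; [exact: linear0|rewrite linearP fx fy scaler0 addr0].
Qed.

Lemma submodule_im U V (f : {linear U -> V}) : submodule [set y | exists x, f x = y].
Proof.
split=> [|a x y [x' <-] [y' <-]]; first by exists 0; rewrite linear0.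
by exists (a *: x' + y'); rewrite linearP.
Qed.

Lemma ker_ex U V (f : {linear U -> V}) : exists (K : lmodType R) (i : {linear K -> U}),
  injective i /\ exact_at i f.
Proof. by have [K [i [ii iE]]] := sub_ex (submodule_ker f); exists K, i. Qed.

End Linear.

(** * Spans, Noetherian modules and Nakayama's lemma *)

Section Noeth.
Variable R : comPzRingType.
Implicit Types U V W : lmodType R.

Lemma in_tail (T : eqType) (x y : T) s : y \in s -> y \in x :: s.
Proof. by rewrite inE orbC => ->. Qed.

Fixpoint span V (s : seq V) : set V :=
  match s with
  | [::] => [set v | v = 0]
  | x :: s' => [set v | exists a w, span s' w /\ v = a *: x + w]
  end.

Lemma span_sub V (s : seq V) : submodule (span s).
Proof.
elim: s => [|x s IH]; first by split=> // a u v /= -> ->; rewrite scaler0 addr0.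
split=> [|a u v /= [b [w [sw ->]]] [c [z [sz ->]]]].
  by exists 0, 0; split; [exact: sub0|rewrite scale0r addr0].
exists (a * b + c), (a *: w + z); split; first exact: IH.2.
by rewrite scalerDr scalerDl !scalerA addrACA.
Qed.

Lemma span_tail V (x : V) s v : span s v -> span (x :: s) v.
Proof. by move=> sv; exists 0, v; split=> //; rewrite scale0r add0r. Qed.

Lemma span_mem V (s : seq V) x : x \in s -> span s x.
Proof.
elim: s => // y s IH; rewrite inE => /orP[/eqP->|/IH]; last exact: span_tail.
by exists 1, 0; split; [exact: sub0 (span_sub s)|rewrite scale1r addr0].
Qed.

Lemma span_min V (s : seq V) (S : set V) :
  submodule S -> (forall x, x \in s -> S x) -> span s `<=` S.
Proof.
move=> hS; elim: s => [|x s IH] sS v /=; first by move=> ->; exact: sub0.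
move=> [a [w [sw ->]]]; apply: hS.2; first by apply: sS; rewrite mem_head.
by apply: IH sw => y ys; apply: sS; rewrite inE ys orbT.
Qed.

Lemma span_catl V (s t : seq V) : span s `<=` span (s ++ t).
Proof.
apply: span_min (span_sub _) _ => x xs; apply: span_mem.
by rewrite mem_cat xs.
Qed.

Lemma span_catr V (s t : seq V) : span t `<=` span (s ++ t).
Proof.
apply: span_min (span_sub _) _ => x xs; apply: span_mem.
by rewrite mem_cat xs orbT.
Qed.

Definition subsum V (S T : set V) : set V :=
  [set v | exists x y, [/\ S x, T y & v = x + y]].

Lemma subsum_sub V (S T : set V) :
  submodule S -> submodule T -> submodule (subsum S T).
Proof.
move=> hS hT; split=> [|a u v /= [x [y [Sx Ty ->]]] [x' [y' [Sx' Ty' ->]]]].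
  by exists 0, 0; split; [exact: sub0|exact: sub0|rewrite addr0].
exists (a *: x + x'), (a *: y + y').
by rewrite scalerDr addrACA; split=> //; [apply: hS.2|apply: hT.2].
Qed.

Lemma subsuml V (S T : set V) : submodule T -> S `<=` subsum S T.
Proof. by move=> hT x Sx; exists x, 0; split=> //; [exact: sub0|rewrite addr0]. Qed.

Lemma subsumr V (S T : set V) : submodule S -> T `<=` subsum S T.
Proof. by move=> hS x Sx; exists 0, x; split=> //; [exact: sub0|rewrite add0r]. Qed.

Lemma span_im U V (f : {linear U -> V}) s y :
  span (map f s) y <-> exists x, span s x /\ f x = y.
Proof.
elim: s y => [|v s IH] y /=.
  by split=> [->|[x [-> <-]]]; [exists 0; split=> //|]; exact: linear0.
split=> [[a [w [/IH[x [sx <-]] ->]]]|[x [[a [w [sw ->]]] <-]]].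
  by exists (a *: v + x); split; [exists a, x|rewrite linearP].
by exists a, (f w); split; [apply/IH; exists w|rewrite linearP].
Qed.

Lemma generated_span V (A : set V) n :
  generated_by A n <-> exists s : seq V, size s = n /\ A = span s.
Proof.
have E (s : seq V) : span s = [set v | exists c : 'I_(size s) -> R,
    v = \sum_i c i *: s`_i].
  elim: s => [|x s IH]; apply/seteqP; split=> v /=.
  - by move=> ->; exists (fun _ => 0); rewrite big_ord0.
  - by move=> [c ->]; rewrite big_ord0.
  - rewrite IH => -[a [w [[c ->] ->]]].
    exists (fun i => if unlift ord0 i is Some j then c j else a).
    rewrite big_ord_recl unlift_none /=; congr (_ + _).
    by apply: eq_bigr => i _; rewrite liftK.
  - move=> [c ->]; rewrite big_ord_recl /=.
    exists (c ord0), (\sum_(i < size s) c (lift ord0 i) *: s`_i).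
    by split=> //; rewrite IH; exists (fun i => c (lift ord0 i)).
split=> [[x ->]|[s [<- ->]]]; last by exists (fun i => s`_i); exact: E.
have sz : size (codom x) = n by rewrite size_codom card_ord.
exists (codom x); split=> //; rewrite E sz.
have xE (i : 'I_n) : (codom x)`_i = x i.
  by rewrite (nth_map i) ?size_enum_ord // nth_ord_enum.
apply/seteqP; split=> v /= [c ->]; exists c; apply: eq_bigr => i _.
  by rewrite xE.
by rewrite xE.
Qed.

Lemma fin_gen_span V : fin_gen V <-> exists s : seq V, forall v, span s v.
Proof.
split=> [[n /generated_span[s [_ sE]]]|[s sP]].
  by exists s => v; rewrite -sE.
exists (size s); apply/generated_span; exists s; split=> //.
by apply/seteqP; split.
Qed.

Definition fg_submodule V (S : set V) : Prop := exists s : seq V, S = span s.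
Definition noeth V : Prop := forall S : set V, submodule S -> fg_submodule S.

Lemma ideal_submodule (I : set R) : ideal I <-> submodule (I : set R^o).
Proof.
split=> [[I0 ID IM]|hI].
  by split=> // a x y Ix Iy; apply: ID => //; apply: IM.
by split=> [|a b Ia Ib|a b Ib];
  [exact: (sub0 hI)|exact: (subD hI Ia Ib)|exact: (subZ hI a Ib)].
Qed.

Lemma gen_eq U V n (x : 'I_n -> U) (h h' : {linear U -> V}) :
  [set: U] = [set v | exists c : 'I_n -> R, v = \sum_i c i *: x i] ->
  (forall i, h (x i) = h' (x i)) -> forall u, h u = h' u.
Proof.
move=> xE hh u; have : [set: U] u by [].
rewrite xE => -[a ->]; rewrite !linear_sum; apply: eq_bigr => i _.
by rewrite !linearZ /= hh.
Qed.

(** [Hom(U, V)], as a submodule of a power of [V], which makes it finitely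
    generated when [V] is. *)
Definition hom_values U V n (x : 'I_n -> U) : set {ffun 'I_n -> V} :=
  [set phi | exists h : {linear U -> V}, forall i, phi i = h (x i)].

Lemma hom_values_sub U V n (x : 'I_n -> U) : submodule (@hom_values U V n x).
Proof.
split; first by have [z zE] := lin_zero U V; exists z => i; rewrite ffunE zE.
move=> a phi psi [h hE] [k kE]; have [ah ahE] := lin_scale a h.
have [l lE] := lin_add ah k; exists l => i.
by rewrite !ffunE hE kE lE ahE.
Qed.

Lemma noetherian_noeth : noetherian R -> noeth R^o.
Proof.
move=> nR S /ideal_submodule/nR[n /generated_span[s [_ ->]]].
by exists s.
Qed.

Lemma submoduleI V (S T : set V) :
  submodule S -> submodule T -> submodule (S `&` T).
Proof.
move=> hS hT; split=> [|a x y [Sx Tx] [Sy Ty]]; first by split; exact: sub0.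
by split; [exact: hS.2|exact: hT.2].
Qed.

(** A submodule of [span (v :: s)] is generated by its part inside [span s] and
    by lifts of generators of the ideal of its coefficients along [v]. *)
Lemma noeth_span V (nR : noeth R^o) (s : seq V) (S : set V) :
  submodule S -> S `<=` span s -> fg_submodule S.
Proof.
move=> hS; elim: s S hS => [|v s IH] S hS Ss.
  exists [::]; apply/seteqP; split=> // x /= ->; exact: sub0.
pose I : set R^o := [set a | exists w, span s w /\ S (a *: v + w)].
have hI : submodule I.
  split=> [|a b c [w [sw Sw]] [z [sz Sz]]].
    by exists 0; rewrite scale0r addr0; split; [exact: sub0 (span_sub s)|exact: sub0].
  exists (a *: w + z); split; first exact: (span_sub s).2.
  rewrite (_ : _ + _ = a *: (b *: v + w) + (c *: v + z)); first exact: hS.2.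
  by rewrite scalerDl scalerDr scalerA addrACA.
have [l lE] := nR _ hI.
have hSs : submodule (S `&` span s) by apply: submoduleI => //; exact: span_sub.
have [t tE] := IH _ hSs (fun x => @proj2 _ _).
have lift (l' : seq R^o) : (forall a, a \in l' -> I a) -> exists u : seq V,
    (forall x, x \in u -> S x) /\
    forall a, span l' a -> exists w, span s w /\ span u (a *: v + w).
  elim: l' => [|a l' IHl] lI.
    exists [::]; split=> // a /= ->; exists 0.
    by rewrite scale0r addr0; split=> //; exact: sub0 (span_sub s).
  have [u [uS uP]] := IHl (fun b bl => lI b (in_tail _ bl)).
  have [w [sw Sw]] := lI a (mem_head _ _).
  exists (a *: v + w :: u); split=> [x|b /= [c [d [/uP[z [sz uz]] ->]]]].
    by rewrite inE => /orP[/eqP->|/uS].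
  exists (c *: w + z); split; first exact: (span_sub s).2.
  exists c, (d *: v + z); split=> //.
  by rewrite scalerDl scalerDr scalerA addrACA.
have [|u [uS uP]] := lift l; first by move=> a al; rewrite lE; exact: span_mem.
exists (u ++ t); apply/seteqP; split=> [x Sx|]; last first.
  apply: span_min => // x; rewrite mem_cat => /orP[/uS//|xt].
  have : span t x by exact: span_mem.
  by rewrite -tE => -[].
have [a [w [sw xE]]] := Ss _ Sx.
have : I a by exists w; rewrite -xE.
rewrite lE => /uP[z [sz uz]].
rewrite -[x](subrK (a *: v + z)) addrC.
apply: subD; [exact: span_sub|exact: span_catl uz|].
apply: span_catr; rewrite -tE; split.
  apply: subB => //; apply: span_min uz => //.
rewrite xE opprD addrACA subrr add0r.
exact: (subB (span_sub s) sw sz).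
Qed.

Lemma fin_gen_noeth V : noeth R^o -> fin_gen V -> noeth V.
Proof.
move=> nR /fin_gen_span[s sP] S hS.
exact: noeth_span nR s S hS (fun v _ => sP v).
Qed.

Lemma fin_gen_surj U V (f : {linear U -> V}) :
  surjective f -> fin_gen U -> fin_gen V.
Proof.
move=> fs /fin_gen_span[s sP]; apply/fin_gen_span; exists (map f s) => v.
by have [u <-] := fs v; apply/span_im; exists u.
Qed.

Lemma fin_gen_inj U V (f : {linear U -> V}) :
  noeth R^o -> injective f -> fin_gen V -> fin_gen U.
Proof.
move=> nR fi gV; have [t tE] := fin_gen_noeth nR gV (submodule_im f).
have tP x : x \in t -> exists u, f u = x.
  by move=> xt; have := span_mem xt; rewrite -tE.
have [s sE] : exists s, map f s = t.
  elim: t tP {tE} => [|x t IH] tP; first by exists [::].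
  have [u uE] := tP x (mem_head _ _).
  have [s sE] := IH (fun y yt => tP y (in_tail _ yt)).
  by exists (u :: s); rewrite /= uE sE.
apply/fin_gen_span; exists s => u.
have : span t (f u) by rewrite -tE; exists u.
by rewrite -sE => /span_im[x [sx /fi <-]].
Qed.

Lemma fin_gen_ext U V W : short_exact U V W -> fin_gen U -> fin_gen W -> fin_gen V.
Proof.
move=> [f [g [fi fg gs]]] /fin_gen_span[s sP] /fin_gen_span[t tP].
have [t' t'E] : exists t', map g t' = t.
  elim: t {tP} => [|x t [t' t'E]]; first by exists [::].
  by have [y yE] := gs x; exists (y :: t'); rewrite /= yE t'E.
apply/fin_gen_span; exists (map f s ++ t') => v.
have : span t (g v) by exact: tP.
rewrite -t'E => /span_im[y [ty yE]].
have /fg[u uE] : g (v - y) = 0 by rewrite linearB yE subrr.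
rewrite -[v](subrK y) -uE; apply: subD; [exact: span_sub| |exact: span_catr].
by apply: span_catl; apply/span_im; exists u.
Qed.

Lemma fin_gen_prod U V : fin_gen U -> fin_gen V -> fin_gen (U * V)%type.
Proof.
have [f fE] := lin_inl U V.
have [g gE] := lin_snd U V.
apply: (@fin_gen_ext U (U * V)%type V); exists f, g; split.
- by move=> x y; rewrite !fE => -[].
- move=> [x y]; rewrite gE /=; split=> [->|[z]]; first by exists x.
  by rewrite fE => -[].
- by move=> y; exists (0, y); rewrite gE.
Qed.

(** A counterexample would start a strictly increasing sequence of
    counterexamples, whose union is finitely generated, hence reached. *)
Lemma noeth_ind V (P : set V -> Prop) : noeth V ->
  (forall S, submodule S ->
     (forall T, submodule T -> S `<=` T -> S <> T -> P T) -> P S) ->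
  forall S, submodule S -> P S.
Proof.
move=> nV step S0 hS0; apply: contrapT => nP0.
pose B := {S : set V | submodule S /\ ~ P S}.
have next (b : B) : exists c : B, sval b `<=` sval c /\ sval b <> sval c.
  case: b => S [hS nPS] /=; apply: contrapT => no; apply: nPS.
  apply: step => // T hT ST neST; apply: contrapT => nPT.
  by apply: no; exists (exist _ T (conj hT nPT)).
have [f fP] := choice next.
pose b0 : B := exist _ S0 (conj hS0 nP0).
pose c n : set V := sval (iter n f b0).
have cS n : c n `<=` c n.+1 by exact: (fP _).1.
have cN n : c n <> c n.+1 by exact: (fP _).2.
have cle m n : (m <= n)%N -> c m `<=` c n.
  move=> /subnK <-; elim: (n - m)%N => // k IH x /IH; exact: cS.
have hc n : submodule (c n) by exact: (proj2_sig (iter n f b0)).1.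
have hU : submodule (\bigcup_n c n).
  split; first by exists 0%N => //; exact: sub0.
  move=> a x y [n _ cx] [m _ cy]; exists (maxn n m) => //.
  apply: (hc _).2; first exact: cle (leq_maxl _ _) _ cx.
  exact: cle (leq_maxr _ _) _ cy.
have [s sE] := nV _ hU.
have [N sN] : exists N, forall x, x \in s -> c N x.
  have : forall x, x \in s -> (\bigcup_n c n) x.
    by move=> x xs; rewrite sE; exact: span_mem.
  elim: {sE} s => [|x s IH] sP; first by exists 0%N.
  have [N HN] := IH (fun y ys => sP y (in_tail _ ys)).
  have [M _ HM] := sP x (mem_head _ _).
  exists (maxn N M) => y; rewrite inE => /orP[/eqP->|/HN].
    exact: cle (leq_maxr _ _) _ HM.
  by move=> cy; exact: (cle _ _ (leq_maxl _ _) _ cy).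
apply: (cN N); apply/seteqP; split; first exact: cS.
apply: subset_trans (span_min (hc N) sN); rewrite -sE => x cx.
by exists N.+1.
Qed.

(** An impredicative form of the product, so that inclusions out of it are
    checked on the [a *: x] only. *)
Definition imul V (I : set R) (S : set V) : set V :=
  [set v | forall T, submodule T -> (forall a x, I a -> S x -> T (a *: x)) -> T v].

Lemma imul_sub V I (S : set V) : submodule (imul I S).
Proof.
split=> [T hT _|a x y Ix Iy T hT TP]; first exact: sub0.
by apply: hT.2; [exact: Ix|exact: Iy].
Qed.

Lemma imulM V I (S : set V) a x : I a -> S x -> imul I S (a *: x).
Proof. by move=> Ia Sx T hT; apply. Qed.

Lemma imul_min V I (S T : set V) : submodule T ->
  (forall a x, I a -> S x -> T (a *: x)) -> imul I S `<=` T.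
Proof. by move=> hT TP v; apply. Qed.

(** Nakayama's lemma at a prime [p], with a multiplier outside [p] in place of a
    localization. Induction on the generators: the first one is put into [T]
    while the others are dealt with, and then removed, because its own
    coefficient is invertible at [p]. *)
Lemma nakayama_at V (p : set R) (s : seq V) (T : set V) :
  prime_ideal p -> submodule T ->
  (forall v, span s v -> exists2 a, ~ p a & subsum T (imul p (span s)) (a *: v)) ->
  forall v, span s v -> exists2 a, ~ p a & T (a *: v).
Proof.
move=> [pI p1 pM]; have [p0 pD pZ] := pI.
elim: s T => [|v s IH] T hT H x.
  by move=> /= ->; exists 1 => //; rewrite scaler0; exact: sub0.
pose Tv := subsum T (span [:: v]).
have hTv : submodule Tv by apply: subsum_sub => //; exact: span_sub.
have pE : imul p (span (v :: s)) `<=`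
    [set z | exists y w, [/\ p y, imul p (span s) w & z = y *: v + w]].
  apply: imul_min => [|a z pa [b [w [sw ->]]]].
    split; first by exists 0, 0; split; [|exact: sub0 (imul_sub _ _)|rewrite scale0r addr0].
    move=> a z z' [y [w [py pw ->]]] [y' [w' [py' pw' ->]]].
    exists (a * y + y'), (a *: w + w'); split.
    - by apply: pD => //; exact: pZ.
    - exact: (imul_sub _ _).2.
    - by rewrite scalerDr scalerA scalerDl addrACA.
  exists (b * a), (a *: w); split; [exact: pZ|exact: imulM|].
  by rewrite scalerDr scalerA mulrC.
have vTv a : Tv (a *: v).
  apply: subsumr => //; exists a, 0; split=> //; by rewrite addr0.
have TTv : T `<=` Tv by apply: subsuml; exact: span_sub.
have Hs w : span s w -> exists2 a, ~ p a & Tv (a *: w).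
  apply: IH => // {}w sw; have [a pa [t [z [Tt /pE[y [z' [py pz' ->]]] aw]]]] :=
    H w (span_tail v sw).
  exists a => //; exists (t + y *: v), z'; split=> //.
    by apply: subD => //; exact: TTv.
  by rewrite aw addrA.
have Ts w : imul p (span s) w -> exists2 a, ~ p a &
    exists t y, [/\ T t, p y & a *: w = t + y *: v].
  move=> pw; apply: (pw [set w | exists2 a, ~ p a &
      exists t y, [/\ T t, p y & a *: w = t + y *: v]]).
    split.
      exists 1 => //; exists 0, 0; split; [exact: sub0|exact: p0|].
      by rewrite scaler0 scale0r addr0.
    move=> c z z' [a pa [t [y [Tt py e]]]] [a' pa' [t' [y' [Tt' py' e']]]].
    exists (a * a'); first by move=> /pM[].
    exists ((c * a') *: t + a *: t'), (c * a' * y + a * y'); split.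
    - by apply: hT.2 => //; exact: subZ.
    - by apply: pD; exact: pZ.
    - rewrite scalerDr; transitivity ((c * a') *: (a *: z) + a *: (a' *: z')).
        by rewrite !scalerA; congr (_ *: _ + _); ring.
      by rewrite e e' !scalerDr scalerDl !scalerA addrACA.
  move=> c z pc /Hs[a pa [t [_ [Tt [b [_ [-> ->]]] e]]]].
  rewrite addr0 in e.
  exists a => //; exists (c *: t), (c * b); split; first exact: subZ.
    by rewrite mulrC; exact: pZ.
  by rewrite scalerA [a * c]mulrC -(scalerA c a) e scalerDr !scalerA.
(* the coefficient of [v] on the right-hand side is in [p]: bring it to the left *)
have [b pb Tb] : exists2 a, ~ p a & T (a *: v).
  have [|a pa [t [z [Tt /pE[y [w [py pw ->]]] av]]]] := H v.
    by apply: span_mem; rewrite mem_head.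
  have [a' pa' [t' [y' [Tt' py' e']]]] := Ts _ pw.
  exists (a' * a - (a' * y + y')).
    by move=> /pD /(_ (pD _ _ (pZ a' _ py) py')); rewrite subrK => /pM[].
  suff -> : (a' * a - (a' * y + y')) *: v = a' *: t + t' by apply: hT.2.
  apply: (addIr ((a' * y + y') *: v)); rewrite scalerBl subrK -scalerA av.
  by rewrite !scalerDr e' scalerDl scalerA addrACA [_ + (y' *: v)]addrC addrA
     -addrA [y' *: v + _]addrC.
move=> [c [w [sw ->]]]; have [a pa [t [_ [Tt [d [_ [-> ->]]] e]]]] := Hs _ sw.
exists (b * a); first by move=> /pM[].
rewrite addr0 in e.
rewrite scalerDr -(scalerA b a w) e scalerDr !scalerA.
apply: subD => //.
  by rewrite (_ : b * a * c = (a * c) * b); [rewrite -scalerA; apply: subZ|ring].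
apply: subD => //; first exact: subZ.
by rewrite mulrC -scalerA; apply: subZ.
Qed.
End Noeth.

(** * Annihilation of Ext modules *)

Section Ext.
Variables (R : comPzRingType) (nR : noeth R^o).
Variables (I : set R) (hI : submodule (I : set R^o)).
Implicit Types K L M N P Q U V W X Y Z : lmodType R.

Definition killed N : Prop := forall a (x : N), I a -> a *: x = 0.

(** Projectivity over [R/I]. The modules over [R/I] are the [R]-modules killed
    by [I]; working with these lets [I] grow in an induction while the ring
    stays the same. The usual theory is the case [I = 0]. *)
Definition rproj P : Prop := killed P /\
  forall V W (g : {linear V -> W}) (h : {linear P -> W}), killed V ->
    surjective g -> exists h' : {linear P -> V}, forall x, g (h' x) = h x.

Definition cover K P N (f : {linear K -> P}) (g : {linear P -> N}) : Prop :=
  [/\ rproj P, injective f, exact_at f g & surjective g].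

(** [r Ext^{i+1}_{R/I}(N, M) = 0], stated by dimension shifting: [Ext^1(N, M)]
    is the cokernel of the restriction [Hom(P, M) -> Hom(K, M)], and
    [Ext^{i+2}(N, M)] is [Ext^{i+1}(K, M)]. *)
Fixpoint annExt (r : R) (i : nat) N M : Prop :=
  match i with
  | 0 => forall P K (f : {linear K -> P}) (g : {linear P -> N}), cover f g ->
      forall h : {linear K -> M}, exists h' : {linear P -> M},
        forall x, h' (f x) = r *: h x
  | i'.+1 => forall P K (f : {linear K -> P}) (g : {linear P -> N}), cover f g ->
      annExt r i' K M
  end.

Lemma killed_inj U V (f : {linear U -> V}) : injective f -> killed V -> killed U.
Proof. by move=> fi kV a x Ia; apply: fi; rewrite linearZ /= kV // linear0. Qed.

Lemma killed_surj U V (f : {linear U -> V}) : surjective f -> killed U -> killed V.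
Proof. by move=> fs kU a y Ia; have [x <-] := fs y; rewrite -linearZ /= kU // linear0. Qed.

Lemma killed_prod U V : killed U -> killed V -> killed (U * V)%type.
Proof.
move=> kU kV a [x y] Ia; have e1 := kU a x Ia; have e2 := kV a y Ia.
by rewrite -[LHS]/(a *: x, a *: y) e1 e2.
Qed.

Lemma rproj_retract P Q (f : {linear P -> Q}) (g : {linear Q -> P}) :
  (forall x, g (f x) = x) -> rproj Q -> rproj P.
Proof.
move=> gf [kQ lQ]; split; first exact: (killed_inj (can_inj gf) kQ).
move=> V W u h kV us; have [hg hgE] := lin_comp h g.
have [h' h'E] := lQ _ _ u hg kV us; have [k kE] := lin_comp h' f.
by exists k => x; rewrite kE h'E hgE gf.
Qed.

Lemma zero_ex : exists Z, zero_module Z.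
Proof. by exists {ffun 'I_0 -> R^o} => x; apply/ffunP => -[]. Qed.

Lemma zero_rproj Z : zero_module Z -> rproj Z.
Proof.
move=> z0; split=> [a x _|V W g h _ _]; first by rewrite (z0 (_ *: _)).
have [k kE] := lin_zero Z V.
by exists k => x; rewrite (z0 x) !linear0.
Qed.

Lemma lin_smul V (v : V) : exists f : {linear R^o -> V}, forall a, f a = a *: v.
Proof.
by apply: linear_ex => a x y; rewrite scalerDl -scalerA.
Qed.

(** A power of [R/I] is free over [R/I]: lift the images of the unit vectors. *)
Lemma cyclic_power_rproj Q (pi : {linear R^o -> Q}) n :
  surjective pi -> (forall a, pi a = 0 <-> I a) -> rproj {ffun 'I_n -> Q}.
Proof.
move=> pis piE.
have kQ : killed Q.
  move=> a y Ia; have [b <-] := pis y; rewrite -linearZ; apply/piE.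
  by rewrite /= [_ *: _]mulrC; apply: (subZ hI).
split=> [a f Ia|V W g h kV gs].
  by apply/ffunP => i; rewrite !ffunE kQ.
have [gi giE] := choice gs.
have [e eE] : exists e : 'I_n -> {ffun 'I_n -> Q}, forall i j,
    e i j = if i == j then pi 1 else 0.
  by exists (fun i => [ffun j => if i == j then pi 1 else 0]) => i j; rewrite ffunE.
have /choice[k kE] : forall i, exists k : {linear Q -> V},
    forall a, k (pi a) = a *: gi (h (e i)).
  move=> i; have [u uE] := lin_smul (gi (h (e i))).
  have [|k kE] := @factor_surj _ _ _ _ pi u pis.
    by move=> a /piE Ia; rewrite uE kV.
  by exists k => a; rewrite kE uE.
have [h' h'E] : exists h' : {linear {ffun 'I_n -> Q} -> V}, forall f,
    h' f = \sum_i k i (f i).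
  apply: linear_ex => a f f'; rewrite scaler_sumr -big_split.
  by apply: eq_bigr => i _; rewrite !ffunE linearP.
exists h' => f; rewrite h'E linear_sum /=.
rewrite (_ : f = \sum_i [ffun j => if i == j then f i else 0]); last first.
  apply/ffunP => j; rewrite sum_ffunE (bigD1 j) //= ffunE eqxx big1 ?addr0 // => i.
  by rewrite ffunE => /negbTE ->.
rewrite linear_sum; apply: eq_bigr => i _.
rewrite sum_ffunE (bigD1 i) //= ffunE eqxx big1 ?addr0; last first.
  by move=> j; rewrite ffunE => /negbTE ->.
have [a aE] := pis (f i); rewrite -aE kE linearZ /= giE -linearZ /=.
congr (h _); apply/ffunP => j; rewrite !ffunE eE.
by case: eqP => _; rewrite ?scaler0 // -linearZ /= /GRing.scale /= mulr1 aE.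
Qed.

Lemma fin_gen_cyclic Q (pi : {linear R^o -> Q}) : surjective pi -> fin_gen Q.
Proof.
move=> pis; apply: (fin_gen_surj pis); apply/fin_gen_span; exists [:: 1] => a.
by exists a, 0; rewrite addr0; split=> //; rewrite /GRing.scale /= mulr1.
Qed.

Lemma fin_gen_power Q n : fin_gen Q -> fin_gen {ffun 'I_n -> Q}.
Proof.
move=> gQ; elim: n => [|n IH].
  by apply/fin_gen_span; exists [::] => f; apply/ffunP => -[].
have [u uE] : exists u : {linear (Q * {ffun 'I_n -> Q})%type -> {ffun 'I_n.+1 -> Q}},
    forall x, u x = [ffun i => if unlift ord0 i is Some j then x.2 j else x.1].
  apply: linear_ex => a x y; apply/ffunP => i; rewrite !ffunE.
  by case: unlift => [j|] //; rewrite !ffunE.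
apply: (@fin_gen_surj _ _ _ u); last exact: fin_gen_prod.
move=> f; exists (f ord0, [ffun j => f (lift ord0 j)]); rewrite uE.
by apply/ffunP => i; rewrite ffunE; case: unliftP => [j ->|->] //; rewrite ffunE.
Qed.

Lemma free_cover_ex N : killed N -> fin_gen N ->
  exists n Q (pi : {linear R^o -> Q}) (K : lmodType R)
    (f : {linear K -> {ffun 'I_n -> Q}}) (g : {linear {ffun 'I_n -> Q} -> N}),
    [/\ surjective pi, forall a, pi a = 0 <-> I a, cover f g & fin_gen K].
Proof.
move=> kN [n [x xE]]; have [Q [pi [pis piE]]] := quot_ex hI.
have rP := @cyclic_power_rproj Q pi n pis piE.
have /choice[k kE] : forall i, exists k : {linear Q -> N},
    forall a, k (pi a) = a *: x i.
  move=> i; have [u uE] := lin_smul (x i).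
  have [|k kE] := @factor_surj _ _ _ _ pi u pis.
    by move=> a /piE Ia; rewrite uE kN.
  by exists k => a; rewrite kE uE.
have [g gE] : exists g : {linear {ffun 'I_n -> Q} -> N}, forall f,
    g f = \sum_i k i (f i).
  apply: linear_ex => a f f'; rewrite scaler_sumr -big_split.
  by apply: eq_bigr => i _; rewrite !ffunE linearP.
have [K [f [fi fg]]] := ker_ex g.
have gP := fin_gen_power n (fin_gen_cyclic pis).
exists n, Q, pi, K, f, g; split=> //; last exact: fin_gen_inj fi gP.
split=> // y; have : [set: N] y by [].
rewrite xE => -[c ->]; exists [ffun i => pi (c i)]; rewrite gE.
by apply: eq_bigr => i _; rewrite ffunE kE.
Qed.

Lemma cover_ex N : killed N -> fin_gen N ->
  exists P K (f : {linear K -> P}) (g : {linear P -> N}),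
    [/\ cover f g, fin_gen P & fin_gen K].
Proof.
move=> kN gN; have [n [Q [pi [K [f [g [pis piE c gK]]]]]]] := free_cover_ex kN gN.
by exists {ffun 'I_n -> Q}, K, f, g; split=> //; exact/fin_gen_power/(fin_gen_cyclic pis).
Qed.

(** [K'] is a summand of [K] in the stable category: the identity of [K']
    factors through [K], modulo maps that factor through a relative projective.
    This is what relates two syzygies of the same module. *)
Definition sretract K K' : Prop := exists P (al : {linear K -> K'})
  (be : {linear K' -> K}) (ga : {linear K' -> P}) (de : {linear P -> K'}),
  rproj P /\ forall x, x = al (be x) + de (ga x).

Lemma retract_sretract K K' (al : {linear K -> K'}) (be : {linear K' -> K}) :
  (forall x, al (be x) = x) -> sretract K K'.
Proof.
move=> ab; have [Z Z0] := zero_ex.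
have [ga gaE] := lin_zero K' Z.
have [de deE] := lin_zero Z K'.
exists Z, al, be, ga, de; split; first exact: zero_rproj.
by move=> x; rewrite ab deE addr0.
Qed.

Lemma cover_killed K P N (f : {linear K -> P}) (g : {linear P -> N}) :
  cover f g -> killed K.
Proof. by move=> [[kP _] fi _ _]; exact: killed_inj fi kP. Qed.

(** Lift all the maps to the covers. The error made on the identity of [Q']
    lands in [L'], so that its restriction to [L'] factors through [Q']. *)
Lemma sretract_syzygy K K' Q L Q' L' (f : {linear L -> Q}) (g : {linear Q -> K})
    (f' : {linear L' -> Q'}) (g' : {linear Q' -> K'}) :
  cover f g -> cover f' g' -> sretract K K' ->
  exists (bt : {linear Q' -> Q}) (aL : {linear L -> L'}) (bL : {linear L' -> L})
    (ep : {linear Q' -> L'}),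
    (forall x, bt (f' x) = f (bL x)) /\ (forall x, x = aL (bL x) + ep (f' x)).
Proof.
move=> [[kQ lQ] fi fg gs] [[kQ' lQ'] fi' fg' gs'].
move=> [P [al [be [ga [de [[kP lP] abcd]]]]]].
have [ag agE] := lin_comp al g; have [at_ atE] := lQ _ _ g' ag kQ' gs'.
have [bg bgE] := lin_comp be g'; have [bt btE] := lQ' _ _ g bg kQ gs.
have [dt dtE] := lP _ _ g' de kQ' gs'.
have [af afE] := lin_comp at_ f; have [bf bfE] := lin_comp bt f'.
have [|aL aLE] := @factor_inj _ _ _ _ f' af fi'.
  by move=> x; apply/fg'; rewrite afE atE agE (fg _).2 ?linear0 //; exists x.
have [|bL bLE] := @factor_inj _ _ _ _ f bf fi.
  by move=> x; apply/fg; rewrite bfE btE bgE (fg' _).2 ?linear0 //; exists x.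
have [e eE] : exists e : {linear Q' -> Q'}, forall x,
    e x = x - (at_ (bt x) + dt (ga (g' x))).
  have [i iE] := lin_id Q'.
  have [ab abE] := lin_comp at_ bt; have [gg ggE] := lin_comp ga g'.
  have [dg dgE] := lin_comp dt gg; have [s sE] := lin_add ab dg.
  have [e eE] := lin_sub i s.
  by exists e => x; rewrite eE iE sE abE dgE ggE.
have [|ep epE] := @factor_inj _ _ _ _ f' e fi'.
  move=> x; apply/fg'; rewrite eE linearB linearD atE agE btE bgE dtE.
  by rewrite -abcd subrr.
exists bt, aL, bL, ep; split=> x; first by rewrite bLE bfE.
apply: fi'; rewrite linearD aLE afE bLE bfE epE eE.
have -> : g' (f' x) = 0 by apply/fg'; exists x.
by rewrite !linear0 addr0 addrC subrK.
Qed.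

(** By [sretract_syzygy], the property of being a stable summand passes to the
    syzygies. *)
Lemma annExt_sretract r i M K K' : fin_gen K -> killed K -> sretract K K' ->
  annExt r i K M -> annExt r i K' M.
Proof.
elim: i K K' => [|i IH] K K' gK kK sr H Q' L' f' g' c'.
  have [Q [L [f [g [c _ gL]]]]] := cover_ex kK gK.
  have [bt [aL [bL [ep [btE LE]]]]] := sretract_syzygy c c' sr.
  move=> h; have [ha haE] := lin_comp h aL; have [e eE] := H _ _ _ _ c ha.
  have [e1 e1E] := lin_comp e bt; have [he heE] := lin_comp h ep.
  have [e2 e2E] := lin_scale r he; have [e' e'E] := lin_add e1 e2.
  exists e' => x; rewrite e'E e1E btE eE haE e2E heE -scalerDr -linearD.
  by rewrite -LE.
have [Q [L [f [g [c _ gL]]]]] := cover_ex kK gK.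
have [bt [aL [bL [ep [btE LE]]]]] := sretract_syzygy c c' sr.
apply: (IH L) => //; [exact: cover_killed c| |exact: H c].
by exists Q', aL, bL, f', ep; split=> //; case: c'.
Qed.

Lemma cover_sretract K P K' P' N (f : {linear K -> P}) (g : {linear P -> N})
    (f' : {linear K' -> P'}) (g' : {linear P' -> N}) :
  cover f g -> cover f' g' -> exists (bt : {linear P' -> P}) (aL : {linear K -> K'})
    (bL : {linear K' -> K}) (ep : {linear P' -> K'}),
    (forall x, bt (f' x) = f (bL x)) /\ (forall x, x = aL (bL x) + ep (f' x)).
Proof.
move=> c c'; have [i iE] := lin_id N.
apply: sretract_syzygy c c' _; apply: (@retract_sretract _ _ i i) => x.
by rewrite !iE.
Qed.

(** One cover suffices to test [annExt], because the syzygies of [N] for two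
    covers are stable summands of each other. *)
Lemma annExt0_cover r M K P N (f : {linear K -> P}) (g : {linear P -> N}) : cover f g ->
  (forall h : {linear K -> M}, exists h' : {linear P -> M},
     forall x, h' (f x) = r *: h x) -> annExt r 0 N M.
Proof.
move=> c H P' K' f' g' c' h; have [bt [aL [bL [ep [btE LE]]]]] := cover_sretract c c'.
have [ha haE] := lin_comp h aL; have [e eE] := H ha.
have [e1 e1E] := lin_comp e bt; have [he heE] := lin_comp h ep.
have [e2 e2E] := lin_scale r he; have [e' e'E] := lin_add e1 e2.
exists e' => x; rewrite e'E e1E btE eE haE e2E heE -scalerDr -linearD.
by rewrite -LE.
Qed.

Lemma annExtS_cover r i M K P N (f : {linear K -> P}) (g : {linear P -> N}) : cover f g ->
  fin_gen K -> annExt r i K M -> annExt r i.+1 N M.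
Proof.
move=> c gK H P' K' f' g' c'; have [bt [aL [bL [ep [btE LE]]]]] := cover_sretract c c'.
apply: annExt_sretract H => //; first exact: cover_killed c.
by exists P', aL, bL, f', ep; split=> //; case: c'.
Qed.

Lemma annExt_retract r i M X Y (f : {linear X -> Y}) (g : {linear Y -> X}) :
  killed Y -> fin_gen Y -> (forall x, g (f x) = x) -> annExt r i Y M -> annExt r i X M.
Proof. by move=> kY gY gf; apply: annExt_sretract => //; exact: retract_sretract gf. Qed.

Lemma cover_split K Q P (f : {linear K -> Q}) (g : {linear Q -> P}) :
  rproj P -> cover f g -> exists ep : {linear Q -> K}, forall x, ep (f x) = x.
Proof.
move=> rP [rQ fi fg gs]; have [i iE] := lin_id P; have [j jE] := lin_id Q.
have [s sE] := rP.2 _ _ g i rQ.1 gs; have [sg sgE] := lin_comp s g.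
have [e eE] := lin_sub j sg.
have [|ep epE] := @factor_inj _ _ _ _ f e fi.
  by move=> x; apply/fg; rewrite eE linearB sgE sE iE jE subrr.
exists ep => x; apply: fi; rewrite epE eE sgE jE.
have -> : g (f x) = 0 by apply/fg; exists x.
by rewrite linear0 subr0.
Qed.

Lemma annExt_rproj r i M P : rproj P -> annExt r i P M.
Proof.
elim: i P => [|i IH] P rP Q K f g c; have [ep epE] := cover_split rP c.
  move=> h; have [k kE] := lin_comp h ep; have [l lE] := lin_scale r k.
  by exists l => x; rewrite lE kE epE.
by case: c => rQ _ _ _; apply: IH; exact: rproj_retract epE rQ.
Qed.

Lemma annExt_mul r s i N M : annExt r i N M -> annExt (s * r) i N M.
Proof.
elim: i N => [|i IH] N H P K f g c; last by apply: IH; exact: H c.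
move=> h; have [h' h'E] := H _ _ _ _ c h; have [k kE] := lin_scale s h'.
by exists k => x; rewrite kE h'E scalerA.
Qed.

(** An extension [Z] of [X] by [K] is a pushout of a cover of [X]: it is the
    quotient of [K + Q] by the syzygy [L]. *)
Lemma annExt_extend r M K Z X (f : {linear K -> Z}) (g : {linear Z -> X}) :
  injective f -> exact_at f g -> surjective g -> killed Z -> fin_gen X ->
  annExt r 0 X M -> forall h : {linear K -> M}, exists h' : {linear Z -> M},
    forall x, h' (f x) = r *: h x.
Proof.
move=> fi fg gs kZ gX H h; have kX := killed_surj gs kZ.
have [Q [L [fL [gQ [c _ _]]]]] := cover_ex kX gX; have [[kQ lQ] fLi fgQ gQs] := c.
have [q qE] := lQ _ _ g gQ kZ gs; have [qf qfE] := lin_comp q fL.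
have [|l lE] := @factor_inj _ _ _ _ f qf fi.
  by move=> x; apply/fg; rewrite qfE qE; apply/fgQ; exists x.
have [hl hlE] := lin_comp h l; have [e eE] := H _ _ _ _ c hl.
have [p pE] := lin_pair f q; have [rh rhE] := lin_scale r h.
have [m mE] := lin_pair rh e.
have [| |h' h'E] := @factor_surj _ _ _ _ p m.
- move=> z; have [y yE] := gQs (g z).
  have /fg[k kE] : g (z - q y) = 0 by rewrite linearB qE yE subrr.
  by exists (k, y); rewrite pE /= kE subrK.
- move=> [k y]; rewrite pE mE /= => kq0.
  have /fgQ[x xE] : gQ y = 0.
    rewrite -qE -[q y](addKr (f k)) kq0 addr0 linearN.
    by rewrite (fg _).2 ?oppr0 //; exists k.
  have : f (k + l x) = 0 by rewrite linearD lE qfE xE.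
  rewrite -[RHS](linear0 f) => /fi kl.
  by rewrite -xE eE hlE rhE -scalerDr -linearD kl linear0 scaler0.
exists h' => x; transitivity (h' (p (x, 0))); first by rewrite pE /= linear0 addr0.
by rewrite h'E mE rhE /= linear0 addr0.
Qed.

Lemma short_exact_killed X Y Z : short_exact X Y Z -> killed Y -> killed X /\ killed Z.
Proof.
by move=> [f [g [fi _ gs]]] kY; split; [exact: killed_inj fi kY|exact: killed_surj gs kY].
Qed.

Lemma short_exact_fg X Y Z : short_exact X Y Z -> fin_gen Y -> fin_gen X /\ fin_gen Z.
Proof.
by move=> [f [g [fi _ gs]]] gY; split; [exact: fin_gen_inj fi gY|exact: fin_gen_surj gs gY].
Qed.

(** Rotating an exact sequence moves its outer terms to the middle; all the
    parts of the long exact sequence come from one of them in this way. *)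
Lemma short_exact_rotate X Y Z K P (f : {linear K -> P}) (g : {linear P -> Z}) :
  killed Y -> cover f g -> short_exact X Y Z -> short_exact K (X * P)%type Y.
Proof.
move=> kY [[kP lP] fi fg gs] [u [v [ui uv vs]]].
have [p pE] := lP _ _ v g kY vs; have [pf pfE] := lin_comp p f.
have [|l lE] := @factor_inj _ _ _ _ u pf ui.
  by move=> x; apply/uv; rewrite pfE pE; apply/fg; exists x.
have [z zE] := lin_zero K X.
have [nl nlE] := lin_sub z l; have [a aE] := lin_copair nl f.
have [b bE] := lin_pair u p; exists a, b; split.
- by move=> x y; rewrite !aE => -[_ /fi].
- move=> [x y]; rewrite bE /=; split=> [up0|[k]].
    have /fg[k kE] : g y = 0.
      rewrite -pE -[p y](addKr (u x)) up0 addr0 linearN.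
      by rewrite (uv _).2 ?oppr0 //; exists x.
    exists k; rewrite aE kE; congr pair; apply: ui.
    by rewrite nlE zE sub0r linearN lE pfE kE -[LHS]add0r -up0 addrK.
  by rewrite aE => -[<- <-]; rewrite nlE zE sub0r linearN lE pfE addNr.
- move=> y; have [x xE] := gs (v y).
  have /uv[w wE] : v (y - p x) = 0 by rewrite linearB pE xE subrr.
  by exists (w, x); rewrite bE /= wE subrK.
Qed.

Lemma annExt_addP r i M X P : killed X -> fin_gen X -> rproj P ->
  annExt r i X M -> annExt r i (X * P)%type M.
Proof.
move=> kX gX rP; apply: annExt_sretract => //.
have [al alE] := lin_inl X P.
have [de deE] := lin_inr X P.
have [be beE] := lin_fst X P.
have [ga gaE] := lin_snd X P.
exists P, al, be, ga, de; split=> // -[x y]; rewrite alE deE beE gaE.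
by apply: (congr2 pair); rewrite ?addr0 ?add0r.
Qed.

Lemma annExt_subP r i M X P : killed (X * P)%type -> fin_gen (X * P)%type ->
  annExt r i (X * P)%type M -> annExt r i X M.
Proof.
have [al alE] := lin_inl X P.
have [be beE] := lin_fst X P.
by move=> kXP gXP; apply: (@annExt_retract r i M X _ al be) => // x; rewrite beE alE.
Qed.

(** The long exact sequence of [Ext(-, M)], seen by annihilators: among three
    consecutive terms, the product of annihilators of the outer ones annihilates
    the middle one. Two of the three positions are obtained by a simultaneous
    induction on the degree. *)
Definition annExt_mid_at i := forall M r s X Y Z, killed Y -> fin_gen Y ->
  short_exact X Y Z -> annExt r i X M -> annExt s i Z M -> annExt (r * s) i Y M.
Definition annExt_left_at i := forall M r s X Y Z, killed Y -> fin_gen Y ->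
  short_exact X Y Z -> annExt r i Y M -> annExt s i.+1 Z M -> annExt (r * s) i X M.

(** For the cover [P -> Y -> Z] of [Z], the syzygy of [Z] is an extension of [X]
    by the syzygy [K] of [Y]: a map on [K] is extended to it, and then to
    [P]. *)
Lemma annExt_mid0 : annExt_mid_at 0.
Proof.
move=> M r s X Y Z kY gY E HX HZ; have [kX kZ] := short_exact_killed E kY.
have [gX gZ] := short_exact_fg E gY; case: E => u [v [ui uv vs]].
move=> P K f g [rP fi fg gs] h; have [vg vgE] := lin_comp v g.
have [KZ [fZ [fZi fZg]]] := ker_ex vg.
have [|k kE] := @factor_inj _ _ _ _ fZ f fZi.
  by move=> x; apply/fZg; rewrite vgE (fg _).2 ?linear0 //; exists x.
have [gf gfE] := lin_comp g fZ.
have [|w wE] := @factor_inj _ _ _ _ u gf ui.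
  by move=> x; apply/uv; rewrite gfE -vgE; apply/fZg; exists x.
have [||||h1 h1E] := @annExt_extend r M _ _ _ k w _ _ _ _ gX HX h.
- by move=> x y /(congr1 fZ); rewrite !kE => /fi.
- move=> y; split=> [w0|[x <-]].
    have /fg[x xE] : g (fZ y) = 0 by rewrite -gfE -wE w0 linear0.
    by exists x; apply: fZi; rewrite kE.
  by apply: ui; rewrite wE gfE kE linear0; apply/fg; exists x.
- move=> x; have [y yE] := gs (u x).
  have /fZg[z zE] : vg y = 0 by rewrite vgE yE; apply/uv; exists x.
  by exists z; apply: ui; rewrite wE gfE zE.
- exact: (killed_inj fZi rP.1).
have [|h2 h2E] := HZ _ _ fZ vg _ h1.
  split=> // z; have [y yE] := vs z; have [x xE] := gs y.
  by exists x; rewrite vgE xE.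
by exists h2 => x; rewrite -kE h2E h1E scalerA mulrC.
Qed.

(** This is the middle position in the rotated sequence. *)
Lemma annExt_left_of_mid i : annExt_mid_at i -> annExt_left_at i.
Proof.
move=> mid M r s X Y Z kY gY E HY HZ; have [kX kZ] := short_exact_killed E kY.
have [gX gZ] := short_exact_fg E gY.
have [P [K [f [g [c gP gK]]]]] := cover_ex kZ gZ.
have [rP _ _ _] := c.
have kXP := killed_prod kX rP.1; have gXP := fin_gen_prod gX gP.
apply: (annExt_subP kXP gXP); rewrite mulrC.
by apply: mid (short_exact_rotate kY c E) _ _ => //; exact: HZ c.
Qed.

(** The syzygy of [Y] is the first term of [0 -> K -> KZ -> X -> 0], where [KZ]
    is a syzygy of [Z]. *)
Lemma annExt_mid_of_left i : annExt_left_at i -> annExt_mid_at i.+1.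
Proof.
move=> left M r s X Y Z kY gY E HX HZ.
have [P [K [f [g [c gP gK]]]]] := cover_ex kY gY.
apply: (annExtS_cover c gK).
case: E => u [v [ui uv vs]]; case: c => rP fi fg gs; have [vg vgE] := lin_comp v g.
have [KZ [fZ [fZi fZg]]] := ker_ex vg.
have [|k kE] := @factor_inj _ _ _ _ fZ f fZi.
  by move=> x; apply/fZg; rewrite vgE (fg _).2 ?linear0 //; exists x.
have [gf gfE] := lin_comp g fZ.
have [|w wE] := @factor_inj _ _ _ _ u gf ui.
  by move=> x; apply/uv; rewrite gfE -vgE; apply/fZg; exists x.
rewrite mulrC; apply: (left M s r K KZ X _ _ _ _ HX).
- exact: (killed_inj fZi rP.1).
- exact: (fin_gen_inj nR fZi gP).
- exists k, w; split.
  + by move=> x y /(congr1 fZ); rewrite !kE => /fi.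
  + move=> y; split=> [w0|[x <-]].
      have /fg[x xE] : g (fZ y) = 0 by rewrite -gfE -wE w0 linear0.
      by exists x; apply: fZi; rewrite kE.
    by apply: ui; rewrite wE gfE kE linear0; apply/fg; exists x.
  + move=> x; have [y yE] := gs (u x).
    have /fZg[z zE] : vg y = 0 by rewrite vgE yE; apply/uv; exists x.
    by exists z; apply: ui; rewrite wE gfE zE.
- apply: (HZ _ _ fZ vg); split=> // z.
  by have [y yE] := vs z; have [x xE] := gs y; exists x; rewrite vgE xE.
Qed.

Lemma annExt_mid i : annExt_mid_at i.
Proof.
by elim: i => [|i IH]; [exact: annExt_mid0|exact/annExt_mid_of_left/annExt_left_of_mid].
Qed.

Lemma annExt_left i : annExt_left_at i.
Proof. exact/annExt_left_of_mid/annExt_mid. Qed.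

(** Rotate, then use [annExt_left]. *)
Lemma annExt_right i M r s X Y Z : killed Y -> fin_gen Y ->
  short_exact X Y Z -> annExt r i X M -> annExt s i.+1 Y M -> annExt (r * s) i.+1 Z M.
Proof.
move=> kY gY E HX HY; have [kX kZ] := short_exact_killed E kY.
have [gX gZ] := short_exact_fg E gY.
have [P [K [f [g [c gP gK]]]]] := cover_ex kZ gZ.
have [rP _ _ _] := c.
have kXP := killed_prod kX rP.1; have gXP := fin_gen_prod gX gP.
apply: (annExtS_cover c gK).
by apply: (annExt_left kXP gXP (short_exact_rotate kY c E) _ HY); apply: annExt_addP.
Qed.

(** The long exact sequence of [Ext(N, -)]. Each part is checked for [Ext^1], by
    lifting maps along [v] and correcting them by a map into [M1]; the syzygies
    of [N] give the other degrees. *)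
Lemma annExt2_mid i r s N M1 M M2 : killed M -> short_exact M1 M M2 ->
  annExt r i N M2 -> annExt s i N M1 -> annExt (r * s) i N M.
Proof.
move=> kM [u [v [ui uv vs]]]; elim: i N => [|i IH] N H2 H1 P K f g c; last first.
  by apply: IH; [exact: H2 c|exact: H1 c].
move=> h; have [vh vhE] := lin_comp v h; have [e2 e2E] := H2 _ _ _ _ c vh.
have [[kP lP] fi fg gs] := c; have [e eE] := lP _ _ v e2 kM vs.
have [ef efE] := lin_comp e f; have [rh rhE] := lin_scale r h.
have [d dE] := lin_sub rh ef.
have [|d1 d1E] := @factor_inj _ _ _ _ u d ui.
  by move=> x; apply/uv; rewrite dE linearB rhE linearZ /= efE eE e2E vhE subrr.
have [e1 e1E] := H1 _ _ _ _ c d1.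
have [ue ueE] := lin_comp u e1; have [se seE] := lin_scale s e.
have [k kE] := lin_add ue se; exists k => x.
rewrite kE ueE e1E seE linearZ /= d1E dE rhE efE -scalerDr subrK.
by rewrite scalerA mulrC.
Qed.

Lemma annExt2_right i r s N M1 M M2 : killed M -> fin_gen N -> killed N ->
  short_exact M1 M M2 ->
  annExt r i N M -> annExt s i.+1 N M1 -> annExt (r * s) i N M2.
Proof.
move=> kM + + [u [v [ui uv vs]]]; elim: i N => [|i IH] N gN kN H H1; last first.
  have [P [K [f [g [c gP gK]]]]] := cover_ex kN gN.
  apply: (annExtS_cover c gK); apply: IH => //; first exact: cover_killed c.
    exact: H c.
  exact: H1 c.
have [P [K [f [g [c gP gK]]]]] := cover_ex kN gN.
apply: (annExt0_cover c) => h.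
have [Q [L [fL [gQ [cK _ _]]]]] := cover_ex (cover_killed c) gK.
have [[kQ lQ] fLi fLg gQs] := cK; have [hg hgE] := lin_comp h gQ.
have [t tE] := lQ _ _ v hg kM vs; have [tf tfE] := lin_comp t fL.
have [|l lE] := @factor_inj _ _ _ _ u tf ui.
  move=> x; apply/uv; rewrite tfE tE hgE (fLg _).2 ?linear0 //; by exists x.
have [e1 e1E] := H1 _ _ _ _ c _ _ _ _ cK l.
have [st stE] := lin_scale s t; have [ue ueE] := lin_comp u e1.
have [t' t'E] := lin_sub st ue.
have [|k kE] := @factor_surj _ _ _ _ gQ t' gQs.
  move=> y /fLg[x <-]; rewrite t'E stE ueE e1E linearZ /= lE tfE subrr //.
have [e eE] := H _ _ _ _ c k; have [ve veE] := lin_comp v e.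
exists ve => x; rewrite veE eE linearZ /=.
have [y <-] := gQs x; rewrite kE t'E linearB stE ueE linearZ /= tE hgE.
by rewrite (uv _).2 ?subr0 ?scalerA //; exists (e1 y).
Qed.

Lemma annExt2_left i r s N M1 M M2 : killed M -> short_exact M1 M M2 ->
  annExt r i N M2 -> annExt s i.+1 N M -> annExt (r * s) i.+1 N M1.
Proof.
move=> kM [u [v [ui uv vs]]]; elim: i N => [|i IH] N H2 H P K f g c; last first.
  by apply: IH; [exact: H2 c|exact: H c].
move=> Q L fL gQ cK h; have [uh uhE] := lin_comp u h.
have [t tE] := H _ _ _ _ c _ _ _ _ cK uh; have [vt vtE] := lin_comp v t.
have [[kP lP] fi fg gs] := c; have [rQ fLi fLg gQs] := cK.
have [|d dE] := @factor_surj _ _ _ _ gQ vt gQs.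
  move=> y /fLg[x <-]; rewrite vtE tE linearZ /= uhE (uv _).2 ?scaler0 //.
  by exists (h x).
have [e eE] := H2 _ _ _ _ c d; have [e' e'E] := lP _ _ v e kM vs.
have [w wE] : exists w : {linear Q -> M}, forall x, w x = r *: t x - e' (f (gQ x)).
  have [rt rtE] := lin_scale r t; have [fg1 fg1E] := lin_comp f gQ.
  have [ef efE] := lin_comp e' fg1; have [w wE] := lin_sub rt ef.
  by exists w => x; rewrite wE rtE efE fg1E.
have [|m mE] := @factor_inj _ _ _ _ u w ui.
  move=> x; apply/uv; rewrite wE linearB linearZ /= -vtE -dE e'E eE subrr //.
exists m => x; apply: ui; rewrite mE wE tE uhE (fLg _).2; last by exists x.
by rewrite 2!linear0 subr0 !linearZ /= scalerA mulrC.
Qed.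

Lemma annExt2_retract i r N M M' (f : {linear M -> M'}) (g : {linear M' -> M}) :
  (forall x, g (f x) = x) -> annExt r i N M' -> annExt r i N M.
Proof.
move=> gf; elim: i N => [|i IH] N H P K u v c; last by apply: IH; exact: H c.
move=> h; have [fh fhE] := lin_comp f h; have [e eE] := H _ _ _ _ c fh.
have [ge geE] := lin_comp g e; exists ge => x.
by rewrite geE eE linearZ /= fhE gf.
Qed.

End Ext.

(** * Injective modules and injective dimension *)

Section Baer.
Variable R : comPzRingType.
Implicit Types U V W : lmodType R.

(** Partial linear maps are handled through their graphs, which are ordered by
    inclusion. *)
Definition partial_graph W U (G : set (W * U)%type) : Prop :=
  submodule G /\ forall u, G (0, u) -> u = 0.

Definition baer U : Prop := forall H : set (R^o * U)%type, partial_graph H ->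
  exists u0, forall a u, H (a, u) -> u = a *: u0.

Lemma partial_graph_fun W U (G : set (W * U)%type) w u u' : partial_graph G ->
  G (w, u) -> G (w, u') -> u = u'.
Proof.
move=> [hG fG] Gu Gu'; apply/eqP; rewrite -subr_eq0; apply/eqP/fG.
by have := subB hG Gu Gu'; rewrite (_ : _ - _ = (0, u - u')) //; congr pair; exact: subrr.
Qed.

(** Zorn's lemma. A maximal graph [G] is total: Baer's condition, for the ideal
    of the [a] with [a *: w] in the domain of [G], provides a value at [w]. *)
Lemma baer_extend U W (G0 : set (W * U)%type) : baer U -> partial_graph G0 ->
  exists h : {linear W -> U}, forall w u, G0 (w, u) -> h w = u.
Proof.
move=> bU pG0.
pose T := {G : set (W * U)%type | partial_graph G /\ G0 `<=` G}.
pose le (G G' : T) : bool := `[< sval G `<=` sval G' >].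
have [||||[G [pG G0G]] Gmax] := @Zorn T le.
- by move=> G; apply/asboolP.
- by move=> G1 G2 G3 /asboolP G12 /asboolP G23; apply/asboolP; exact: subset_trans G12 G23.
- move=> [F1 hF] [G hG] /asboolP/= FG /asboolP/= GF.
  have e : F1 = G by apply/seteqP.
  by subst G; congr exist; exact: Prop_irrelevance.
- move=> A Atot.
  have [[F AF]|A0] := pselect (exists F, A F); last first.
    exists (exist _ G0 (conj pG0 (@subset_refl _ _))) => F AF.
    by case: A0; exists F.
  have dir (F1 F2 : T) : A F1 -> A F2 -> exists G : T,
      [/\ A G, sval F1 `<=` sval G & sval F2 `<=` sval G].
    move=> A1 A2; have [/asboolP s12|/asboolP s21] := Atot _ _ A1 A2.
      by exists F2; split=> // z; exact: s12.
    by exists F1; split=> // z; exact: s21.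
  pose U0 : set (W * U)%type := [set z | exists2 F : T, A F & sval F z].
  have pU : partial_graph U0.
    split; first split.
    + by exists F => //; exact: sub0 (proj2_sig F).1.1.
    + move=> a x y [F1 A1 F1x] [F2 A2 F2y]; have [G [AG s1 s2]] := dir _ _ A1 A2.
      exists G => //; apply: (proj2_sig G).1.1.2; [exact: s1|exact: s2].
    + by move=> u [F1 A1] /(proj2_sig F1).1.2.
  have GU : G0 `<=` U0 by move=> z /(proj2_sig F).2 Fz; exists F.
  exists (exist _ U0 (conj pU GU)) => F1 AF1.
  by apply/asboolP => z /= F1z; exists F1.
have tot w : exists u, G (w, u).
  have [hG fG] := pG.
  have [|u0 u0P] := bU [set z : (R^o * U)%type | G ((z.1 : R) *: w, z.2)].
    split=> [|u /=]; last by rewrite scale0r => /fG.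
    split=> /= [|a [b u] [c v] /= Gb Gc]; first by rewrite scale0r; exact: sub0 hG.
    by have := hG.2 a _ _ Gb Gc; congr G; congr pair;
      rewrite /= scalerDl -[(a *: (b : R^o))]/(a * (b : R)) scalerA.
  (* the graph extended by the value [u0] at [w] *)
  pose G' : set (W * U)%type :=
    [set z | exists x u a, G (x, u) /\ z = (x + a *: w, u + a *: u0)].
  have pG' : partial_graph G'.
    split; first split.
    - exists 0, 0, 0; split; first exact: sub0 hG.
      by rewrite !scale0r !addr0.
    - move=> c _ _ [x [u [a [Gx ->]]]] [y [v [b [Gy ->]]]].
      exists (c *: x + y), (c *: u + v), (c * a + b); split.
        exact: (hG.2 c _ _ Gx Gy).
      congr pair => /=; by rewrite scalerDr scalerDl scalerA addrACA.
    - move=> u' [x [u [a [Gx [/esym/eqP xw ->]]]]].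
      move: xw; rewrite addr_eq0 => /eqP xE.
      have : G (a *: w, - u).
        have := subN hG Gx; congr G; congr pair => /=; by rewrite xE opprK.
      by move=> /(u0P a)/= <-; rewrite subrr.
  have GG' : G `<=` G'.
    move=> [x u] Gx; exists x, u, 0; split=> //; by rewrite !scale0r !addr0.
  have := Gmax (exist _ G' (conj pG' (subset_trans G0G GG'))).
  have /asboolP le1 : G `<=` G' by [].
  move=> /(_ le1) /(congr1 sval)/= <-; exists u0, 0, 0, 1; split; first exact: sub0 hG.
  by rewrite !scale1r !add0r.
have [s sE] := choice tot.
have [|h hE] := @linear_ex _ W U s.
  move=> a x y; apply: (partial_graph_fun pG (sE _)).
  exact: (pG.1.2 a _ _ (sE x) (sE y)).
exists h => w u Gwu; rewrite hE; apply: (partial_graph_fun pG (sE _)).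
exact: (G0G _ Gwu).
Qed.

Lemma baer_injective U : baer U -> injective_module U.
Proof.
move=> bU V W g h gi.
have [|h' h'E] := @baer_extend U W [set z | exists v, z = (g v, h v)] bU.
  split; first split.
  - by exists 0; rewrite !linear0.
  - move=> a _ _ [v ->] [w ->]; exists (a *: v + w).
    by congr pair; rewrite /= linearP.
  - move=> u [v [/esym]]; rewrite -(linear0 g) => /gi -> ->; exact: linear0.
by exists h' => x; apply: h'E; exists x.
Qed.

End Baer.

Section QmodZ.

Lemma additive_Zlin (V : zmodType) (D : lmodType int) (f : V -> D) :
  (forall x y, f (x + y) = f x + f y) ->
  exists g : {linear zmodule V -> D}, forall x, g x = f x.
Proof.
move=> fD; apply: (@linear_ex int (zmodule V) D f) => n x y.
rewrite [LHS]fD; congr (_ + _).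
have f0 : f 0 = 0 by apply: (addrI (f 0)); rewrite -fD !addr0.
have fN z : f (- z) = - f z by apply: (addrI (f z)); rewrite -fD !subrr.
have fM z k : f (z *+ k) = f z *+ k.
  by elim: k => [|k IH]; rewrite ?mulr0n // !mulrS fD IH.
rewrite -[n in RHS]intz scaler_int -[n *: x]/((x : V) *~ n).
by case: n => k; rewrite ?NegzE ?mulrNz ?fN -!pmulrn fM.
Qed.

Lemma int_ideal (J : set int^o) : submodule J ->
  exists n : int, J n /\ forall a, J a -> exists b, a = b * n.
Proof.
move=> hJ; have [[k0 [k0p Jk0]]|no] := pselect (exists k : nat, (0 < k)%N /\ J k%:Z).
  have ex : exists k : nat, (0 < k)%N && `[< J k%:Z >].
    by exists k0; rewrite k0p; apply/asboolP.
  case: (ex_minnP ex) => k /andP[kp /asboolP Jk] kmin.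
  exists k%:Z; split=> // a Ja; exists (a %/ k)%Z.
  have Jr : J (a %% k)%Z.
    have -> : (a %% k)%Z = a - (a %/ k)%Z * k by rewrite {2}(divz_eq a k) addrC addKr.
    by apply: (subB hJ) => //; apply: (subZ hJ (a %/ k)%Z).
  have rE := divz_eq a k; rewrite {1}rE.
  suff -> : (a %% k)%Z = 0 by rewrite addr0.
  have r0 : (0 <= (a %% k)%Z)%R by apply: modz_ge0; case: k kp {Jk kmin Jr rE}.
  have rk : ((a %% k)%Z < k%:Z)%R by apply: ltz_pmod; case: k kp {Jk kmin Jr rE r0}.
  case: (a %% k)%Z r0 rk Jr => // r _ rk Jr.
  case: r rk Jr => // r rk Jr.
  have : (k <= r.+1)%N by apply: kmin; apply/andP; split=> //; apply/asboolP.
  by rewrite leqNgt; move: rk; rewrite ltz_nat => ->.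
exists 0; split; first exact: sub0 hJ.
move=> a Ja; exists 0; rewrite mul0r; apply: contrapT => a0; apply: no.
case: a Ja a0 => k Jk k0; [exists k|exists k.+1]; split=> //.
  by case: k {Jk} k0.
by rewrite -[k.+1%:Z]opprK -NegzE; exact: (subN hJ).
Qed.

(** The group [Q/Z] is divisible, and has an element of each order. *)
Lemma QmodZ_ex : exists D : lmodType int, baer D /\ forall J : set int^o, submodule J -> ~ J 1 ->
    exists d : D, d <> 0 /\ forall a : int, J a -> a *: d = 0.
Proof.
pose Z : set (zmodule rat) := [set q : zmodule rat | exists n : int, n%:Q = q].
have scE (n : int) (q : zmodule rat) : n *: q = n%:Q * (q : rat).
  by rewrite -[LHS]/((q : rat) *~ n) mulrzl.
have hZ : submodule Z.
  split; first by exists 0.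
  move=> n _ _ [a <-] [b <-]; exists (n * a + b).
  by rewrite scE intrD intrM.
have [D [pi [pis piE]]] := quot_ex hZ; exists D; split.
  move=> H [hH fH].
  have [|n [[v Hv] nP]] := @int_ideal [set a | exists u, H (a, u)].
    split; first by exists 0; exact: sub0 hH.
    by move=> a b c [u Hu] [w Hw]; exists (a *: u + w); exact: (hH.2 a _ _ Hu Hw).
  have [n0|/eqP n0] := pselect (n = 0).
    exists 0 => a u Hau; have [|b ab] := nP a; first by exists u.
    by rewrite scaler0; apply: fH; move: Hau; rewrite ab n0 mulr0.
  have [q qE] := pis v; exists (pi ((q : rat) / n%:Q)) => a u Hau.
  have [|b ab] := nP a; first by exists u.
  have nv : n *: pi ((q : rat) / n%:Q) = v.
    rewrite -linearZ /= scE -qE; congr (pi _).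
    by rewrite mulrC divfK // intr_eq0.
  rewrite ab -scalerA nv; apply/eqP; rewrite -subr_eq0; apply/eqP/fH.
  have := subB hH Hau (subZ hH b Hv); congr H; congr pair.
  by rewrite /= ab -[b *: _]/(b * n) subrr.
move=> J hJ J1; have [n [Jn nP]] := int_ideal hJ.
(* take [1/2] if [J = 0], and [1/n] if [J = nZ] *)
have piN (q : zmodule rat) : ~ Z q -> pi q <> 0 by move=> nZ /piE.
have [n0|/eqP n0] := pselect (n = 0).
  exists (pi (2%:Q^-1 : rat)); split.
    apply: piN => -[k /(congr1 (fun x => x * 2%:Q))].
    rewrite mulVf // -intrM => /eqP; rewrite (eqr_int _ _ 1) => /eqP.
    by move: k => [[|[|k]]|[|k]].
  by move=> a /nP[b ->]; rewrite n0 mulr0 scale0r.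
have nQ : n%:Q != 0 by rewrite intr_eq0.
exists (pi (n%:Q^-1 : rat)); split.
  apply: piN => -[k /(congr1 (fun x => x * n%:Q))].
  rewrite mulVf // -intrM => /eqP; rewrite (eqr_int _ _ 1) => /eqP kn.
  by apply: J1; rewrite -kn; exact: (subZ hJ k Jn).
move=> a /nP[b ->]; rewrite -linearZ scE; apply/piE; exists b.
by rewrite intrM mulfK.
Qed.

End QmodZ.

Section Coinduced.
Variables (R : comPzRingType) (D : lmodType int) (X : Type).

(** The product over [X] of copies of [Hom(R, D)], for an abelian group [D]. *)
Record coind : Type := Coind {
  coind_fun :> X -> R -> D;
  coindD : forall x r s, coind_fun x (r + s) = coind_fun x r + coind_fun x s
}.

Lemma coind_eq (f g : coind) : (forall x r, f x r = g x r) -> f = g.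
Proof.
case: f g => [f fD] [g gD] /= fg; have e : f = g by apply/funext => x; apply/funext.
by subst g; congr Coind; exact: Prop_irrelevance.
Qed.

HB.instance Definition _ := gen_eqMixin coind.
HB.instance Definition _ := gen_choiceMixin coind.

Let c0 : coind.
Proof. by exists (fun _ _ => 0) => *; rewrite addr0. Defined.
Let cN (f : coind) : coind.
Proof. by exists (fun x r => - f x r) => *; rewrite coindD opprD. Defined.
Let cD (f g : coind) : coind.
Proof. by exists (fun x r => f x r + g x r) => *; rewrite !coindD addrACA. Defined.
Let cZ (a : R) (f : coind) : coind.
Proof. by exists (fun x r => f x (r * a)) => *; rewrite mulrDl coindD. Defined.
Let cDA : associative cD. Proof. by move=> *; apply: coind_eq => *; exact: addrA. Qed.
Let cDC : commutative cD. Proof. by move=> *; apply: coind_eq => *; exact: addrC. Qed.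
Let c0D : left_id c0 cD. Proof. by move=> *; apply: coind_eq => *; exact: add0r. Qed.
Let cND : left_inverse c0 cN cD.
Proof. by move=> *; apply: coind_eq => *; exact: addNr. Qed.
HB.instance Definition _ := GRing.isZmodule.Build coind cDA cDC c0D cND.
Let cZA a b f : cZ a (cZ b f) = cZ (a * b) f.
Proof. by apply: coind_eq => x r /=; rewrite mulrA. Qed.
Let cZ1 f : cZ 1 f = f.
Proof. by apply: coind_eq => x r /=; rewrite mulr1. Qed.
Let cZDr a f g : cZ a (f + g) = cZ a f + cZ a g.
Proof. by apply: coind_eq. Qed.
Let cZDl f a b : cZ (a + b) f = cZ a f + cZ b f.
Proof. by apply: coind_eq => x r /=; rewrite mulrDr coindD. Qed.
HB.instance Definition _ := GRing.Zmodule_isLmodule.Build R coind cZA cZ1 cZDr cZDl.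

(** Evaluation at [1] identifies the linear maps [V -> Hom(R, D)] with the
    additive maps [V -> D]. *)
Lemma coind_injective : baer D -> injective_module coind.
Proof.
move=> /baer_injective iD V W g h gi.
have [g' g'E] : exists g' : {linear zmodule V -> zmodule W}, forall x, g' x = g x.
  by apply: (@additive_Zlin V (zmodule W) g) => x y; exact: linearD.
have /choice[la laE] : forall x, exists la : {linear zmodule W -> D},
    forall v : V, la (g v) = h v x 1.
  move=> x; have [|u uE] := @additive_Zlin V D (fun v => h v x 1).
    by move=> v w; rewrite linearD.
  have [|k kE] := iD _ _ g' u; last by exists k => v; rewrite -g'E kE uE.
  by move=> v w; rewrite !g'E => /gi.
have cP w x r s : la x ((r + s) *: w : W) = la x (r *: w : W) + la x (s *: w : W).
  by rewrite scalerDl; exact: linearD.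
have [h' h'E] : exists h' : {linear W -> coind}, forall w x r,
    h' w x r = la x (r *: w : W).
  have [|h' h'E] := @linear_ex R W coind (fun w => Coind (cP w)); last first.
    by exists h' => w x r; rewrite h'E.
  move=> a v w; apply: coind_eq => x r /=.
  by rewrite scalerDr scalerA; exact: linearD.
exists h' => v; apply: coind_eq => x r.
by rewrite h'E -linearZ laE linearZ /= mul1r.
Qed.
End Coinduced.

Definition zI {R : comPzRingType} : set R := [set x | x = 0].

Section Enough.
Variable R : comPzRingType.
Implicit Types L M N E U V W C : lmodType R.

(** The characters [M -> Q/Z] separate the elements of [M]. *)
Lemma enough_injectives M : exists E (u : {linear M -> E}),
  injective_module E /\ injective u.
Proof.
have [D [bD Dt]] := QmodZ_ex; pose X := {linear zmodule M -> D}.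
have cP (m : M) (x : X) r s :
    x ((r + s) *: m : M) = x (r *: m : M) + x (s *: m : M).
  by rewrite scalerDl; exact: linearD.
have [u uE] : exists u : {linear M -> coind R D X}, forall m x r,
    u m x r = x (r *: m : M).
  have [|u uE] := @linear_ex R M (coind R D X) (fun m => Coind (cP m)); last first.
    by exists u => w x r; rewrite uE.
  move=> a v w; apply: coind_eq => x r /=.
  by rewrite scalerDr scalerA; exact: linearD.
exists (coind R D X), u; split; first exact: coind_injective.
apply: ker0_inj => m um0; apply: contrapT => m0.
have hJ : submodule [set a : int^o | (a : int) *: (m : zmodule M) = 0].
  split=> [|a b c /= b0 c0]; first by rewrite /= scale0r.
  by rewrite scalerDl -scalerA b0 c0 scaler0 addr0.
have [|d [d0 dJ]] := Dt _ hJ; first by rewrite /= scale1r.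
have [|x xE] := @baer_extend _ D (zmodule M)
    [set z | exists a : int, z = (a *: (m : zmodule M), a *: d)] bD.
  split; first split.
  - by exists 0; rewrite !scale0r.
  - move=> a _ _ [b ->] [c ->]; exists (a * b + c).
    by congr pair; rewrite /= scalerDl scalerA.
  - by move=> v [a [/esym am0 ->]]; exact: dJ.
apply: d0; have := uE m x 1; rewrite um0 scale1r.
move=> /esym e; have := xE m d; rewrite e; move=> <- //.
by exists 1; rewrite !scale1r.
Qed.

(** Injective dimension at most [n], through cosyzygies rather than
    resolutions. *)
Fixpoint idim_le n M : Prop :=
  match n with
  | 0 => injective_module M
  | n'.+1 => exists E C, [/\ injective_module E, short_exact M E C & idim_le n' C]
  end.

Lemma injective_retract M E (u : {linear M -> E}) (v : {linear E -> M}) :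
  (forall x, v (u x) = x) -> injective_module E -> injective_module M.
Proof.
move=> vu iE V W g h gi; have [uh uhE] := lin_comp u h.
have [k kE] := iE _ _ g uh gi; have [l lE] := lin_comp v k.
by exists l => x; rewrite lE kE uhE vu.
Qed.

Lemma idim_le_injdim n M : idim_le n M -> injdim_le M n.
Proof.
elim: n M => [|n IH] M /=.
  move=> iM; have [Z Z0] := zero_ex R.
  have [i iE] := lin_id M.
  pose J k : lmodType R := if k is 0 then M else Z.
  have iJ k : injective_module (J k).
    case: k => // k V W g h _.
    have [z zE] := lin_zero W Z.
    by exists z => x; rewrite [h x]Z0 zE.
  have dE k : exists d : {linear J k -> J k.+1}, forall x, d x = 0.
    by apply: linear_ex => a x y; rewrite scaler0 addr0.
  have [d d0] : {d : forall k, {linear J k -> J k.+1} & forall k x, d k x = 0}.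
    exists (fun k => sval (cid (dE k))) => k x; exact: (svalP (cid (dE k))).
  have e0 : exact_at i (d 0%N).
    by move=> y; rewrite d0; split=> // _; exists y; rewrite iE.
  have ex k : exact_at (d k) (d k.+1).
    by move=> y; split=> _; [exists 0; rewrite linear0 [y]Z0|rewrite d0].
  have ii : injective i by move=> x y; rewrite !iE.
  by exists (InjectiveResolution iJ ii e0 ex) => -[].
move=> [E [C [iE [u [v [ui uv vs]]] /IH[I I0]]]].
pose J k : lmodType R := if k is k'.+1 then I k' else E.
have iJ k : injective_module (J k) by case: k => // k; exact: ires_injective.
have [d0 d0E] := lin_comp (ires_coaug I) v.
pose d k : {linear J k -> J k.+1} := match k with 0 => d0 | k'.+1 => ires_d I k' end.
have e0 : exact_at u (d 0%N).
  move=> y /=; rewrite d0E; split=> [|/uv ->]; last exact: linear0.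
  by rewrite -[RHS](linear0 (ires_coaug I)) => /ires_inj/uv.
have ex k : exact_at (d k) (d k.+1).
  case: k => [|k] /=; last exact: (@ires_exact _ _ I).
  move=> y; split=> [/(@ires_exact0 _ _ I _)[c <-]|[x <-]].
    by have [x <-] := vs c; exists x; rewrite d0E.
  by apply/(@ires_exact0 _ _ I _); rewrite d0E; exists (v x).
exists (InjectiveResolution iJ ui e0 ex) => -[//|k] /=.
exact: I0.
Qed.

(** The cokernel of [M -> I 0] is resolved by the truncation of [I]. *)
Lemma injdim_idim_le n M : injdim_le M n -> idim_le n M.
Proof.
elim: n M => [|n IH] M [I I0] /=.
  have Is : surjective (ires_coaug I).
    by move=> y; apply/(@ires_exact0 _ _ I _); exact: I0.
  have [i iE] := lin_id M.
  have [|v vE] := @factor_surj _ _ _ _ (ires_coaug I) i Is.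
    by move=> x; rewrite -[RHS](linear0 (ires_coaug I)) => /ires_inj ->; rewrite linear0.
  apply: (@injective_retract _ _ (ires_coaug I) v); last exact: ires_injective.
  by move=> x; rewrite vE iE.
have [C [pi [pis piE]]] := quot_ex (submodule_im (ires_coaug I)).
exists (I 0%N), C; split; first exact: ires_injective.
  exists (ires_coaug I), pi; split=> //; exact: ires_inj.
apply: IH.
have [|c cE] := @factor_surj _ _ _ _ pi (ires_d I 0) pis.
  by move=> x /piE/(@ires_exact0 _ _ I _).
have ci : injective c.
  move=> x y; have [x' <-] := pis x; have [y' <-] := pis y; rewrite !cE => /eqP.
  rewrite -subr_eq0 -linearB => /eqP/(@ires_exact0 _ _ I _)/piE/eqP.
  by rewrite linearB subr_eq0 => /eqP.
have e0 : exact_at c (ires_d I 1).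
  move=> y; split=> [/(@ires_exact _ _ I _ _)[x <-]|[x <-]]; first by exists (pi x).
  by have [x' <-] := pis x; rewrite cE; apply/(@ires_exact _ _ I _ _); exists x'.
exists (InjectiveResolution (fun k => @ires_injective _ _ I k.+1) ci e0
  (fun k => @ires_exact _ _ I k.+1)) => k kn /=.
exact: I0.
Qed.

Lemma zero_ideal : submodule (@zI R : set R^o).
Proof. by split=> // a x y /= -> ->; rewrite scaler0 addr0. Qed.
Lemma killed0 N : killed (@zI R) N.
Proof. by move=> a x /= ->; rewrite scale0r. Qed.

Lemma free_cover N : noeth R^o -> fin_gen N ->
  exists (P K : lmodType R) (f : {linear K -> P}) (g : {linear P -> N}),
    [/\ cover (@zI R) f g, fin_gen P & fin_gen K].
Proof. by move=> nR; exact: (cover_ex nR zero_ideal (@killed0 N)). Qed.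

Lemma injective_annExt i N E : injective_module E -> annExt zI 1 i N E.
Proof.
move=> iE; elim: i N => [|i IH] N P K f g c; last exact: IH.
move=> h; have [_ fi _ _] := c; have [h' h'E] := iE _ _ f h fi.
by exists h' => x; rewrite h'E scale1r.
Qed.

(** Dimension shifting along the cosyzygies of [M]. *)
Lemma idim_le_annExt n M : idim_le n M -> forall N, annExt zI 1 n N M.
Proof.
elim: n M => [|n IH] M; first by move=> iM N; exact: injective_annExt.
move=> [E [C [iE S /IH H]]] N; rewrite -[1]mulr1.
exact: (annExt2_left (@killed0 E) S (H N) (injective_annExt n.+1 N iE)).
Qed.

Lemma rproj_free1 : rproj zI R^o.
Proof.
split; first exact: killed0.
move=> V W g h _ gs; have [v vE] := gs (h 1).
have [k kE] := lin_smul v; exists k => a.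
by rewrite kE linearZ /= vE -linearZ /= /GRing.scale /= mulr1.
Qed.

(** A partial map on [R] whose domain is the ideal [J] is a map from the first
    syzygy of [R/J]. *)
Lemma baer_of_annExt M :
  (forall J : set R^o, submodule J -> exists N (pi : {linear R^o -> N}),
     [/\ surjective pi, forall a, pi a = 0 <-> J a & annExt zI 1 0 N M]) -> baer M.
Proof.
move=> H G [hG fG].
have hJ : submodule [set a : R^o | exists u, G (a, u)].
  split; first by exists 0; exact: sub0 hG.
  by move=> a b c [u Hu] [w Hw]; exists (a *: u + w); exact: (hG.2 a _ _ Hu Hw).
have [N [pi [pis piE annExtN]]] := H _ hJ; have [K [f [fi fpi]]] := ker_ex pi.
have c : cover zI f pi by split=> //; exact: rproj_free1.
have /choice[h hE] : forall k, exists u, G (f k, u).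
  by move=> k; apply/piE/fpi; exists k.
have [|h' h'E] := @linear_ex R K M h.
  move=> a x y; apply: (@partial_graph_fun _ _ _ G (f (a *: x + y))) => //.
  by rewrite linearP; exact: (hG.2 a _ _ (hE x) (hE y)).
have [e eE] := annExtN _ _ _ _ c h'; exists (e 1) => a u Gau.
have /fpi[k kE] : pi a = 0 by apply/piE; exists u.
have -> : u = h k by apply: (@partial_graph_fun _ _ _ G a) => //; rewrite -kE.
rewrite -h'E -[h' k]scale1r -eE kE -linearZ /=; congr (e _).
by rewrite /GRing.scale /= mulr1.
Qed.

(** Dimension shifting reduces this to Baer's criterion for the [n]-th cosyzygy
    of [M], which only involves the cyclic modules. *)
Lemma idim_le_of_annExt n M : noeth R^o ->
  (forall J : set R^o, submodule J -> exists N (pi : {linear R^o -> N}),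
     [/\ surjective pi, forall a, pi a = 0 <-> J a & annExt zI 1 n N M]) -> idim_le n M.
Proof.
move=> nR; elim: n M => [|n IH] M H /=; first exact/baer_injective/baer_of_annExt.
have [E [u [iE ui]]] := enough_injectives M.
have [C [v [vs vE]]] := quot_ex (submodule_im u).
have S : short_exact M E C by exists u, v; split.
exists E, C; split=> //; apply: IH => J hJ.
have [N [pi [pis piE annExtN]]] := H _ hJ; exists N, pi; split=> //.
rewrite -[1]mulr1.
apply: (annExt2_right nR zero_ideal (@killed0 E) _ (@killed0 N) S _ annExtN).
  exact: fin_gen_cyclic pis.
exact: injective_annExt.
Qed.

End Enough.

(** * Annihilators of Ext computed from projective resolutions *)

Section Resolutions.
Variable R : comPzRingType.
Hypothesis nR : noeth R^o.
Implicit Types K L M N P Q : lmodType R.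

Lemma rproj_projective P : projective P <-> rproj (@zI R) P.
Proof.
split=> [pP|[_ lP] V W g h gs]; last exact: lP (@killed0 _ V) gs.
by split=> [|V W g h _ gs]; [exact: killed0|exact: pP].
Qed.

Lemma syzygy_resolution N (P : projective_resolution N) :
  exists K (f : {linear K -> P 0%N}) (e : {linear P 1%N -> K}),
  [/\ cover (@zI R) f (pres_aug P), surjective e, (forall x, f (e x) = pres_d P 0 x) &
      exact_at (pres_d P 1) e].
Proof.
have [K [f [fi fE]]] := ker_ex (pres_aug P).
have [|e eE] := @factor_inj _ _ _ _ f (pres_d P 0) fi.
  by move=> x; apply/fE/(@pres_exact0 _ _ P); exists x.
exists K, f, e; split=> //.
- split=> //; [exact/rproj_projective/pres_projective|exact: pres_surj].
- move=> k; have /(@pres_exact0 _ _ P)[x xE] : pres_aug P (f k) = 0 by apply/fE; exists k.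
  by exists x; apply: fi; rewrite eE.
- move=> y; split=> [ey|[x <-]].
    by apply/(@pres_exact _ _ P 0); rewrite -eE ey linear0.
  apply: fi; rewrite eE linear0; apply/(@pres_exact _ _ P 0).
  by exists x.
Qed.

Definition shift N (P : projective_resolution N) K (e : {linear P 1%N -> K})
    (es : surjective e) (ex : exact_at (pres_d P 1) e) : projective_resolution K :=
  @ProjectiveResolution _ K (fun i => P i.+1) (fun i => pres_d P i.+1) e
    (fun i => @pres_projective _ _ P i.+1) es ex (fun i => @pres_exact _ _ P i.+1).

(** A cocycle of degree [i.+1] is a cocycle of degree [i] for the truncated
    resolution of the first syzygy; in degree 1, it is a map on the syzygy. *)
Lemma annExt_kills_ext r i N M : annExt (@zI R) r i N M -> kills_ext r i.+1 N M.
Proof.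
elim: i N => [|i IH] N H P f fc; have [K [g [e [c es eE ex]]]] := syzygy_resolution P.
  have [|h hE] := @factor_surj _ _ _ _ e f es.
    by move=> x /ex[y <-]; exact: fc.
  have [k kE] := H _ _ _ _ c h; exists k => x.
  by rewrite -eE kE hE.
exact: (IH K (H _ _ _ _ c) (shift es ex) f fc).
Qed.

Lemma resolution_ex N : fin_gen N ->
  exists P : projective_resolution N, forall i, fin_gen (P i).
Proof.
pose T := {N : lmodType R | fin_gen N}.
have step (t : T) : exists (P : lmodType R) (K : T) (f : {linear sval K -> P})
    (g : {linear P -> sval t}), cover (@zI R) f g /\ fin_gen P.
  have [P [K [f [g [c gP gK]]]]] := free_cover nR (proj2_sig t).
  by exists P, (exist _ K gK), f, g.
pose cP t := sval (cid (step t)); pose sP t := svalP (cid (step t)).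
pose cK t := sval (cid (sP t)); pose sK t := svalP (cid (sP t)).
pose cf t := sval (cid (sK t)); pose sf t := svalP (cid (sK t)).
pose cg t := sval (cid (sf t)); pose sg t := svalP (cid (sf t)).
move=> gN; pose t0 : T := exist _ N gN; pose t n := iter n cK t0.
pose g i : {linear cP (t i) -> sval (t i)} := cg (t i).
pose f i : {linear sval (t i.+1) -> cP (t i)} := cf (t i).
have c i : cover (@zI R) (f i) (g i) by exact: (sg (t i)).1.
have gP i : fin_gen (cP (t i)) by exact: (sg (t i)).2.
have dE i : exists d : {linear cP (t i.+1) -> cP (t i)},
   forall x, d x = f i (g i.+1 x) by exact: lin_comp.
pose d i := sval (cid (dE i)).
have dP i x : d i x = f i (g i.+1 x) by exact: (svalP (cid (dE i))).
have pP i : projective (cP (t i)) by apply/rproj_projective; case: (c i).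
have gs i : surjective (g i) by case: (c i).
have fi i : injective (f i) by case: (c i).
have fg i : exact_at (f i) (g i) by case: (c i).
have e0 : exact_at (d 0%N) (g 0%N).
  move=> y; split=> [/fg[k <-]|[x <-]]; last by rewrite dP; apply/fg; eexists.
  by have [x <-] := gs 1%N k; exists x; rewrite dP.
have e1 i : exact_at (d i.+1) (d i).
  move=> y; rewrite dP; split=> [|[x <-]].
    rewrite -[RHS](linear0 (f i)) => /fi/fg[k <-].
    by have [x <-] := gs i.+2 k; exists x; rewrite dP.
  rewrite dP (fg _ _).2 ?linear0 //; by eexists.
by exists (@ProjectiveResolution _ N (fun i => cP (t i)) d (g 0%N) pP (gs 0%N) e0 e1).
Qed.

Lemma kills_ext_annExt r i N M : fin_gen N -> kills_ext r i.+1 N M -> annExt (@zI R) r i N M.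
Proof.
move=> gN H; have [P gP] := resolution_ex gN.
have {H} : forall f : {linear P i.+1 -> M}, ext_cocycle f ->
  ext_coboundary (fun x => r *: f x) by exact: H.
elim: i N P gP {gN} => [|i IH] N P gP H;
  have [K [g [e [c es eE ex]]]] := syzygy_resolution P.
  apply: (annExt0_cover c) => h; have [he heE] := lin_comp h e.
  have [|k kE] := H he.
    by move=> x; rewrite heE (ex _).2 ?linear0 //; exists x.
  by exists k => x; have [y <-] := es x; rewrite eE -kE heE.
apply: (annExtS_cover nR (zero_ideal R) c); first exact: fin_gen_surj es (gP 1%N).
apply: (IH K (shift es ex)) => [j|f fc]; first exact: gP.
exact: H.
Qed.

End Resolutions.

(** * Localization *)

Lemma fin_gen_free1 (R : comPzRingType) : fin_gen (R^o : lmodType R).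
Proof.
apply/fin_gen_span; exists [:: 1] => a; exists a, 0.
by rewrite addr0; split=> //; rewrite /GRing.scale /= mulr1.
Qed.

Section Loc.
Variables (R : comPzRingType) (p : Spec R).
Local Notation A := (loc_ring p).
Implicit Types K L M N P Q : lmodType R.

Definition lfrac (a : R) (s : den p) : A := @locfrac R p R^o a s.
Definition sc (a : R) : A := lfrac a (den1 p).
Definition dinv (s : den p) : A := lfrac 1 s.
Definition mu M (m : M) : loc p M := locfrac m (den1 p).

Lemma den_notin (s : den p) : ~ spec_set p (den_val s).
Proof. by case: s => s /=; rewrite /den_val /= notin_setE. Qed.

Lemma den_ex (a : R) : ~ spec_set p a -> exists s : den p, den_val s = a.
Proof. by rewrite -notin_setE => pa; exists (exist _ a pa). Qed.

Lemma den1E : den_val (den1 p) = 1. Proof. by []. Qed.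
Lemma denME (s t : den p) : den_val (denM s t) = den_val s * den_val t.
Proof. by []. Qed.

Lemma lfracZ M a s (m : M) t :
  lfrac a s *: (locfrac m t : loc p M) = locfrac (a *: m) (denM s t).
Proof. exact: loc_scaleE. Qed.

Lemma lfracM a s b t : lfrac a s * lfrac b t = lfrac (a * b) (denM s t).
Proof. exact: loc_scaleE. Qed.

Lemma locfrac_eq1 M (m m' : M) (s s' : den p) :
  den_val s' *: m = den_val s *: m' -> locfrac m s = locfrac m' s'.
Proof. by move=> e; apply/locfracP; exists (den1 p); rewrite den1E !mul1r. Qed.

Lemma muE M (m : M) s : locfrac m s = dinv s *: mu m.
Proof. by rewrite lfracZ scale1r; apply: locfrac_eq1; rewrite denME mulr1. Qed.

Lemma mu_eq0 M (m : M) : mu m = 0 <-> exists u : den p, den_val u *: m = 0.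
Proof.
rewrite -[0]/(locfrac 0 (den1 p) : loc p M).
split=> [/locfracP|] [u e]; last apply/locfracP; exists u.
  by move: e; rewrite den1E mulr1 scaler0.
by rewrite den1E mulr1 scaler0.
Qed.

Lemma muD M : {morph @mu M : x y / x + y}.
Proof.
by move=> x y; rewrite /mu locfracD; apply: locfrac_eq1; rewrite denME !den1E mul1r !scale1r.
Qed.

Lemma muZ M a (m : M) : mu (a *: m) = sc a *: mu m.
Proof. by rewrite lfracZ; apply: locfrac_eq1; rewrite denME !den1E mul1r. Qed.

Lemma scD a b : sc (a + b) = sc a + sc b.
Proof. exact: (@muD R^o). Qed.

Lemma scM a b : sc (a * b) = sc a * sc b.
Proof. by rewrite lfracM; apply: (@locfrac_eq1 R^o); rewrite denME !den1E mul1r. Qed.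

Lemma sc_dinv s : sc (den_val s) * dinv s = 1.
Proof.
rewrite lfracM; apply: (@locfrac_eq1 R^o).
by rewrite denME !den1E mul1r mulr1 /GRing.scale /= mul1r mulr1.
Qed.

Lemma dinv_sc s : dinv s * sc (den_val s) = 1.
Proof. by rewrite mulrC sc_dinv. Qed.

Lemma lfracE a s : lfrac a s = sc a * dinv s.
Proof. by rewrite lfracM; apply: (@locfrac_eq1 R^o); rewrite denME !den1E mul1r mulr1. Qed.

Lemma sc_inj (V : lmodType A) (s : den p) (x y : V) : sc (den_val s) *: x = sc (den_val s) *: y -> x = y.
Proof. by move=> e; rewrite -[x]scale1r -[y]scale1r -(dinv_sc s) -!scalerA e. Qed.

Lemma locfrac_ex M (x : loc p M) : exists m s, x = locfrac m s.
Proof. by exists (repr x).1, (repr x).2; rewrite locfrac_repr. Qed.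

Lemma sc_locfrac M (m : M) s : sc (den_val s) *: locfrac m s = mu m.
Proof. by rewrite muE scalerA sc_dinv scale1r. Qed.

(** Restriction of scalars along [R -> R_p]. *)
Definition restr (V : lmodType A) : Type := V.
Section Restr.
Variable V : lmodType A.
HB.instance Definition _ := GRing.Zmodule.on (restr V).
Let rZ (a : R) (x : restr V) : restr V := sc a *: (x : V).
Let rZA a b x : rZ a (rZ b x) = rZ (a * b) x.
Proof. by rewrite /rZ scM scalerA. Qed.
Let rZ1 x : rZ 1 x = x. Proof. exact: scale1r. Qed.
Let rZDr a x y : rZ a (x + y) = rZ a x + rZ a y. Proof. exact: scalerDr. Qed.
Let rZDl x a b : rZ (a + b) x = rZ a x + rZ b x.
Proof. by rewrite /rZ scD; exact: scalerDl. Qed.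
HB.instance Definition _ := GRing.Zmodule_isLmodule.Build R (restr V) rZA rZ1 rZDr rZDl.
Lemma restrZ a (x : restr V) : a *: x = sc a *: (x : V). Proof. by []. Qed.
End Restr.

Lemma mu_lin M : exists f : {linear M -> restr (loc p M)}, forall m, f m = mu m.
Proof. by apply: linear_ex => a x y; rewrite muD muZ. Qed.

(** The denominators act bijectively on [V], so a map into [V] is determined by,
    and extends from, its values on [M]. *)
Lemma loc_univ P (V : lmodType A) (k : {linear P -> restr V}) :
  exists k' : {linear loc p P -> V}, forall m, k' (mu m) = k m.
Proof.
pose F (x : loc p P) : V := dinv (repr x).2 *: (k (repr x).1 : V).
have FE m s : F (locfrac m s) = dinv s *: (k m : V).
  rewrite /F; have [u] := (locfracP _ _ _ _).1 (locfrac_repr (locfrac m s : loc p P)).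
  case: (repr _) => m' s' /= e.
  have := congr1 (fun x => (dinv u * dinv s * dinv s') *: (k x : V)) e.
  rewrite /= !linearZ /= !scM !scalerA.
  have -> : sc (den_val u) * sc (den_val s) * (dinv u * dinv s * dinv s') =
      (dinv u * sc (den_val u)) * (dinv s * sc (den_val s)) * dinv s' by ring.
  have -> : sc (den_val u) * sc (den_val s') * (dinv u * dinv s * dinv s') =
      (dinv u * sc (den_val u)) * (dinv s' * sc (den_val s')) * dinv s by ring.
  by rewrite !dinv_sc !mul1r.
have Fmu m : F (mu m) = k m by rewrite FE; exact: scale1r.
have [|k' k'E] := @linear_ex A (loc p P) V F; last by exists k' => m; rewrite k'E.
move=> a x y; have [b [t ->]] := @locfrac_ex R^o a.
have [m [s ->]] := locfrac_ex x; have [n [u ->]] := locfrac_ex y.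
rewrite -[(locfrac b t : loc p R^o)]/(lfrac b t) lfracZ locfracD !FE.
apply: (@sc_inj _ (denM (denM t s) u)).
rewrite scalerA sc_dinv scale1r linearD !linearZ /= !restrZ lfracE.
rewrite !denME !scM scalerDr !scalerA; congr (_ *: _ + _ *: _).
  transitivity (sc (den_val u) * sc b * (sc (den_val t) * dinv t) * (sc (den_val s) * dinv s)).
    by rewrite !sc_dinv !mulr1.
  by ring.
transitivity (sc (den_val t) * sc (den_val s) * (sc (den_val u) * dinv u)).
  by rewrite !sc_dinv !mulr1.
by ring.
Qed.

Lemma loc_uniq P (V : lmodType A) (f g : {linear loc p P -> V}) :
  (forall m, f (mu m) = g (mu m)) -> forall x, f x = g x.
Proof.
move=> fg x; have [m [s ->]] := locfrac_ex x.
by rewrite muE !linearZ /= fg.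
Qed.

Lemma loc_map M N (f : {linear M -> N}) :
  exists g : {linear loc p M -> loc p N}, forall m, g (mu m) = mu (f m).
Proof.
have [m mE] := mu_lin N; have [mf mfE] := lin_comp m f.
by have [g gE] := loc_univ mf; exists g => x; rewrite gE mfE mE.
Qed.

Lemma loc_inj M N (f : {linear M -> N}) (fp : {linear loc p M -> loc p N}) :
  (forall m, fp (mu m) = mu (f m)) -> injective f -> injective fp.
Proof.
move=> fpE fi; apply: ker0_inj => x.
have [m [s ->]] := locfrac_ex x; rewrite muE linearZ /= fpE => e.
have /mu_eq0[u] : mu (f m) = 0 by rewrite -[mu _]scale1r -(sc_dinv s) -scalerA e scaler0.
rewrite -linearZ -[RHS](linear0 f) => /fi um0.
by rewrite (mu_eq0 m).2 ?scaler0 //; exists u.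
Qed.

Lemma loc_surj M N (f : {linear M -> N}) (fp : {linear loc p M -> loc p N}) :
  (forall m, fp (mu m) = mu (f m)) -> surjective f -> surjective fp.
Proof.
move=> fpE fs y; have [n [s ->]] := locfrac_ex y; have [m <-] := fs n.
by exists (dinv s *: mu m); rewrite linearZ /= fpE -muE.
Qed.

Lemma loc_exact L M N (f : {linear L -> M}) (g : {linear M -> N})
    (fp : {linear loc p L -> loc p M}) (gp : {linear loc p M -> loc p N}) :
  (forall m, fp (mu m) = mu (f m)) -> (forall m, gp (mu m) = mu (g m)) ->
  exact_at f g -> exact_at fp gp.
Proof.
move=> fpE gpE fg y; split=> [|[x <-]].
  have [m [s ->]] := locfrac_ex y; rewrite muE linearZ /= gpE => e.
  have /mu_eq0[u] : mu (g m) = 0 by rewrite -[mu _]scale1r -(sc_dinv s) -scalerA e scaler0.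
  rewrite -linearZ => /fg[l lE]; exists (dinv s *: (dinv u *: mu l)).
  by rewrite !linearZ /= fpE lE muZ [dinv u *: _]scalerA dinv_sc scale1r.
have [l [s ->]] := locfrac_ex x; rewrite muE !linearZ /= fpE gpE.
by rewrite (fg _).2 ?scaler0 //; exists l.
Qed.

(** Lift over [R], after a restriction of scalars, then extend to the
    localization. *)
Lemma loc_rproj P : rproj (@zI R) P -> rproj (@zI A) (loc p P).
Proof.
move=> [_ lP]; split; first exact: killed0.
move=> V W g h _ gs; have [m mE] := mu_lin P.
have [hr hrE] : exists hr : {linear P -> restr W}, forall x, hr x = h (mu x).
  by apply: linear_ex => a x y; rewrite muD muZ linearP.
have [gr grE] : exists gr : {linear restr V -> restr W}, forall x, gr x = g x.
  by apply: linear_ex => a x y; exact: linearP.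
have [|k kE] := lP _ _ gr hr (@killed0 _ _).
  by move=> y; have [x xE] := gs y; exists x; rewrite grE.
have [k' k'E] := loc_univ k; exists k' => x.
have [gk gkE] := lin_comp g k'; rewrite -gkE; apply: loc_uniq x => x.
by rewrite gkE k'E -grE kE hrE.
Qed.

Lemma loc_cover K P N (f : {linear K -> P}) (g : {linear P -> N}) :
  cover (@zI R) f g -> exists (fp : {linear loc p K -> loc p P})
    (gp : {linear loc p P -> loc p N}),
    [/\ cover (@zI A) fp gp, forall x, fp (mu x) = mu (f x) &
        forall x, gp (mu x) = mu (g x)].
Proof.
move=> [rP fi fg gs]; have [fp fpE] := loc_map f; have [gp gpE] := loc_map g.
exists fp, gp; split=> //; split.
- exact: loc_rproj.
- exact: loc_inj fpE fi.
- exact: loc_exact fpE gpE fg.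
- exact: loc_surj gpE gs.
Qed.

Lemma mu_span M (l : seq M) m : span l m -> span (map (@mu M) l) (mu m).
Proof.
elim: l m => [|x l IH] m /=; first by move=> ->.
by move=> [a [w [/IH lw ->]]]; exists (sc a), (mu w); rewrite muD muZ.
Qed.

Lemma loc_fin_gen M : fin_gen M -> fin_gen (loc p M).
Proof.
move=> /fin_gen_span[l lP]; apply/fin_gen_span; exists (map (@mu M) l) => x.
by have [m [s ->]] := locfrac_ex x; rewrite muE; apply: (subZ (span_sub _)); apply: mu_span.
Qed.

Definition contract (J : set A) : set R := [set a | J (sc a)].

Lemma contract_sub (J : set A) : submodule (J : set A^o) ->
  submodule (contract J : set R^o).
Proof.
move=> hJ; split; first exact: sub0 hJ.
by move=> a x y Jx Jy; rewrite /contract /= scD scM; exact: (hJ.2 (sc a) _ _ Jx Jy).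
Qed.

Lemma contractE (J : set A) a s : submodule (J : set A^o) ->
  J (lfrac a s) <-> contract J a.
Proof.
move=> hJ; rewrite lfracE; split=> H; last by rewrite mulrC; exact: (subZ hJ).
have := subZ hJ (sc (den_val s)) H; congr J; rewrite /GRing.scale /=.
by rewrite mulrCA sc_dinv mulr1.
Qed.

Lemma lfrac_ex (x : A) : exists a s, x = lfrac a s.
Proof. exact: (@locfrac_ex R^o x). Qed.

(** An ideal of [R_p] is generated by the image of its contraction. *)
Lemma loc_noeth : noeth R^o -> noeth A^o.
Proof.
move=> nR J hJ; have [l lE] := nR _ (contract_sub hJ).
exists (map (fun a => sc a : A^o) l); apply/seteqP; split=> [x|].
  have [a [s ->]] := lfrac_ex x => /(contractE _ _ hJ) Ja.
  rewrite lfracE mulrC; apply: (subZ (span_sub _)).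
  have : span l a by rewrite -lE.
  elim: l a {lE Ja} => [|b l IH] a /=; first by move=> ->.
  by move=> [c [w [/IH lw ->]]]; exists (sc c), (sc w); rewrite scD scM.
apply: span_min => // x /mapP[a al ->].
by have : span l a by [exact: span_mem]; rewrite -lE.
Qed.

Lemma den_prod M (l : seq M) : (forall x, x \in l -> mu x = 0) ->
  exists u : den p, forall x, span l x -> den_val u *: x = 0.
Proof.
elim: l => [|x l IH] H; first by exists (den1 p) => x /= ->; rewrite scaler0.
have [u uP] := IH (fun y yl => H y (in_tail _ yl)).
have /mu_eq0[v vx] := H x (mem_head _ _).
exists (denM u v) => y [a [w [/uP uw ->]]].
rewrite denME scalerDr.
have -> : (den_val u * den_val v) *: (a *: x) = (den_val u * a) *: (den_val v *: x).
  by rewrite !scalerA; congr (_ *: _); ring.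
by rewrite vx scaler0 add0r mulrC -scalerA uw scaler0.
Qed.

Lemma common_den M (l : seq (loc p M)) : exists t : den p, forall x, x \in l ->
  exists m, mu m = sc (den_val t) *: x.
Proof.
elim: l => [|x l [t tP]]; first by exists (den1 p).
have [m [s xE]] := locfrac_ex x; exists (denM s t) => y.
rewrite inE => /orP[/eqP->|/tP[n nE]].
  by exists (den_val t *: m); rewrite muZ denME scM mulrC -scalerA xE sc_locfrac.
by exists (den_val s *: n); rewrite muZ nE denME scM scalerA.
Qed.

(** [K] is finitely presented: clear the denominators of the images of the
    generators, then multiply once more to kill the finitely many relations. *)
Lemma hom_loc K M (h : {linear loc p K -> loc p M}) : noeth R^o -> fin_gen K ->
  exists (t : den p) (h0 : {linear K -> M}), forall k, mu (h0 k) = sc (den_val t) *: h (mu k).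
Proof.
move=> nR [n [x xE]].
have [t tP] := common_den (codom (fun i => h (mu (x i)))).
have /choice[m mE] : forall i, exists m, mu m = sc (den_val t) *: h (mu (x i)).
  by move=> i; apply: tP; apply: codom_f.
have [g gE] : exists g : {linear {ffun 'I_n -> R^o} -> K}, forall f,
    g f = \sum_i (f i : R) *: x i.
  apply: linear_ex => a f f'; rewrite scaler_sumr -big_split.
  by apply: eq_bigr => i _; rewrite !ffunE scalerDl scalerA.
have [ph phE] : exists g : {linear {ffun 'I_n -> R^o} -> M}, forall f,
    g f = \sum_i (f i : R) *: m i.
  apply: linear_ex => a f f'; rewrite scaler_sumr -big_split.
  by apply: eq_bigr => i _; rewrite !ffunE scalerDl scalerA.
have gs : surjective g.
  move=> k; have : [set: K] k by []. 
  by rewrite xE => -[c ->]; exists [ffun i => c i]; rewrite gE; apply: eq_bigr => i _; rewrite ffunE.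
have key f : mu (ph f) = sc (den_val t) *: h (mu (g f)).
  have mu_sum (V : lmodType R) (F : 'I_n -> V) : mu (\sum_i F i) = \sum_i mu (F i).
    by have [e eE] := mu_lin V; rewrite -eE (linear_sum e); apply: eq_bigr => i _; rewrite eE.
  rewrite phE gE !mu_sum linear_sum scaler_sumr; apply: eq_bigr => i _.
  by rewrite !muZ linearZ /= mE !scalerA mulrC.
have gF := fin_gen_power n (@fin_gen_free1 R).
have [l lE] := fin_gen_noeth nR gF (submodule_ker g).
have [|u uP] := @den_prod M (map ph l).
  move=> _ /mapP[f fl ->]; rewrite key.
  have -> : g f = 0 by have : span l f by [exact: span_mem]; rewrite -lE.
  by rewrite (_ : mu 0 = 0) ?linear0 ?scaler0.
have [uph uphE] := lin_scale (den_val u) ph.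
have [|h0 h0E] := @factor_surj _ _ _ _ g uph gs.
  move=> f gf0; rewrite uphE; apply: uP; apply/span_im; exists f; split=> //.
  by rewrite -lE.
exists (denM u t), h0 => k; have [f <-] := gs k.
by rewrite h0E uphE muZ key denME scM scalerA.
Qed.

(** Half of the fact that [Ext] commutes with localization: a map [K_p -> M_p]
    comes from a map [K -> M], up to a denominator. *)
Lemma annExt_loc r i N M : noeth R^o -> fin_gen N -> ~ spec_set p r ->
  annExt (@zI R) r i N M -> annExt (@zI A) 1 i (loc p N) (loc p M).
Proof.
move=> nR + /den_ex[s <-] {r}; elim: i N => [|i IH] N gN H.
  have [P [K [f [g [c gP gK]]]]] := free_cover nR gN.
  have [fp [gp [cp fpE gpE]]] := loc_cover c.
  apply: (annExt0_cover cp) => h; have [t [h0 h0E]] := hom_loc h nR gK.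
  have [e eE] := H _ _ _ _ c h0; have [ep epE] := loc_map e.
  have [k kE] := lin_scale (dinv t * dinv s) ep.
  exists k => x; rewrite scale1r.
  have [kf kfE] := lin_comp k fp; rewrite -kfE; apply: loc_uniq x => x.
  rewrite kfE kE fpE epE eE muZ h0E !scalerA.
  have -> : dinv t * dinv s * (sc (den_val s) * sc (den_val t)) =
    (dinv t * sc (den_val t)) * (dinv s * sc (den_val s)) by ring.
  by rewrite !dinv_sc ?mul1r scale1r.
have [P [K [f [g [c gP gK]]]]] := free_cover nR gN.
have [fp [gp [cp fpE gpE]]] := loc_cover c.
apply: (annExtS_cover (loc_noeth nR) (zero_ideal _) cp (loc_fin_gen gK)).
by apply: IH => //; exact: H c.
Qed.

(** Each map [K -> M] extends to [P] up to a multiplier outside [p], found after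
    localization. A single multiplier serves for all of them, because
    [Hom(K, M)] is finitely generated. *)
Lemma loc_annExt i N M : noeth R^o -> fin_gen N -> fin_gen M ->
  annExt (@zI A) 1 i (loc p N) (loc p M) -> exists2 r, ~ spec_set p r & annExt (@zI R) r i N M.
Proof.
move=> nR + gM; elim: i N => [|i IH] N gN H;
  have [P [K [f [g [c gP gK]]]]] := free_cover nR gN;
  have [fp [gp [cp fpE gpE]]] := loc_cover c; last first.
  have [r pr Hr] := IH K gK (H _ _ _ _ cp); exists r => //.
  exact: (annExtS_cover nR (zero_ideal R) c gK Hr).
have gK' := gK; case: gK' => n [x xE].
have single (h : {linear K -> M}) : exists (u : den p) (e : {linear P -> M}),
    forall k, e (f k) = den_val u *: h k.
  have [hp hpE] := loc_map h; have [e eE] := H _ _ _ _ cp hp.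
  have [t [e0 e0E]] := hom_loc e nR gP.
  have [ef efE] := lin_comp e0 f; have [th thE] := lin_scale (den_val t) h.
  have [d dE] := lin_sub ef th.
  have [|u uP] := @den_prod M (map d (codom x)).
    move=> _ /mapP[k _ ->]; rewrite dE efE thE.
    have [m mE] := mu_lin M; rewrite -mE linearB !mE e0E -fpE eE scale1r hpE muZ.
    exact: subrr.
  have [ue ueE] := lin_scale (den_val u) e0.
  exists (denM u t), ue => k; rewrite ueE denME -scalerA -efE -thE.
  apply/eqP; rewrite -subr_eq0 -scalerBr -dE; apply/eqP/uP/span_im.
  exists k; split=> //; have : [set: K] k by [].
  rewrite xE => -[a ->]; apply: (sub_sum (span_sub _)) => i _.
  by apply: (subZ (span_sub _)); apply/span_mem/codom_f.
have [l lE] := fin_gen_noeth nR (fin_gen_power n gM) (hom_values_sub M x).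
have [u uP] : exists u : den p, forall phi, span l phi -> exists (h : {linear K -> M})
    (e : {linear P -> M}), (forall i, phi i = h (x i)) /\
    forall k, e (f k) = den_val u *: h k.
  have : forall phi, phi \in l -> hom_values x phi by move=> phi pl; rewrite lE; exact: span_mem.
  elim: l {lE} => [|phi l IHl] lS.
    exists (den1 p) => _ ->; have [z zE] := lin_zero K M.
    have [z' z'E] := lin_zero P M.
    by exists z, z'; split=> i; rewrite ?ffunE ?zE ?z'E ?scaler0.
  have [u uP] := IHl (fun y yl => lS y (in_tail _ yl)).
  have [h hE] := lS phi (mem_head _ _); have [v [e eE]] := single h.
  exists (denM u v) => _ [a [w [/uP[h' [e' [wE e'E]]] ->]]].
  have [ah ahE] := lin_scale a h; have [k kE] := lin_add ah h'.
  have [ue ueE] := lin_scale (den_val u * a) e; have [ve' ve'E] := lin_scale (den_val v) e'.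
  have [q qE] := lin_add ue ve'; exists k, q; split=> [i|y].
    by rewrite !ffunE hE wE kE ahE.
  rewrite qE ueE ve'E eE e'E denME kE ahE scalerDr !scalerA.
  by congr (_ *: _ + _ *: _); ring.
exists (den_val u); first exact: den_notin.
apply: (annExt0_cover c) => h.
have [|h' [e [h'E eE]]] := uP [ffun i => h (x i)].
  by rewrite -lE; exists h => i; rewrite ffunE.
exists e => k; rewrite eE; congr (_ *: _); apply: (gen_eq xE) => i.
by rewrite -h'E ffunE.
Qed.

Lemma loc_quot N (pi : {linear R^o -> N}) : surjective pi ->
  exists q : {linear A^o -> loc p N}, surjective q /\
    forall a s, q (lfrac a s) = 0 <-> exists u : den p, pi (den_val u * a) = 0.
Proof.
move=> pis; have [pp ppE] := loc_map pi.
have [q qE] : exists q : {linear A^o -> loc p N}, forall x, q x = pp (x : loc p R^o).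
  by apply: linear_ex => a x y; exact: (linearP pp).
exists q; split=> [y|a s].
  by have [x <-] := loc_surj ppE pis y; exists x; rewrite qE.
rewrite qE (_ : pp _ = dinv s *: mu (pi a)); last by rewrite -ppE -linearZ -muE.
transitivity (mu (pi a) = 0).
  split=> [e|->]; last exact: scaler0.
  by rewrite -[mu _]scale1r -(sc_dinv s) -scalerA e scaler0.
by rewrite mu_eq0; split=> -[u e]; exists u; move: e; rewrite -linearZ.
Qed.

Lemma injdim_loc_annExt M n : noeth R^o -> fin_gen M -> injdim_le (loc p M) n ->
  forall N, fin_gen N -> exists2 r, ~ spec_set p r & annExt (@zI R) r n N M.
Proof. by move=> nR gM /injdim_idim_le/idim_le_annExt H N gN; apply: loc_annExt. Qed.

(** Each cyclic module over [R_p] is the localization of a cyclic module over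
    [R], given by the contraction of its annihilator. *)
Lemma annExt_injdim_loc M n : noeth R^o -> (forall N, fin_gen N ->
  exists2 r, ~ spec_set p r & annExt (@zI R) r n N M) -> injdim_le (loc p M) n.
Proof.
move=> nR H; apply: idim_le_injdim; apply: idim_le_of_annExt; first exact: loc_noeth.
move=> J hJ; have [N [pi [pis piE]]] := quot_ex (contract_sub hJ).
have [q [qs qE]] := loc_quot pis.
have gN := fin_gen_cyclic pis; have [r pr Hr] := H N gN.
exists (loc p N), q; split=> //; last exact: annExt_loc nR gN pr Hr.
move=> x; have [a [s ->]] := lfrac_ex x.
rewrite qE (contractE _ _ hJ); split=> [[u /piE]|Ja]; last first.
  by exists (den1 p); apply/piE; rewrite den1E mul1r.
rewrite /contract /= scM => Ja.
have := subZ hJ (dinv u) Ja; congr J; rewrite /GRing.scale /=.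
by rewrite mulrA dinv_sc mul1r.
Qed.
End Loc.

(** * Primes, chains and regular sequences in Noetherian rings *)

Section Primes.
Variable R : comPzRingType.
Hypothesis nR : noeth R^o.
Implicit Types (I J K L N P Q m : set R) (a b c s t x y : R).
Local Notation idl I := (submodule (I : set R^o)).

Lemma idl0 I : idl I -> I 0. Proof. by move=> h; exact: (@sub0 R R^o I h). Qed.
Lemma idlD I x y : idl I -> I x -> I y -> I (x + y). Proof. by move=> h; exact: (@subD R R^o I h x y). Qed.
Lemma idlB I x y : idl I -> I x -> I y -> I (x - y). Proof. by move=> h; exact: (@subB R R^o I h x y). Qed.
Lemma idlM I a x : idl I -> I x -> I (a * x). Proof. by move=> h Ix; exact: (@subZ R R^o I h a x Ix). Qed.
Lemma idlMr I a x : idl I -> I x -> I (x * a).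
Proof. by rewrite mulrC; exact: idlM. Qed.
Lemma idl_ex I : I 0 -> (forall a x y, I x -> I y -> I (a * x + y)) -> idl I.
Proof. by []. Qed.

Lemma prime_idl P : prime_ideal P -> idl P.
Proof. by move=> [/ideal_submodule]. Qed.
Lemma prime1 P : prime_ideal P -> ~ P 1. Proof. by case. Qed.
Lemma primeM P a b : prime_ideal P -> ~ P a -> ~ P b -> ~ P (a * b).
Proof. by move=> [_ _ h] Pa Pb /h[]. Qed.
Lemma primeX P a n : prime_ideal P -> P (a ^+ n) -> P a.
Proof.
move=> hP; elim: n => [|n IH]; first by rewrite expr0 => /(prime1 hP).
by rewrite exprS; case: hP => _ _ h /h[//|/IH].
Qed.

Definition adj I x : set R := [set y | exists i a, I i /\ y = i + a * x].
Fixpoint adjs I (xs : seq R) : set R :=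
  if xs is x :: xs' then adjs (adj I x) xs' else I.

Lemma adj_idl I x : idl I -> idl (adj I x).
Proof.
move=> hI; apply: idl_ex => [|a _ _ [i [b [Ii ->]]] [j [c [Ij ->]]]].
  by exists 0, 0; rewrite mul0r addr0; split=> //; exact: idl0.
exists (a * i + j), (a * b + c); split; first by apply: idlD => //; exact: idlM.
by rewrite mulrDr mulrDl mulrA addrACA.
Qed.

Lemma adj_sub I x : I `<=` adj I x.
Proof. by move=> i Ii; exists i, 0; rewrite mul0r addr0. Qed.

Lemma adj_mem I x : idl I -> adj I x x.
Proof. by move=> hI; exists 0, 1; rewrite mul1r add0r; split=> //; exact: idl0. Qed.

Lemma adj_min I J x : idl J -> I `<=` J -> J x -> adj I x `<=` J.
Proof. by move=> hJ IJ Jx _ [i [a [/IJ Ji ->]]]; apply: idlD => //; exact: idlM. Qed.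

Lemma adj_mono I J x : I `<=` J -> adj I x `<=` adj J x.
Proof. by move=> IJ _ [i [a [/IJ Ji ->]]]; exists i, a. Qed.

Lemma adjs_sub I xs : I `<=` adjs I xs.
Proof.
elim: xs I => [|x xs IH] I //=; exact: subset_trans (@adj_sub I x) (IH _).
Qed.

Lemma adjs_idl I xs : idl I -> idl (adjs I xs).
Proof. by elim: xs I => [|x xs IH] I hI //=; apply/IH/adj_idl. Qed.

(** An ideal that is maximal among those avoiding [S] is prime. *)
Lemma krull_prime I (S : set R) : idl I -> S 1 ->
  (forall a b, S a -> S b -> S (a * b)) -> (forall a, S a -> ~ I a) ->
  exists P, [/\ prime_ideal P, I `<=` P & forall a, S a -> ~ P a].
Proof.
move=> hI S1 SM; move: I hI.
apply: (noeth_ind (V := R^o) (P := fun I => (forall a, S a -> ~ I a) ->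
  exists P, [/\ prime_ideal P, I `<=` P & forall a, S a -> ~ P a])) => // I hI IH dis.
have [pI|npI] := pselect (prime_ideal I); first by exists I; split.
have [a [b [Iab Ia Ib]]] : exists a b, [/\ I (a * b), ~ I a & ~ I b].
  apply: contrapT => no; apply: npI; split; [exact/ideal_submodule|by move=> I1; apply: (dis 1)|].
  move=> a b Iab; apply: contrapT => /not_orP[Ia Ib]; apply: no; by exists a, b.
have grow x : ~ I x -> (forall c, S c -> ~ adj I x c) ->
    exists P, [/\ prime_ideal P, I `<=` P & forall a, S a -> ~ P a].
  move=> Ix dx; have [|P [pP IP SP]] := IH (adj I x) (adj_idl _ hI) (@adj_sub I x) _ dx.
    by move=> e; apply: Ix; rewrite e; exact: adj_mem.
  by exists P; split=> //; apply: subset_trans IP; exact: adj_sub.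
have [da|] := pselect (forall c, S c -> ~ adj I a c); first exact: grow Ia da.
have [db|] := pselect (forall c, S c -> ~ adj I b c); first by move=> _; exact: grow Ib db.
move=> /existsNP[s /not_implyP[Ss /contrapT[i [c [Ii sE]]]]].
move=> /existsNP[t /not_implyP[St /contrapT[j [d [Ij tE]]]]].
exfalso; apply: (dis _ (SM _ _ Ss St)); rewrite sE tE.
rewrite (_ : _ * _ = (j + d * a) * i + (c * b) * j + (c * d) * (a * b)); last by ring.
by apply: idlD => //; [apply: idlD => //; exact: idlM|exact: idlM].
Qed.

Definition sat P J : set R := [set a | exists2 s, ~ P s & J (s * a)].

Lemma sat_idl P J : prime_ideal P -> idl J -> idl (sat P J).
Proof.
move=> pP hJ; apply: idl_ex => [|a x y [s Ps Jsx] [t Pt Jty]].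
  by exists 1; [exact: prime1|rewrite mulr0; exact: idl0].
exists (s * t); first exact: primeM.
rewrite (_ : _ * _ = (t * a) * (s * x) + s * (t * y)); last by ring.
by apply: idlD => //; exact: idlM.
Qed.

Lemma sat_sub P J : prime_ideal P -> J `<=` sat P J.
Proof. by move=> pP a Ja; exists 1; [exact: prime1|rewrite mul1r]. Qed.

Definition saturated P J : Prop := forall s a, ~ P s -> J (s * a) -> J a.

Lemma sat_saturated P J : prime_ideal P -> saturated P (sat P J).
Proof.
move=> pP s a Ps [t Pt]; rewrite mulrA => Jtsa; exists (t * s) => //.
exact: primeM.
Qed.

(** For each element of [l] in turn, multiply by its largest power that keeps
    the class nonzero. *)
Lemma socle_ex N (l : seq R) : idl N -> ~ N 1 ->
  (forall y, y \in l -> exists k, N (y ^+ k)) ->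
  exists v, ~ N v /\ forall y, y \in l -> N (y * v).
Proof.
move=> hN N1; elim: l => [|y l IH] H; first by exists 1.
have [v [Nv vP]] := IH (fun z zl => H z (in_tail _ zl)).
have [k Nk] := H y (mem_head _ _).
have ex : exists k, `[< N (y ^+ k * v) >].
  by exists k; apply/asboolP; exact: idlMr.
case: (ex_minnP ex) => -[|j] /asboolP Nj jmin; first by rewrite expr0 mul1r in Nj.
exists (y ^+ j * v); split=> [Nyj|z].
  by have := jmin j (asboolT Nyj); rewrite ltnn.
rewrite inE => /orP[/eqP->|/vP Nz]; first by rewrite mulrA -exprS.
by rewrite mulrCA; exact: idlM.
Qed.

(** This says that [R_P / L_P] is Artinian. Starting with [N = L], one enlarges
    an ideal [N] on which the chain is eventually stationary: a class [v] that
    [P] annihilates modulo [N] adds a one-dimensional space over the residue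
    field at [P], where the chain can drop only once. *)
Lemma dcc_above P L (J : nat -> set R) : prime_ideal P ->
  (forall y, P y -> exists k, L (y ^+ k)) ->
  (forall n, idl (J n)) -> (forall n, saturated P (J n)) ->
  (forall n, L `<=` J n) -> (forall n, J n.+1 `<=` J n) ->
  idl L -> saturated P L ->
  exists n, J n `<=` J n.+1.
Proof.
move=> pP nil hJ sJ LJ dJ hL sL.
have dle n k : (n <= k)%N -> J k `<=` J n.
  move=> /subnK <-; elim: (k - n)%N => // i IH x /dJ; exact: IH.
have [l lE] := nR (prime_idl pP).
suff key N : idl N -> saturated P N -> L `<=` N ->
    (exists n0, forall n k x, (n0 <= n)%N -> (n0 <= k)%N -> N x -> J n x -> J k x) ->
    exists n, J n `<=` J n.+1.
  apply: (key L) => //; exists 0%N => n k x _ _ Lx _; exact: LJ.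
move: N; apply: (noeth_ind (V := R^o) (P := fun N => saturated P N -> L `<=` N ->
  (exists n0, forall n k x, (n0 <= n)%N -> (n0 <= k)%N -> N x -> J n x -> J k x) ->
  exists n, J n `<=` J n.+1)) => // N hN IH sN LN [n0 n0P].
have [N1|N1] := pselect (N 1).
  exists n0 => x Jx; apply: (n0P n0) => //; rewrite -[x]mulr1; exact: idlM.
have [|v [Nv vP]] := @socle_ex N l hN N1.
  move=> y yl; have [|k Lk] := nil y; last by exists k; exact: LN.
  by rewrite lE; exact: (span_mem (V := R^o)).
have PvN y : P y -> N (y * v).
  rewrite lE; apply: (span_min (V := R^o) (S := [set y | N (y * v)])) vP y.
  apply: idl_ex => [|a b c Nb Nc] /=; first by rewrite mul0r; exact: idl0.
  by rewrite mulrDl -mulrA; apply: idlD => //; exact: idlM.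
pose N' := sat P (adj N v).
have hA : idl (adj N v) by exact: adj_idl.
have NN' : N `<=` N' by apply: subset_trans (sat_sub pP); exact: adj_sub.
have N'v : N' v by apply: sat_sub => //; exact: adj_mem.
apply: (IH N').
- exact: sat_idl.
- by [].
- by move=> e; apply: Nv; rewrite e.
- exact: sat_saturated.
- exact: subset_trans LN NN'.
(* either [J n] is inside [N] on [N'] from some stage on, or it never is *)
have [big|] := pselect (forall n, exists w, [/\ N' w, ~ N w & J n w]); last first.
  move=> /existsNP[n1 no]; exists (maxn n0 n1) => n k x nn nk N'x Jx.
  have [Nx|Nx] := pselect (N x).
    by apply: (n0P n k) => //; [exact: leq_trans (leq_maxl _ _) nn|exact: leq_trans (leq_maxl _ _) nk].
  case: no; exists x; split=> //; apply: dle Jx; exact: leq_trans (leq_maxr _ _) nn.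
exists n0 => n k x nn nk N'x Jx.
have [w [N'w Nw Jw]] := big (maxn n k).
have Jwn : J n w by apply: dle Jw; exact: leq_maxl.
have Jwk : J k w by apply: dle Jw; exact: leq_maxr.
have [s Ps [i [a [Ni sx]]]] := N'x; have [t Pt [j [b [Nj tw]]]] := N'w.
have Pb : ~ P b.
  by move=> /PvN Nbv; apply: Nw; apply: (sN t) => //; rewrite tw; exact: idlD.
(* the component along [v] cancels, so this element is in [N] *)
have Jk : J k (b * s * x - a * t * w).
  apply: (n0P n k) => //; last by apply: idlB => //; rewrite -?mulrA; do 2!apply: idlM => //.
  rewrite -!mulrA sx tw (_ : _ - _ = b * i - a * j); last by ring.
  by apply: idlB => //; exact: idlM.
apply: (sJ k (b * s)); first exact: primeM.
rewrite -[_ * x](subrK (a * t * w)); apply: idlD => //; exact: idlM.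
Qed.

(** The symbolic powers of [Q], modulo [P]. *)
Fixpoint symb P Q (n : nat) : set R :=
  if n is n'.+1 then sat Q (subsum (P : set R^o) (imul Q (symb P Q n' : set R^o)))
  else setT.

Lemma symb_facts P Q n : prime_ideal P -> prime_ideal Q -> P `<=` Q ->
  [/\ idl (symb P Q n), saturated Q (symb P Q n), P `<=` symb P Q n &
      forall a, Q a -> symb P Q n (a ^+ n)].
Proof.
move=> pP pQ PQ; elim: n => [|n [hn sn Pn Xn]]; first by split.
have hS : idl (subsum (P : set R^o) (imul Q (symb P Q n : set R^o))).
  by apply: subsum_sub; [exact: prime_idl|exact: imul_sub].
split.
- exact: sat_idl.
- exact: sat_saturated.
- apply: subset_trans (sat_sub pQ); exact: (@subsuml R R^o P _ (imul_sub _ _)).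
- move=> a Qa; apply: sat_sub => //; apply: (@subsumr R R^o P _ (prime_idl pP)).
  by rewrite exprS; apply: (@imulM R R^o) => //; exact: Xn.
Qed.

(** Krull's principal ideal theorem. Otherwise [P2] is minimal over [P0] and
    [x], so that [R_P2] is Artinian modulo [P0] and [x], and the symbolic powers
    of [P1] are stationary modulo [x]. They are then stationary, by Nakayama's
    lemma at [P2] and because [x] is not in [P1]; so they vanish modulo [P0], by
    Nakayama's lemma at [P1], and [P1 = P0]. *)
Lemma pit P0 P1 P2 x : prime_ideal P0 -> prime_ideal P1 -> prime_ideal P2 ->
  P0 `<=` P1 -> ~ (P1 `<=` P0) -> P1 `<=` P2 -> P2 x -> ~ P1 x ->
  exists P, [/\ prime_ideal P, P0 `<=` P, P x, P `<=` P2 & ~ (P2 `<=` P)].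
Proof.
move=> p0 p1 p2 s01 n01 s12 P2x P1x; apply: contrapT => no.
have min P : prime_ideal P -> P0 `<=` P -> P x -> P `<=` P2 -> P2 `<=` P.
  by move=> pP P0P Px PP2; apply: contrapT => nP; apply: no; exists P.
have h0 := prime_idl p0; have h1 := prime_idl p1; have h2 := prime_idl p2.
pose L := sat P2 (adj P0 x).
have hL : idl L by apply: sat_idl => //; exact: adj_idl.
(* [P2] is minimal over [P0] and [x], so its elements are nilpotent modulo [L] *)
have nil y : P2 y -> exists k, L (y ^+ k).
  move=> P2y; apply: contrapT => nk.
  pose S : set R := [set z | exists s k, ~ P2 s /\ z = s * y ^+ k].
  have [||||P [pP AP SP]] := @krull_prime (adj P0 x) S.
  - exact: adj_idl.
  - by exists 1, 0%N; rewrite mulr1; split=> //; exact: prime1.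
  - move=> _ _ [s [k [Ps ->]]] [t [j [Pt ->]]]; exists (s * t), (k + j)%N.
    by rewrite exprD mulrACA; split=> //; exact: primeM.
  - by move=> _ [s [k [Ps ->]]] As; apply: nk; exists k, s.
  have PP2 : P `<=` P2.
    move=> s Ps; apply: contrapT => P2s; apply: (SP s) => //.
    by exists s, 0%N; rewrite mulr1.
  have /(_ y P2y) Py := min P pP (subset_trans (@adj_sub _ _) AP) (AP _ (adj_mem _ h0)) PP2.
  by apply: (SP y) => //; exists 1, 1%N; rewrite mul1r; split=> //; exact: prime1.
pose Sy n := symb P0 P1 n.
have F n := symb_facts n p0 p1 s01.
pose J n := sat P2 (adj (Sy n) x).
have dS n : Sy n.+1 `<=` Sy n.
  have [hn sn Pn Xn] := F n; move=> a [s Ps [i [b [P0i ib e]]]].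
  apply: (sn s) => //; rewrite e; apply: idlD => //; first exact: Pn.
  apply: (imul_min (S := Sy n : set R^o) hn _ ib) => c z _ Sz; exact: idlM.
have [n Jn] : exists n, J n `<=` J n.+1.
  apply: (@dcc_above P2 L) => // [n|n|n|n|].
  - by apply: sat_idl => //; apply: adj_idl; case: (F n).
  - exact: sat_saturated.
  - move=> a [s Ps As]; exists s => //; apply: adj_mono As; by case: (F n).
  - by move=> a [s Ps As]; exists s => //; apply: adj_mono As; exact: dS.
  - exact: sat_saturated.
have [hn sn Pn Xn] := F n; have [hn1 sn1 Pn1 Xn1] := F n.+1.
have [l lE] := nR hn; have [l0 l0E] := nR h0.
(* [c * x] lies in [Sy n] and [x] is not in [P1], so [c] lies in [Sy n] *)
have SS : Sy n `<=` Sy n.+1.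
  move=> a Sa; have : span l (a : R^o) by rewrite -lE.
  case/(nakayama_at p2 hn1) => [v|s P2s]; last first.
    by move=> H; apply: (sn1 s) => // /s12.
  rewrite -lE => Sv; have /Jn[s P2s [b [c [Sb e]]]] : J n v.
    by apply: sat_sub => //; exact: adj_sub.
  exists s => //; exists b, (c * x); split=> //.
  rewrite mulrC; apply: (imulM (S := symb P0 P1 n : set R^o)) => //.
  apply: (sn x) => //; rewrite mulrC (_ : c * x = s * v - b); last by rewrite e addrC addKr.
  by apply: idlB => //; [exact: idlM|exact: dS].
apply: n01 => a P1a; apply: (primeX (n := n) p0).
have : span l (a ^+ n : R^o) by rewrite -lE; exact: Xn.
case/(nakayama_at p1 h0) => [v|s P1s].
  by rewrite -lE => /SS[s P1s H]; exists s.
by case: p0 => _ _ pM /pM[/s01|].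
Qed.

Fixpoint chain (n : nat) P Q : Prop :=
  if n is n'.+1 then
    prime_ideal Q /\ exists Q', [/\ chain n' P Q', Q' `<=` Q & ~ (Q `<=` Q')]
  else prime_ideal P /\ P = Q.

Lemma chain_primes n P Q : chain n P Q -> prime_ideal P /\ prime_ideal Q.
Proof.
elim: n Q => [|n IH] Q /=; first by move=> [pP <-].
by move=> [pQ [Q' [/IH[pP _] _ _]]].
Qed.

Lemma chain_le n P Q : chain n P Q -> P `<=` Q.
Proof.
elim: n Q => [|n IH] Q /=; first by move=> [_ ->].
by move=> [_ [Q' [/IH PQ' Q'Q _]]]; exact: subset_trans PQ' Q'Q.
Qed.

Lemma chain_lt n P Q : chain n.+1 P Q -> ~ (Q `<=` P).
Proof.
move=> [_ [Q' [/chain_le PQ' _ QQ']]] QP; apply: QQ'; exact: subset_trans QP PQ'.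
Qed.

Lemma chain_cons n P P' Q : prime_ideal P -> P `<=` P' -> ~ (P' `<=` P) ->
  chain n P' Q -> chain n.+1 P Q.
Proof.
move=> pP PP' P'P; elim: n Q => [|n IH] Q.
  by move=> [pP' <-]; split=> //; exists P; split.
by move=> [pQ [Q' [/IH c Q'Q QQ']]]; split=> //; exists Q'.
Qed.

(** The principal ideal theorem moves [x] down the chain, one step at a time. *)
Lemma chain_above n P Q x : chain n.+1 P Q -> Q x ->
  exists P', [/\ P `<=` P', ~ (P' `<=` P), P' x & chain n P' Q].
Proof.
elim: n P Q => [|n IH] P Q; move=> [pQ [Q' [c Q'Q QQ']]] Qx.
  move: c => [pP PQ']; subst Q'; exists Q; split=> //; by split.
have [Q'x|Q'x] := pselect (Q' x).
  have [P' [PP' P'P P'x c']] := IH _ _ c Q'x.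
  by exists P'; split=> //; split=> //; exists Q'.
move: c => [pQ' [Q'' [c Q''Q' Q'Q'']]]; have [pP pQ''] := chain_primes c.
have [S [pS Q''S Sx SQ QS]] := pit pQ'' pQ' pQ Q''Q' Q'Q'' Q'Q Qx Q'x.
have cS : chain n.+1 P S.
  split=> //; exists Q''; split=> // SQ''; apply: Q'x; apply: Q''Q'; exact: SQ''.
have [P' [PP' P'P P'x c']] := IH _ _ cS Sx.
by exists P'; split=> //; split=> //; exists S.
Qed.

(** Krull's height theorem: by [chain_above], each generator takes away one step
    of the chain. *)
Lemma height_le xs I n P m : I `<=` P -> chain n P m -> m `<=` adjs I xs ->
  (forall x, x \in xs -> m x) -> (n <= size xs)%N.
Proof.
elim: xs I n P => [|x xs IH] I [|n] P IP c mI mx //=.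
  by case: (chain_lt c); apply: subset_trans mI IP.
have [P' [PP' P'P P'x c']] := chain_above c (mx x (mem_head _ _)).
have [pP' _] := chain_primes c'.
apply: (IH (adj I x) n P') => //; last by move=> y yx; apply: mx; exact: in_tail.
apply: adj_min => //; [exact: prime_idl|exact: subset_trans IP PP'].
Qed.

Fixpoint regseq I (xs : seq R) : Prop :=
  if xs is x :: xs' then (forall a, I (x * a) -> I a) /\ regseq (adj I x) xs' else True.

Section Local.
Variable m : set R.
Hypothesis pm : prime_ideal m.
Hypothesis unit_m : forall a, ~ m a -> exists b, a * b = 1.

Lemma unit_idl I a x : idl I -> ~ m a -> I (a * x) -> I x.
Proof.
move=> hI /unit_m[b ab] /(idlM b hI).
by rewrite mulrA [b * a]mulrC ab mul1r.
Qed.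

(** A regular local ring is a domain. Move the chain above [x]: by induction,
    [I + x] is the prime [P'] at its bottom. The height theorem forbids [x] to
    lie in [P], so that [P] is contained in [I + x P] and hence in [I], by
    Nakayama's lemma. *)
Lemma chain_regseq xs I P : idl I -> I `<=` P -> chain (size xs) P m ->
  m `<=` adjs I xs -> (forall x, x \in xs -> m x) -> P `<=` I /\ regseq I xs.
Proof.
elim: xs I P => [|x xs IH] I P hI IP c mI mx.
  by move: c => [_ ->]; split.
have [P' [PP' P'P P'x c']] := chain_above c (mx x (mem_head _ _)).
have mxs y : y \in xs -> m y by move=> yx; apply: mx; exact: in_tail.
have [pP pM] := chain_primes c; have [pP' _] := chain_primes c'.
have hP := prime_idl pP.
have IP' : adj I x `<=` P'.
  apply: adj_min => //; [exact: prime_idl|exact: subset_trans IP PP'].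
have [P'I reg] := IH (adj I x) P' (adj_idl _ hI) IP' c' mI mxs.
have Px : ~ P x.
  move=> Px; have := @height_le xs (adj I x) (size xs).+1 P m _ c mI mxs.
  by rewrite ltnn => /(_ (adj_min hP IP Px)).
have PI : P `<=` I.
  have [l lE] := nR hP.
  move=> a Pa; have : span l (a : R^o) by rewrite -lE.
  case/(nakayama_at pm hI) => [v|s ms]; last exact: unit_idl.
  rewrite -lE => Pv; exists 1; first exact: prime1.
  rewrite scale1r; have [i [b [Ii e]]] := P'I _ (PP' _ Pv).
  exists i, (b * x); split=> //; rewrite mulrC.
  apply: (imulM (S := P : set R^o)); first exact: mx (mem_head _ _).
  have Pbx : P (b * x).
    have -> : b * x = (v : R) - i by rewrite e addrC addKr.
    exact: (idlB hP Pv (IP _ Ii)).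
  by case: pP => _ _ /(_ _ _ Pbx)[].
split=> //; split=> // a /IP Pxa; apply: PI.
by case: pP => _ _ /(_ _ _ Pxa)[].
Qed.

(** If [P'] contains [I + x], the multiplicative set generated by [x] and the
    complement of [P'] avoids [I], as [x] is a nonzerodivisor modulo [I]; so
    there is a prime above [I] and below [P'] without [x]. *)
Lemma regseq_chain xs I : idl I -> I `<=` m -> (forall x, x \in xs -> m x) ->
  regseq I xs -> exists P, I `<=` P /\ chain (size xs) P m.
Proof.
elim: xs I => [|x xs IH] I hI Im mx /=; first by exists m.
move=> [nzd reg].
have mxs y : y \in xs -> m y by move=> yx; apply: mx; exact: in_tail.
have [P' [IP' c]] := IH (adj I x) (adj_idl _ hI)
  (adj_min (prime_idl pm) Im (mx x (mem_head _ _))) mxs reg.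
have [pP' _] := chain_primes c.
pose S : set R := [set z | exists s k, ~ P' s /\ z = s * x ^+ k].
have [|||P [pP IP SP]] := @krull_prime I S hI.
- by exists 1, 0%N; rewrite mulr1; split=> //; exact: prime1.
- move=> _ _ [s [k [Ps ->]]] [t [j [Pt ->]]]; exists (s * t), (k + j)%N.
  by rewrite exprD mulrACA; split=> //; exact: primeM.
- move=> _ [s [k [Ps ->]]] Isx; apply: Ps; apply: IP'; apply: adj_sub.
  elim: k Isx => [|k IHk]; first by rewrite mulr1.
  by rewrite exprS mulrCA => /nzd.
exists P; split=> //; apply: (chain_cons pP _ _ c).
  move=> s Ps; apply: contrapT => P's; apply: (SP s) => //.
  by exists s, 0%N; rewrite mulr1.
move=> P'P; have /(SP x) : S x by exists 1, 1%N; rewrite mul1r; split=> //; exact: prime1.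
by apply; apply: P'P; apply: IP'; exact: adj_mem.
Qed.

(** An elimination, as for Vandermonde systems: multiplication by [a + b ^+ t]
    annihilates the last vector, and acts on the others as the differences
    [b ^+ t - b ^+ j], each of which is a unit times a power of [b]. *)
Lemma independent K I a b (t : nat) (w : nat -> R) : idl K -> idl I -> m a -> m b ->
  (forall v, K v -> I (a * v) -> I (b * v) -> I v) ->
  (forall j, (j < t)%N -> K (w j) /\ I ((a + b ^+ j.+1) * w j)) ->
  I (\sum_(j < t) w j) -> forall j, (j < t)%N -> I (w j).
Proof.
move=> hK hI ma mb soc; have hm := prime_idl pm.
have pow k v : K v -> I (a * v) -> I (b ^+ k * v) -> I v.
  elim: k v => [|k IH] v Kv Iav; first by rewrite mul1r.
  rewrite exprSr -mulrA => Ib; apply: soc => //; apply: IH => //; first exact: idlM.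
  by rewrite mulrCA; exact: idlM.
elim: t w => [|t IH] w wP Iw //.
have It j : (j < t)%N -> I (w j).
  move=> jt; have [Kw Iaw] := wP j (ltnW jt).
  (* multiplying the relation by [a + b ^+ t.+1] eliminates its last term *)
  have Iu : I ((b ^+ t.+1 - b ^+ j.+1) * w j).
    apply: (IH (fun j => (b ^+ t.+1 - b ^+ j.+1) * w j)) => // [i it|].
      have [Kwi Iawi] := wP i (ltnW it); split; first exact: idlM.
      by rewrite mulrCA; exact: idlM.
    have := idlM (a + b ^+ t.+1) hI Iw.
    rewrite big_ord_recr /= mulrDr => Is.
    have := idlB hI Is (wP t (ltnSn t)).2; rewrite addrK mulr_sumr => {}Is.
    have I2 : I (\sum_(i < t) (a + b ^+ i.+1) * w i).
      elim/big_ind: _ => [|*|i _]; [exact: idl0|exact: idlD|].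
      by have [] := wP i (ltnW (ltn_ord i)).
    have := idlB hI Is I2; rewrite -sumrB; congr I; apply: eq_bigr => i _.
    by ring.
  have Ib : I (b ^+ j.+1 * w j).
    apply: (@unit_idl I (b ^+ (t - j) - 1)) => //.
      move=> mu; apply: (prime1 pm); have mbt : m (b ^+ (t - j)).
        by rewrite (_ : (t - j = (t - j).-1.+1)%N) ?exprS; [exact: idlMr|rewrite prednK // subn_gt0].
      by rewrite -[1](subKr (b ^+ (t - j))); exact: idlB.
    move: Iu; congr I; rewrite [RHS]mulrA; congr (_ * _).
    by rewrite mulrBl mul1r -exprD addnS subnK // ltnW.
  apply: (pow j.+1) => //; have := idlB hI Iaw Ib.
  by rewrite mulrDl addrK.
move=> j; rewrite ltnS leq_eqVlt => /orP[/eqP->|/It//].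
move: Iw; rewrite big_ord_recr /= => Iw.
have I2 : I (\sum_(i < t) w i).
  by elim/big_ind: _ => [|*|i _]; [exact: idl0|exact: idlD|exact: It].
by have := idlB hI Iw I2; rewrite [X in X - _]addrC addrK.
Qed.

(** Otherwise each [a + b ^+ j.+1] annihilates a nonzero class. By
    [independent], these classes generate a strictly increasing sequence of
    ideals. *)
Lemma nzd_two K I a b : idl K -> idl I -> m a -> m b ->
  (forall v, K v -> I (a * v) -> I (b * v) -> I v) ->
  exists j, forall v, K v -> I ((a + b ^+ j.+1) * v) -> I v.
Proof.
move=> hK hI ma mb soc; apply: contrapT => no.
have /choice[v vP] : forall j, exists v, [/\ K v, I ((a + b ^+ j.+1) * v) & ~ I v].
  move=> j; apply: contrapT => nv; apply: no; exists j => v Kv Iv.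
  by apply: contrapT => Iv'; apply: nv; exists v.
pose J (t : nat) : set R := [set z | exists i (c : nat -> R), I i /\ z = i + \sum_(j < t) c j * v j].
have Jgrow (t : nat) : J t `<=` J t.+1.
  move=> _ [i [c [Ii ->]]]; exists i, (fun j => if (j < t)%N then c j else 0); split=> //.
  rewrite big_ord_recr /= ltnn mul0r addr0; congr (_ + _).
  by apply: eq_bigr => j _; rewrite ltn_ord.
have Jv (t : nat) : J t.+1 (v t).
  exists 0, (fun j => (j == t)%:R); split; first exact: idl0.
  rewrite add0r big_ord_recr /= eqxx mul1r big1 ?add0r // => j _.
  by rewrite (ltn_eqF (ltn_ord j)) mul0r.
have JN (t : nat) : ~ J t (v t).
  move=> [i [c [Ii e]]]; have [_ _ Iv] := vP t; apply: Iv.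
  pose w j := if (j < t)%N then c j * v j else - v t.
  have wP j : (j < t.+1)%N -> K (w j) /\ I ((a + b ^+ j.+1) * w j).
    rewrite /w => jt; have [Kv Iv' _] := vP j; case: ifP => [_|/negbT].
      by split; [exact: idlM|rewrite mulrCA; exact: idlM].
    have [Kt It _] := vP t; rewrite -leqNgt => tj.
    have -> : j = t by apply/eqP; rewrite eqn_leq tj -ltnS jt.
    by rewrite -mulN1r; split; [exact: idlM|rewrite mulrCA; exact: idlM].
  have Iw : I (\sum_(j < t.+1) w j).
    rewrite big_ord_recr /= (eq_bigr (fun j : 'I_t => c j * v j)); last first.
      by move=> j _; rewrite /w ltn_ord.
    rewrite /w ltnn; have -> : \sum_(j < t) c j * v j - v t = -1 * i.
      by rewrite e opprD addrCA subrr addr0 mulN1r.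
    exact: idlM.
  have := independent hK hI ma mb soc wP Iw (ltnSn t).
  by rewrite /w ltnn => /(idlM (-1) hI); rewrite mulN1r opprK.
have hJ (t : nat) : idl (J t).
  apply: idl_ex => [|d _ _ [i [c [Ii ->]]] [i' [c' [Ii' ->]]]].
    exists 0, (fun _ => 0); split; first exact: idl0.
    by rewrite add0r big1 // => j _; rewrite mul0r.
  exists (d * i + i'), (fun j => d * c j + c' j); split.
    by apply: idlD => //; exact: idlM.
  rewrite mulrDr addrACA mulr_sumr -big_split; congr (_ + _).
  by apply: eq_bigr => j _ /=; rewrite mulrDl mulrA.
suff key N : idl N -> forall t : nat, J t = N -> False by exact: key (hJ 0%N) 0%N erefl.
move: N; apply: (noeth_ind (V := R^o) (P := fun N => forall t : nat, J t = N -> False)) => // N hN IH t tE.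
apply: (IH (J t.+1)) (hJ _) _ _ t.+1 erefl; first by rewrite -tE; exact: Jgrow.
by move=> e; apply: (JN t); rewrite tE e.
Qed.

(** By induction on [xs], using [nzd_two] on the ideal of the classes that the
    later elements annihilate. Note that [x + w] can replace [x] in a system of
    generators. *)
Lemma nzd_ex K I x xs : idl K -> idl I -> m x -> (forall y, y \in xs -> m y) ->
  (forall v, K v -> I (x * v) -> (forall y, y \in xs -> I (y * v)) -> I v) ->
  exists w, span (xs : seq R^o) w /\ forall v, K v -> I ((x + w) * v) -> I v.
Proof.
move=> hK hI mx; elim: xs x mx => [|y xs IH] x mx mxs soc.
  by exists 0; split=> // v Kv; rewrite addr0 => Iv; apply: soc.
(* the classes annihilated by the later elements of the sequence *)
pose K' : set R := K `&` [set v | forall z, z \in xs -> I (z * v)].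
have hK' : idl K'.
  apply: submoduleI => //; apply: idl_ex => [z _|d u v Iu Iv z zx].
    by rewrite mulr0; exact: idl0.
  by rewrite mulrDr mulrCA; apply: idlD => //; [apply: idlM => //; exact: Iu|exact: Iv].
have my : m y by apply: mxs; rewrite mem_head.
have [|j jP] := nzd_two hK' hI mx my.
  move=> v [Kv Kv'] Ix Iy; apply: soc => // z.
  by rewrite inE => /orP[/eqP->|/Kv'].
have mxj : m (x + y ^+ j.+1).
  have hm := prime_idl pm.
  by apply: idlD => //; rewrite exprSr; exact: idlM.
have [||w [xw wP]] := IH _ mxj.
- by move=> z zx; apply: mxs; exact: in_tail.
- by move=> v Kv Iv zv; apply: jP.
exists (y ^+ j.+1 + w); split; last by move=> v; rewrite addrA; exact: wP.
by exists (y ^+ j), w; rewrite exprSr.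
Qed.

End Local.
End Primes.

(** * Vanishing of Ext over a local ring is detected by the residue field *)

Section Cyclic.
Variable R : comPzRingType.
Implicit Types (I J : set R) (N X Y Z M : lmodType R).
Local Notation idl I := (submodule (I : set R^o)).

Definition is_quot J N : Prop := exists pi : {linear R^o -> N},
  surjective pi /\ forall a, pi a = 0 <-> J a.

Lemma is_quot_ex J : idl J -> exists N, is_quot J N.
Proof. by move=> hJ; have [N [pi piP]] := quot_ex hJ; exists N, pi. Qed.

Lemma is_quot_fin_gen J N : is_quot J N -> fin_gen N.
Proof. by move=> [pi [pis _]]; exact: fin_gen_cyclic pis. Qed.

Lemma is_quot_killed I J N : idl J -> I `<=` J -> is_quot J N -> killed I N.
Proof.
move=> hJ IJ [pi [pis piE]] a x /IJ Ja; have [b <-] := pis x.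
by rewrite -linearZ; apply/piE; exact: idlMr.
Qed.

Lemma is_quot_rproj I N : idl I -> is_quot I N -> rproj I N.
Proof.
move=> hI [pi [pis piE]].
have [u uE] : exists u : {linear N -> {ffun 'I_1 -> N}}, forall x i, u x i = x.
  have [|u uE] := @linear_ex R N {ffun 'I_1 -> N} (fun x => [ffun _ => x]).
    by move=> a x y; apply/ffunP => i; rewrite !ffunE.
  by exists u => x i; rewrite uE ffunE.
have [v vE] : exists v : {linear {ffun 'I_1 -> N} -> N}, forall f, v f = f ord0.
  by apply: linear_ex => a f g; rewrite !ffunE.
apply: (@rproj_retract R I N _ u v); first by move=> x; rewrite vE uE.
exact: cyclic_power_rproj pis piE.
Qed.

Lemma is_quot_iso J N N' : is_quot J N -> is_quot J N' ->
  exists (f : {linear N -> N'}) (g : {linear N' -> N}),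
    (forall x, g (f x) = x) /\ (forall x, f (g x) = x).
Proof.
move=> [pi [pis piE]] [pi' [pis' piE']].
have [|f fE] := @factor_surj _ _ _ _ pi pi' pis; first by move=> x /piE/piE'.
have [|g gE] := @factor_surj _ _ _ _ pi' pi pis'; first by move=> x /piE'/piE.
exists f, g; split=> x.
  by have [a <-] := pis x; rewrite fE gE.
by have [a <-] := pis' x; rewrite gE fE.
Qed.

Definition colon J (a : R) : set R := [set b | J (b * a)].

Lemma colon_idl J a : idl J -> idl (colon J a).
Proof.
move=> hJ; apply: idl_ex => [|b x y Jx Jy] /=; first by rewrite /colon /= mul0r; exact: idl0.
by rewrite /colon /= mulrDl -mulrA; apply: idlD => //; exact: idlM.
Qed.

(** Multiplication by [a] on [R/J] has the kernel [(J : a)/J] and the cokernel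
    [R/(J + a)]. *)
Lemma is_quot_exact_maps J a X Y Z (pX : {linear R^o -> X}) (pY : {linear R^o -> Y}) :
  idl J -> surjective pX -> (forall b, pX b = 0 <-> J (b * a)) ->
  surjective pY -> (forall b, pY b = 0 <-> J b) -> is_quot (adj J a) Z ->
  exists (u : {linear X -> Y}) (v : {linear Y -> Z}),
    [/\ injective u, exact_at u v, surjective v & forall b, u (pX b) = pY (b * a)].
Proof.
move=> hJ pXs pXE pYs pYE [pZ [pZs pZE]].
have [h hE] := lin_smul (pY a).
have hE' b : h b = pY (b * a) by rewrite hE -linearZ.
have [|u uE] := @factor_surj _ _ _ _ pX h pXs.
  by move=> b /pXE Jba; rewrite hE'; apply/pYE.
have [|v vE] := @factor_surj _ _ _ _ pY pZ pYs.
  by move=> b /pYE Jb; apply/pZE; exact: adj_sub.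
exists u, v; split; last by move=> b; rewrite uE hE'.
- by apply: ker0_inj => x; have [b <-] := pXs x; rewrite uE hE' => /pYE Jba; apply/pXE.
- move=> y; have [c <-] := pYs y; rewrite vE; split=> [/pZE[j [b [Jj cE]]]|[x]].
    exists (pX b); rewrite uE hE' cE linearD /=.
    by rewrite (pYE j).2 // add0r.
  have [b <-] := pXs x; rewrite uE hE' => e; apply/pZE.
  have : J (c - b * a) by apply/pYE; rewrite linearB e subrr.
  by move=> Jc; exists (c - b * a), b; rewrite subrK.
- by move=> z; have [c <-] := pZs z; exists (pY c).
Qed.

Lemma is_quot_exact J a X Y Z : idl J -> is_quot (colon J a) X -> is_quot J Y -> is_quot (adj J a) Z ->
  short_exact X Y Z.
Proof.
move=> hJ [pX [pXs pXE]] [pY [pYs pYE]] cZ.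
have [u [v [ui uv vs _]]] := is_quot_exact_maps hJ pXs pXE pYs pYE cZ.
by exists u, v.
Qed.

End Cyclic.

Section Local.
Variable R : comPzRingType.
Hypothesis nR : noeth R^o.
Variable m : set R.
Hypothesis pm : prime_ideal m.
Hypothesis unit_m : forall a, ~ m a -> exists b, a * b = 1.
Local Notation idl I := (submodule (I : set R^o)).
Variable I : set R.
Hypothesis hI : idl I.
Implicit Types (J : set R) (K P N X Y Z M : lmodType R).

(** [Ext^{i+1}(X, M)] is divisible by [x]: modulo the maps that extend to the
    cover, a map on the syzygy is [x] times another one. *)
Fixpoint xdiv (x : R) (i : nat) X M : Prop :=
  exists P K (f : {linear K -> P}) (g : {linear P -> X}),
    [/\ cover I f g, fin_gen P & match i with
      | 0 => forall h : {linear K -> M}, exists (h1 : {linear K -> M})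
               (e : {linear P -> M}), forall k, h k = x *: h1 k + e (f k)
      | i'.+1 => xdiv x i' K M
      end].

(** The horseshoe of [0 -> X -> Y -> Z -> 0] along covers of [X] and [Z]. The
    point is that if [u] is [x] times a map, up to a map through a projective,
    then so is the induced map on the syzygies: this allows an induction on the
    degree. *)
Lemma horseshoe (x : R) X Y Z P (u : {linear X -> Y}) (v : {linear Y -> Z})
    (al : {linear X -> Y}) (ga : {linear X -> P}) (de : {linear P -> Y})
    (QX KX : lmodType R) (fX : {linear KX -> QX}) (gX : {linear QX -> X})
    (QZ KZ : lmodType R) (fZ : {linear KZ -> QZ}) (gZ : {linear QZ -> Z}) :
  killed I Y -> injective u -> exact_at u v -> surjective v ->
  rproj I P -> (forall t, u t = x *: al t + de (ga t)) ->
  cover I fX gX -> fin_gen QX -> cover I fZ gZ -> fin_gen QZ ->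
  exists (KY : lmodType R) (uK : {linear KX -> KY}) (vK : {linear KY -> KZ}) (aK : {linear KX -> KY})
    (ep : {linear QX -> KY}), [/\ killed I KY /\ fin_gen KY, injective uK,
      exact_at uK vK, surjective vK & forall t, uK t = x *: aK t + ep (fX t)].
Proof.
move=> kY ui uv vs rP uE [[kQX lX] fXi fXg gXs] gQX [[kQZ lZ] fZi fZg gZs] gQZ.
have [q qE] := lZ _ _ v gZ kY vs; have [ug ugE] := lin_comp u gX.
have [gY gYE] := lin_pair ug q; have [KY [fY [fYi fYg]]] := ker_ex gY.
have kQ := killed_prod kQX kQZ.
have gYs : surjective gY.
  move=> y; have [z zE] := gZs (v y).
  have /uv[t tE] : v (y - q z) = 0 by rewrite linearB qE zE subrr.
  by have [s sE] := gXs t; exists (s, z); rewrite gYE ugE /= sE tE subrK.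
have [i1 i1E] := lin_inl QX QZ; have [i1f i1fE] := lin_comp i1 fX.
have i1g t : gY (i1 t) = u (gX t) by rewrite i1E gYE ugE linear0 addr0.
have [|uK uKE] := @factor_inj _ _ _ _ fY i1f fYi.
  by move=> t; apply/fYg; rewrite i1fE i1g (fXg _).2 ?linear0 //; exists t.
have [p2 p2E] := lin_snd QX QZ; have [p2f p2fE] := lin_comp p2 fY.
have [|vK vKE] := @factor_inj _ _ _ _ fZ p2f fZi.
  move=> t; apply/fZg; rewrite p2fE p2E -qE.
  have : gY (fY t) = 0 by apply/fYg; exists t.
  rewrite gYE => /(congr1 v); rewrite linearD linear0 ugE (uv (u _)).2 ?add0r //.
  by eexists.
have [ag agE] := lin_comp al gX; have [at_ atE] := lX _ _ gY ag kQ gYs.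
have [dt dtE] := rP.2 _ _ gY de kQ gYs; have [af afE] := lin_comp at_ fX.
have [|aK aKE] := @factor_inj _ _ _ _ fY af fYi.
  by move=> t; apply/fYg; rewrite afE atE agE (fXg _).2 ?linear0 //; exists t.
have [w wE] : exists w : {linear QX -> (QX * QZ)%type}, forall t,
    w t = i1 t - (x *: at_ t + dt (ga (gX t))).
  have [xa xaE] := lin_scale x at_; have [gg ggE] := lin_comp ga gX.
  have [dg dgE] := lin_comp dt gg; have [s sE] := lin_add xa dg.
  by have [w wE] := lin_sub i1 s; exists w => t; rewrite wE sE xaE dgE ggE.
have [|ep epE] := @factor_inj _ _ _ _ fY w fYi.
  move=> t; apply/fYg; rewrite wE linearB i1g linearD linearZ /= atE agE dtE uE.
  exact: subrr.
exists KY, uK, vK, aK, ep; split.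
- by split; [exact: killed_inj fYi kQ|exact: fin_gen_inj fYi (fin_gen_prod gQX gQZ)].
- by move=> s t /(congr1 fY); rewrite !uKE !i1fE !i1E => -[/fXi].
- move=> y; split=> [vy|[t <-]]; last first.
    by apply: fZi; rewrite vKE p2fE p2E uKE i1fE i1E linear0.
  have e2 : (fY y).2 = 0 by rewrite -p2E -p2fE -vKE vy linear0.
  have : gY (fY y) = 0 by apply/fYg; exists y.
  rewrite gYE e2 linear0 addr0 ugE -[RHS](linear0 u) => /ui/fXg[t tE].
  by exists t; apply: fYi; rewrite uKE i1fE i1E tE -e2 -surjective_pairing.
- move=> z; have /uv[t tE] : v (q (fZ z)) = 0 by rewrite qE; apply/fZg; exists z.
  have [s sE] := gXs t.
  have /fYg[y yE] : gY (- s, fZ z) = 0.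
    by rewrite gYE ugE /= linearN sE linearN tE addNr.
  by exists y; apply: fZi; rewrite vKE p2fE p2E yE.
- move=> t; apply: fYi; rewrite linearD linearZ /= uKE i1fE aKE afE epE wE.
  have -> : gX (fX t) = 0 by apply/fXg; exists t.
  by rewrite !linear0 addr0 addrC subrK.
Qed.

(** When [Ext^{i+2}(Z, M)] vanishes, every class in [Ext^{i+1}(X, M)] comes from
    [Ext^{i+1}(Y, M)] through [u]; and [u] acts as [x] times a map. *)
Lemma xdiv_of_vanishing x i M X Y Z P (u : {linear X -> Y}) (v : {linear Y -> Z})
    (al : {linear X -> Y}) (ga : {linear X -> P}) (de : {linear P -> Y}) :
  killed I Y -> fin_gen Y -> injective u -> exact_at u v -> surjective v ->
  rproj I P -> (forall t, u t = x *: al t + de (ga t)) ->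
  annExt I 1 i.+1 Z M -> xdiv x i X M.
Proof.
elim: i X Y Z P u v al ga de => [|i IH] X Y Z P u v al ga de kY gY ui uv vs rP uE H;
  have [QX [KX [fX [gX [cX gQX gKX]]]]] :=
    cover_ex nR hI (killed_inj ui kY) (fin_gen_inj nR ui gY);
  have [QZ [KZ [fZ [gZ [cZ gQZ gKZ]]]]] :=
    cover_ex nR hI (killed_surj vs kY) (fin_gen_surj vs gY);
  have [KY [uK [vK [aK [ep [[kKY gKY] uKi uvK vKs uKE]]]]]] :=
    horseshoe kY ui uv vs rP uE cX gQX cZ gQZ; exists QX, KX, fX, gX; split=> //.
- move=> h; have [h' h'E] := annExt_extend nR hI uKi uvK vKs kKY gKZ (H _ _ _ _ cZ) h.
  have [h1 h1E] := lin_comp h' aK; have [e eE] := lin_comp h' ep.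
  by exists h1, e => k; rewrite h1E eE -linearZ -linearD -uKE h'E scale1r.
- have [rQX _ _ _] := cX.
  exact: (IH _ _ _ _ uK vK aK fX ep kKY gKY uKi uvK vKs rQX uKE (H _ _ _ _ cZ)).
Qed.

(** Nakayama's lemma for [Ext], as a quotient of the finitely generated module
    [Hom(K, M)], whose elements are recorded by their values on generators. *)
Lemma xdiv_vanish x i X M : m x -> fin_gen M -> xdiv x i X M -> annExt I 1 i X M.
Proof.
move=> mx gM; elim: i X => [|i IH] X [P [K [f [g [c gP H]]]]]; last first.
  have [_ fi _ _] := c; have gK := fin_gen_inj nR fi gP.
  exact: (annExtS_cover nR hI c gK (IH _ H)).
have [_ fi _ _] := c; have gK := fin_gen_inj nR fi gP.
apply: (annExt0_cover c); have [n [y yE]] := gK.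
have [l lE] := fin_gen_noeth nR (fin_gen_power n gM) (hom_values_sub M y).
have hT := hom_values_sub M (fun i => f (y i)).
move=> h; pose phi := [ffun i => h (y i)].
have : span l phi by rewrite -lE; exists h => i; rewrite ffunE.
case/(nakayama_at pm hT) => [psi|s ms [e eE]].
  rewrite -lE => -[k kE]; exists 1; first by case: pm.
  have [h1 [e heE]] := H k; rewrite scale1r.
  exists [ffun i => e (f (y i))], (x *: [ffun i => h1 (y i)]); split.
  - by exists e => i; rewrite ffunE.
  - by apply: imulM => //; exists h1 => i; rewrite ffunE.
  - by apply/ffunP => i; rewrite !ffunE kE heE addrC.
have [b sb] := unit_m ms; have [be beE] := lin_scale b e.
exists be => k; rewrite beE scale1r.
have [bef befE] := lin_comp be f; rewrite -beE -befE; apply: (gen_eq yE) => i.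
rewrite befE beE -eE !ffunE scalerA [b * s]mulrC sb; exact: scale1r.
Qed.

Definition vanExt i J M : Prop := exists N, is_quot J N /\ annExt I 1 i N M.

Lemma vanExt_all i J M N : idl J -> I `<=` J -> is_quot J N -> vanExt i J M -> annExt I 1 i N M.
Proof.
move=> hJ IJ cN [N' [cN']]; have [f [g [gf fg]]] := is_quot_iso cN cN'.
exact: (annExt_retract nR hI (is_quot_killed hJ IJ cN') (is_quot_fin_gen cN') gf).
Qed.

(** Let [J] be a maximal counterexample. The sequences
    [0 -> R/(J : a) -> R/J -> R/(J + a) -> 0] show that [J] is prime; and then,
    for [a] in [m] but not in [J], that multiplication by [a] is onto on
    [Ext^i(R/J, M)], which thus vanishes by Nakayama's lemma. *)
Lemma residue_vanishing n M : fin_gen M -> I `<=` m ->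
  (forall i, (n <= i)%N -> vanExt i m M) ->
  forall J, idl J -> I `<=` J -> forall i, (n <= i)%N -> vanExt i J M.
Proof.
move=> gM Im Hm; have hm := prime_idl pm.
apply: (noeth_ind (V := R^o) (P := fun J => I `<=` J -> forall i, (n <= i)%N -> vanExt i J M)) => //.
move=> J hJ IH IJ i ni; have [N cN] := is_quot_ex hJ.
have [J1|J1] := pselect (J 1).
  exists N; split=> //; apply: (annExt_rproj _ _ _ (zero_rproj I _)) => x.
  case: cN => pi [pis piE]; have [a <-] := pis x; apply/piE.
  by rewrite -[a]mulr1; exact: idlM.
have Jm : J `<=` m.
  move=> a Ja; apply: contrapT => /unit_m[b ab]; apply: J1; rewrite -ab; exact: idlMr.
have kN := is_quot_killed hJ IJ cN; have gN := is_quot_fin_gen cN.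
have adjI a : idl (adj J a) by exact: adj_idl.
have Iadj a : I `<=` adj J a by exact: subset_trans IJ (@adj_sub _ _ _).
have ne a : ~ J a -> J <> adj J a by move=> Ja e; apply: Ja; rewrite e; exact: adj_mem.
have [[a [b [Jab Ja Jb]]]|pJ] := pselect (exists a b, [/\ J (a * b), ~ J a & ~ J b]).
  have hC := colon_idl a hJ; have JC : J `<=` colon J a by move=> c Jc; exact: idlMr.
  have [X cX] := is_quot_ex hC; have [Z cZ] := is_quot_ex (adjI a).
  exists N; split=> //; rewrite -[1]mulr1.
  apply: (annExt_mid nR hI kN gN (is_quot_exact hJ cX cN cZ)).
    apply: (vanExt_all hC _ cX); first exact: subset_trans IJ JC.
    apply: IH => //; last exact: subset_trans IJ JC.
    by move=> e; apply: Jb; rewrite e /colon /= mulrC.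
  apply: (vanExt_all (adjI a) _ cZ) => //.
  by apply: IH => //; [exact: adj_sub|exact: ne].
have [mJ|] := pselect (m `<=` J).
  by rewrite (_ : J = m); [exact: Hm|apply/seteqP].
move=> /existsNP[x /not_implyP[mx Jx]].
have [Z cZ] := is_quot_ex (adjI x); exists N; split=> //.
have [pi [pis piE]] := cN.
have CJ b : J (b * x) <-> J b.
  split=> [Jbx|Jb]; last exact: idlMr.
  by apply: contrapT => Jb; apply: pJ; exists b, x.
have piE' b : pi b = 0 <-> J (b * x) by rewrite piE CJ.
have [u [v [ui uv vs uE]]] := is_quot_exact_maps hJ pis piE' pis piE cZ.
have [i1 i1E] := lin_id N.
have [O O0] := zero_ex R.
have [ga gaE] := lin_zero N O.
have [de deE] := lin_zero O N.
apply: (xdiv_vanish mx gM).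
apply: (xdiv_of_vanishing (al := i1) (ga := ga) (de := de) kN gN ui uv vs) => //.
- exact: zero_rproj.
- move=> t; have [b <-] := pis t; rewrite uE deE addr0 i1E -linearZ.
  by congr (pi _); rewrite mulrC.
- apply: (vanExt_all (adjI x) _ cZ) => //.
  by apply: IH => //; [exact: adj_sub|exact: ne|exact: leqW].
Qed.

End Local.

Section Adjs.
Variable R : comPzRingType.
Implicit Types (I P Q m : set R).
Local Notation idl I := (submodule (I : set R^o)).

Lemma adjs_span I (xs : seq R) y : idl I ->
  adjs I xs y <-> exists i w, [/\ I i, span (xs : seq R^o) w & y = i + w].
Proof.
elim: xs I => [|x xs IH] I hI /=.
  split=> [Iy|[i [w [Ii -> ->]]]]; first by exists y, 0; rewrite addr0.
  by rewrite addr0.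
rewrite (IH _ (adj_idl x hI)); split.
  move=> [_ [w [[i [a [Ii ->]]] sw ->]]]; exists i, (a * x + w); split=> //.
    by exists a, w.
  by rewrite addrA.
move=> [i [_ [Ii [a [w [sw ->]]] ->]]]; exists (i + a * x), w; split=> //.
  by exists i, a.
by rewrite addrA.
Qed.

Lemma adjs_zI (xs : seq R) y : adjs zI xs y <-> span (xs : seq R^o) y.
Proof.
rewrite (adjs_span _ _ (@zero_ideal R)); split=> [[i [w [-> sw ->]]]|sy].
  by rewrite add0r.
by exists 0, y; split=> //; rewrite add0r.
Qed.

Lemma prime_chain_chain (c : nat -> Spec R) n : prime_chain n c -> chain n (c 0%N) (c n).
Proof.
elim: n => [|n IH] H; first by split=> //; exact: spec_prime.
split; first exact: spec_prime.
have [s1 s2] := H n (ltnSn n); exists (c n); split=> //.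
by apply: IH => i /ltnW; exact: H.
Qed.

Lemma chain_prime_chain n P Q : chain n P Q ->
  exists c : nat -> Spec R, prime_chain n c /\ spec_set (c n) = Q.
Proof.
elim: n Q => [|n IH] Q.
  by move=> [pP <-]; exists (fun _ => MkSpec pP).
move=> [pQ [Q' [/IH[c [cP cQ]] Q'Q QQ']]].
exists (fun i => if (i <= n)%N then c i else MkSpec pQ); split; last by rewrite ltnn.
move=> i; rewrite ltnS => ilen; rewrite ilen; case: ltnP => [/cP //|nlei].
have -> : i = n by apply/eqP; rewrite eqn_leq ilen.
by rewrite /= cQ.
Qed.

Lemma chain_top n P Q m : prime_ideal m -> chain n P Q -> Q `<=` m ->
  exists P', chain n P' m.
Proof.
case: n => [|n] pm; first by exists m.
move=> [pQ [Q' [c Q'Q QQ']]] Qm; exists P; split=> //; exists Q'; split=> //.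
  exact: subset_trans Q'Q Qm.
by move=> mQ'; apply: QQ'; exact: subset_trans Qm mQ'.
Qed.

End Adjs.

(** * Regular local rings have finite injective dimension *)

Section Regular.
Variable R : comPzRingType.
Hypothesis nR : noeth R^o.
Variable m : set R.
Hypothesis pm : prime_ideal m.
Hypothesis unit_m : forall a, ~ m a -> exists b, a * b = 1.
Local Notation idl I := (submodule (I : set R^o)).
Implicit Types (I J : set R) (K P N X Y Z M L : lmodType R).

(** Each element [x] of the sequence costs one degree, by the exact sequence
    [0 -> R/J -> R/J -> R/(J + x) -> 0]. *)
Lemma regseq_vanishing I M xs J n : idl I -> idl J -> I `<=` J -> regseq J xs ->
  (forall i, (n <= i)%N -> vanExt I i J M) ->
  forall i, (n + size xs <= i)%N -> vanExt I i (adjs J xs) M.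
Proof.
move=> hI; elim: xs J n => [|x xs IH] J n hJ IJ /=.
  by move=> _ H i; rewrite addn0; exact: H.
move=> [nzd reg] H i; rewrite addnS -addSn => ni.
have IJ' : I `<=` adj J x by exact: subset_trans IJ (@adj_sub _ _ _).
apply: (IH _ n.+1) => // [|j]; first exact: adj_idl.
case: j => // j nj.
(* as [x] is a nonzerodivisor modulo [J], [R/(J : x) = R/J] *)
have [N cN] := is_quot_ex hJ; have [Z cZ] := is_quot_ex (adj_idl x hJ).
exists Z; split=> //; have [pi [pis piE]] := cN.
have piE' b : pi b = 0 <-> J (b * x).
  rewrite piE; split=> [Jb|]; first exact: idlMr.
  by rewrite mulrC => /nzd.
have [u [v [ui uv vs _]]] := is_quot_exact_maps hJ pis piE' pis piE cZ.
rewrite -[1]mulr1.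
have E : short_exact N N Z by exists u, v.
have kN := is_quot_killed hJ IJ cN; have gN := is_quot_fin_gen cN.
apply: (annExt_right nR hI kN gN E).
  by apply: (vanExt_all nR hI hJ IJ cN); exact: H.
by apply: (vanExt_all nR hI hJ IJ cN); apply: H; exact: ltnW.
Qed.

Lemma idim_le_of_residue n M : fin_gen M -> (forall i, (n <= i)%N -> vanExt zI i m M) -> idim_le n M.
Proof.
move=> gM H; apply: idim_le_of_annExt => // J hJ.
have hm := prime_idl pm.
have zm (I' : set R) : idl I' -> zI `<=` I' by move=> hI' x ->; exact: idl0.
have [N [[pi [pis piE]] annExtN]] :=
  residue_vanishing nR pm unit_m (@zero_ideal R) gM (zm _ hm) H hJ (zm _ hJ) (leqnn n).
by exists N, pi.
Qed.

Lemma maximal_eq (m' : set R) : maximal_ideal m' -> m' = m.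
Proof.
move=> [im' m'1 max]; have m'm : m' `<=` m.
  move=> a m'a; apply: contrapT => /unit_m[b ab]; apply: m'1; rewrite -ab.
  by apply: idlMr => //; exact/ideal_submodule.
by apply/esym/max => //; [exact/ideal_submodule/prime_idl|exact: prime1].
Qed.

(** The generators of [m] form a regular sequence, so that [Ext^i(R/m, M)]
    vanishes for large [i]; [residue_vanishing] does the rest. *)
Lemma regular_idim_le M : fin_gen M -> regular_local R -> exists n, idim_le n M.
Proof.
move=> gM [_ [m' [/maximal_eq -> _ [d [[[c cc] dmax] /generated_span[xs [sz mE]] _]]]]].
subst d.
have hm := prime_idl pm; have hz := @zero_ideal R.
have cm : spec_set (c (size xs)) `<=` m.
  have pc := spec_prime (c (size xs)); move=> a ca; apply: contrapT => /unit_m[b ab].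
  by apply: (prime1 pc); rewrite -ab; apply: idlMr => //; exact: prime_idl.
have [P cP] := chain_top pm (prime_chain_chain cc) cm.
have [pP _] := chain_primes cP.
have mx x : x \in (xs : seq R) -> m x by move=> xxs; rewrite mE; exact: (span_mem (V := R^o) xxs).
have mxs : m `<=` adjs zI xs by rewrite mE => y /adjs_zI.
have zP : zI `<=` P by move=> x ->; apply: idl0; exact: prime_idl.
have [_ reg] := chain_regseq nR pm unit_m hz zP cP mxs mx.
exists (size xs); apply: idim_le_of_residue => // i di.
have -> : m = adjs zI xs by apply/seteqP; split=> // y /adjs_zI; rewrite mE.
apply: (regseq_vanishing (n := 0%N) hz hz _ reg) => // j _.
have [N cN] := is_quot_ex hz; exists N; split=> //.
by apply: annExt_rproj; exact: is_quot_rproj cN.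
Qed.
End Regular.

(** * Finite injective dimension of the residue field *)

Section ModNzd.
Variable R : comPzRingType.
Hypothesis nR : noeth R^o.
Variables (I : set R) (c : R).
Hypothesis hI : submodule (I : set R^o).
Hypothesis nzd : forall a, I (c * a) -> I a.
Implicit Types (K P N L : lmodType R).

(** A quotient by the multiples of [c], up to isomorphism. *)
Definition mod_c N N' (tau : {linear N -> N'}) : Prop :=
  surjective tau /\ forall x, tau x = 0 <-> exists y, x = c *: y.

Lemma mod_c_ex N : exists N' (tau : {linear N -> N'}), mod_c tau.
Proof.
suff h : submodule [set x : N | exists y, x = c *: y].
  by have [N' [tau tauP]] := quot_ex h; exists N', tau.
split; first by exists 0; rewrite scaler0.
by move=> a _ _ [y ->] [z ->]; exists (a *: y + z); rewrite scalerDr !scalerA mulrC.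
Qed.

Lemma mod_c_map N N' P P' (tN : {linear N -> N'}) (tP : {linear P -> P'})
    (f : {linear N -> P}) : mod_c tN -> mod_c tP ->
  exists f' : {linear N' -> P'}, forall x, f' (tN x) = tP (f x).
Proof.
move=> [tNs tNE] [_ tPE]; have [tf tfE] := lin_comp tP f.
have [|f' f'E] := @factor_surj _ _ _ _ tN tf tNs; last by exists f' => x; rewrite f'E.
by move=> x /tNE[y ->]; rewrite tfE; apply/tPE; exists (f y); rewrite linearZ.
Qed.

Lemma mod_c_killed N N' (tau : {linear N -> N'}) :
  mod_c tau -> killed I N -> killed (adj I c) N'.
Proof.
move=> [taus tauE] kN _ x [j [a [Ij ->]]]; have [y <-] := taus x.
rewrite -linearZ; apply/tauE; exists (a *: y).
by rewrite /= scalerDl (kN j y Ij) add0r scalerA mulrC.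
Qed.

Lemma adj_kills L (x : L) : killed (adj I c) L -> c *: x = 0.
Proof. by apply; exact: adj_mem. Qed.

Lemma mod_c_factor N N' L (tau : {linear N -> N'}) (h : {linear N -> L}) :
  mod_c tau -> killed (adj I c) L ->
  exists h' : {linear N' -> L}, forall x, h' (tau x) = h x.
Proof.
move=> [taus tauE] kL; apply: (factor_surj taus) => x /tauE[y ->].
by rewrite linearZ /= adj_kills.
Qed.

(** As [c] is a nonzerodivisor on [N], the sequence [0 -> K -> P -> N -> 0]
    remains exact modulo [c]; and a power of [R/I] becomes a power of
    [R/(I + c)]. *)
Lemma cover_mod_c N N' (tau : {linear N -> N'}) : killed I N -> fin_gen N ->
  (forall x : N, c *: x = 0 -> x = 0) -> mod_c tau ->
  exists P K (f : {linear K -> P}) (g : {linear P -> N}) P' K' (f' : {linear K' -> P'})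
    (g' : {linear P' -> N'}) (tP : {linear P -> P'}) (tK : {linear K -> K'}),
    [/\ cover I f g /\ fin_gen K, forall x : K, c *: x = 0 -> x = 0,
        cover (adj I c) f' g', mod_c tP /\ mod_c tK & forall x, f' (tK x) = tP (f x)].
Proof.
move=> kN gN cN mN; have [n [Q [pi [K [f [g [pis piE cv gK]]]]]]] := free_cover_ex nR hI kN gN.
pose P : lmodType R := {ffun 'I_n -> Q}; have [[kP lP] fi fg gs] := cv.
have cP (x : P) : c *: x = 0 -> x = 0.
  move=> /ffunP cx; apply/ffunP => j; have := cx j; rewrite !ffunE.
  have [a <-] := pis (x j); rewrite -linearZ => /piE; rewrite /= -[c *: a]/(c * a).
  by move=> /nzd Ia; apply/piE.
have [P' [tP mP]] := mod_c_ex P; have [K' [tK mK]] := mod_c_ex K.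
have [f' f'E] := mod_c_map f mK mP; have [g' g'E] := mod_c_map g mP mN.
exists P, K, f, g, P', K', f', g', tP, tK; split=> //.
  by move=> x cx; apply: fi; rewrite linear0; apply: cP; rewrite -linearZ /= cx linear0.
have [[tPs tPE] [tKs tKE] [taus tauE]] := And3 mP mK mN; split.
- split=> [|V W u h kV us]; first exact: mod_c_killed mP kP.
  have [ht htE] := lin_comp h tP.
  have [|k kE] := lP _ _ u ht _ us; first by move=> a x Ia; apply: kV; exact: adj_sub.
  have [k' k'E] := mod_c_factor k mP kV.
  by exists k' => x; have [y <-] := tPs x; rewrite k'E kE htE.
- apply: ker0_inj => x; have [k <-] := tKs x; rewrite f'E => /tPE[y yE]; apply/tKE.
  have /fg[k1 k1E] : g y = 0 by apply: cN; rewrite -linearZ /= -yE; apply/fg; exists k.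
  by exists k1; apply: fi; rewrite yE linearZ /= k1E.
- move=> y; have [x <-] := tPs y; rewrite g'E; split=> [/tauE[z zE]|[t]].
    have [x1 x1E] := gs z.
    have /fg[k kE] : g (x - c *: x1) = 0 by rewrite linearB linearZ /= x1E zE subrr.
    exists (tK k); rewrite f'E kE linearB /= (_ : tP (c *: x1) = 0) ?subr0 //.
    by apply/tPE; exists x1.
  have [k <-] := tKs t; rewrite f'E => e; apply/tauE.
  have /tPE[x1 x1E] : tP (x - f k) = 0 by rewrite linearB e subrr.
  by exists (g x1); rewrite -linearZ /= -x1E linearB (fg (f k)).2 ?subr0 //; exists k.
- by move=> y; have [x <-] := taus y; have [z <-] := gs x; exists (tP z); rewrite g'E.
Qed.

(** [Ext_{R/(I+c)}(N/cN, L) = Ext_{R/I}(N, L)], since a resolution of [N]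
    reduces modulo [c] to a resolution of [N/cN]. *)
Lemma annExt_mod_nzd i N N' L (tau : {linear N -> N'}) :
  killed I N -> fin_gen N -> (forall x : N, c *: x = 0 -> x = 0) -> mod_c tau ->
  killed (adj I c) L -> annExt I 1 i N L -> annExt (adj I c) 1 i N' L.
Proof.
move=> + + + + kL; elim: i N N' tau => [|i IH] N N' tau kN gN cN mN H;
  have [P [K [f [g [P' [K' [f' [g' [tP [tK [[cv gK] cK cv' [mP mK] f'E]]]]]]]]]]] :=
    cover_mod_c kN gN cN mN; have [tKs _] := mK.
- apply: (annExt0_cover cv') => h; have [ht htE] := lin_comp h tK.
  have [e eE] := H _ _ _ _ cv ht; have [e' e'E] := mod_c_factor e mP kL.
  by exists e' => x; have [k <-] := tKs x; rewrite f'E e'E eE htE.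
- apply: (annExtS_cover nR (adj_idl c hI) cv'); first exact: fin_gen_surj tKs gK.
  exact: (IH K K' tK (cover_killed cv) gK cK mK (H _ _ _ _ cv)).
Qed.

End ModNzd.

Section Residue.
Variable R : comPzRingType.
Hypothesis nR : noeth R^o.
Variable m : set R.
Hypothesis pm : prime_ideal m.
Hypothesis unit_m : forall a, ~ m a -> exists b, a * b = 1.
Variables (k : lmodType R) (pk : {linear R^o -> k}).
Hypothesis pks : surjective pk.
Hypothesis pkE : forall a, pk a = 0 <-> m a.
Local Notation idl I := (submodule (I : set R^o)).
Implicit Types (I J : set R) (K P N X Y Z M L : lmodType R).

Let hm : idl m := prime_idl pm.

Lemma is_quot_k : is_quot m k. Proof. by exists pk. Qed.

Lemma fin_gen_k : fin_gen k. Proof. exact: is_quot_fin_gen is_quot_k. Qed.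

(** The class [v] spans a copy of [k] in [R/I], with quotient [R/(I + v)]: the
    long exact sequence lowers [n], down to the injectivity of [k] over [R/I].
    Then the identity of [k] extends to [R/I], so that [v] does not annihilate
    [k]; hence [v] is a unit and [m = I]. *)
Lemma socle_residue I n v : idl I -> I `<=` m -> ~ I v ->
  (forall y, m y -> I (y * v)) ->
  (forall i, (n <= i)%N -> annExt I 1 i k k) -> m `<=` I.
Proof.
move=> hI Im Iv soc; have hA : idl (adj I v) by exact: adj_idl.
have [Y cY] := is_quot_ex hI; have [Z cZ] := is_quot_ex hA.
have [pi [pis piE]] := cY.
have pkE' b : pk b = 0 <-> I (b * v).
  rewrite pkE; split=> [/soc//|Ibv]; apply: contrapT => mb.
  exact: Iv (unit_idl unit_m hI mb Ibv).
have [u [w [ui uw ws uE]]] := is_quot_exact_maps hI pks pkE' pis piE cZ.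
have rY := is_quot_rproj hI cY.
have kY := is_quot_killed hI (@subset_refl _ I) cY; have gY := is_quot_fin_gen cY.
have van n' : (forall i, (n' <= i)%N -> annExt I 1 i k k) -> forall i, (n' <= i)%N -> annExt I 1 i Z k.
  move=> H i ni; apply: (vanExt_all nR hI hA (@adj_sub _ _ _) cZ).
  apply: (residue_vanishing nR pm unit_m hI fin_gen_k Im _ hA (@adj_sub _ _ _) ni).
  by move=> j nj; exists k; split; [exact: is_quot_k|exact: H].
elim: n => [|n IH] H; last first.
  apply: IH => i; rewrite leq_eqVlt => /orP[/eqP <-|]; last exact: H.
  rewrite -[1]mulr1; apply: (annExt_left nR hI kY gY).
  - by exists u, w; split.
  - exact: annExt_rproj rY.
  - by apply: (van n.+1 H).
have [i1 i1E] := lin_id k.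
(* [e] extends the identity of [k], embedded by [u], to [R/I] *)
have [e eE] := van 0%N H 0%N isT _ _ u w (And4 rY ui uw ws) i1.
have mv : ~ m v.
  move=> mv; apply: (prime1 pm); apply/pkE.
  rewrite -[pk 1]scale1r -[pk 1 in LHS]i1E -eE uE mul1r.
  rewrite -[v]mulr1 -[v * 1]/(v *: (1 : R^o)) linearZ linearZ /=.
  by have [a <-] := pks (e (pi 1)); rewrite -linearZ; apply/pkE; exact: idlMr.
move=> y my; have := soc y my; rewrite mulrC; exact: (unit_idl unit_m hI mv).
Qed.

(** In passing from [R/I] to [R/(I + c)], [m/I] is replaced by its reduction
    [N/cN], where [N = m/I], which has the same Ext modules. As [c] belongs to a
    minimal system of generators [c, xs] of [m] modulo [I], [m/(I + c)] is a
    summand of [N/cN]: it is the image of the span of [xs]. *)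
Lemma residue_mod_nzd I c xs n : idl I -> I `<=` m -> m c ->
  (forall x, x \in xs -> m x) -> m `<=` adjs (adj I c) xs ->
  (forall a, adjs I xs (a * c) -> m a) -> (forall a, I (c * a) -> I a) ->
  (forall i, (n <= i)%N -> annExt I 1 i k k) ->
  forall i, (n.+1 <= i)%N -> annExt (adj I c) 1 i k k.
Proof.
move=> hI Im mc mxs mgen cmin nzd H [//|i] ni.
have hI' : idl (adj I c) by exact: adj_idl.
have Im' : adj I c `<=` m by exact: adj_min.
have hJ : idl (adjs I xs) by exact: adjs_idl.
have Jm : adjs I xs `<=` m.
  move=> y; rewrite adjs_span // => -[j [w [/Im mj sw ->]]]; apply: idlD => //.
  apply: (span_min (V := R^o) (S := m)) sw => //.
(* the kernels of [R/I -> k] and [R/(I + c) -> k] *)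
have [Q [pi [pis piE]]] := quot_ex hI; have [Q' [pi' [pis' piE']]] := quot_ex hI'.
have cQ : is_quot I Q by exists pi.
have cQ' : is_quot (adj I c) Q' by exists pi'.
have [|r rE] := @factor_surj _ _ _ _ pi pk pis; first by move=> a /piE/Im ma; apply/pkE.
have [|r' rE'] := @factor_surj _ _ _ _ pi' pk pis'; first by move=> a /piE'/Im' ma; apply/pkE.
have rs : surjective r by move=> y; have [a <-] := pks y; exists (pi a).
have rs' : surjective r' by move=> y; have [a <-] := pks y; exists (pi' a).
have [N [f [fi fr]]] := ker_ex r; have [N' [f' [fi' fr']]] := ker_ex r'.
have kQ := is_quot_killed hI (@subset_refl _ I) cQ; have gQ := is_quot_fin_gen cQ.
have gQ' := is_quot_fin_gen cQ'.
have cv : cover I f r by split=> //; exact: is_quot_rproj cQ.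
have cv' : cover (adj I c) f' r' by split=> //; exact: is_quot_rproj cQ'.
apply: (annExtS_cover nR hI' cv' (fin_gen_inj nR fi' gQ')).
have [Nc [tau mN]] := mod_c_ex c N; have [taus tauE] := mN.
have gN := fin_gen_inj nR fi gQ; have kN := killed_inj fi kQ.
have HN : annExt (adj I c) 1 i Nc k.
  apply: (annExt_mod_nzd nR hI nzd kN gN _ mN).
  - move=> x cx; apply: fi; rewrite linear0; have [a aE] := pis (f x).
    rewrite -aE; apply/piE/nzd; apply/piE; rewrite -[c * a]/(c *: (a : R^o)) linearZ /= aE.
    by rewrite -linearZ /= cx linear0.
  - exact: is_quot_killed hm Im' is_quot_k.
  - exact: (H i.+1 (leqW ni) _ _ _ _ cv).
have kNc := mod_c_killed mN kN.
have gNc := fin_gen_surj taus gN.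
(* lifts of the elements of [m] to [N] and [N'] *)
have [Mm [jm [jmi jmE]]] := sub_ex hm.
have [jpi jpiE] := lin_comp pi jm; have [jpi' jpiE'] := lin_comp pi' jm.
have [|nu nuE] := @factor_inj _ _ _ _ f jpi fi.
  by move=> x; apply/fr; rewrite jpiE rE; apply/pkE/jmE; exists x.
have [|nu' nuE'] := @factor_inj _ _ _ _ f' jpi' fi'.
  by move=> x; apply/fr'; rewrite jpiE' rE'; apply/pkE/jmE; exists x.
have nus : surjective nu.
  move=> x; have [a aE] := pis (f x).
  have /jmE[t tE] : m a by apply/pkE; rewrite -rE aE; apply/fr; exists x.
  by exists t; apply: fi; rewrite nuE jpiE tE.
(* the projection [(m/I)/c -> m/(I + c)] *)
have [|q qE] := @factor_surj _ _ _ _ nu nu' nus.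
  move=> t nut; apply: fi'; rewrite linear0 nuE' jpiE'; apply/piE'/adj_sub/piE.
  by rewrite -jpiE -nuE nut linear0.
have kN' := killed_inj fi' (is_quot_killed hI' (@subset_refl _ (adj I c)) cQ').
have [be beE] := mod_c_factor hI q mN kN'.
(* its section, defined on the span of [xs] *)
have [Jj [jj [jji jjE]]] := sub_ex hJ.
have [|l lE] := @factor_inj _ _ _ _ jm jj jmi.
  by move=> x; apply/jmE/Jm/jjE; exists x.
have [s1 s1E] := lin_comp nu l; have [s2 s2E] := lin_comp tau s1.
have [p1 p1E] := lin_comp nu' l.
have p1s : surjective p1.
  move=> x; have [a aE] := pis' (f' x).
  have ma : m a by apply/pkE; rewrite -rE' aE; apply/fr'; exists x.
  have := mgen _ ma; rewrite adjs_span // => -[_ [w [[j [b [Ij ->]]] sw e]]].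
  have /jjE[t tE] : adjs I xs (j + w) by apply/adjs_span => //; exists j, w.
  exists t; apply: fi'; rewrite p1E nuE' jpiE' lE tE -aE.
  apply/eqP; rewrite -subr_eq0 -linearB; apply/eqP/piE'.
  have -> : j + w - a = 0 + (- b) * c by rewrite e; ring.
  by exists 0, (- b); split=> //; exact: idl0.
have [|al alE] := @factor_surj _ _ _ _ p1 s2 p1s.
  move=> t; rewrite p1E => e; rewrite s2E s1E; apply/tauE.
  have [j [a [Ij tE]]] : adj I c (jj t).
    by apply/piE'; rewrite -lE -jpiE' -nuE' e linear0.
  have ma : m a.
    apply: cmin; have -> : a * c = jj t - j by rewrite tE addrC addKr.
    by apply: idlB => //; [apply/jjE; exists t|exact: adjs_sub].
  have [t' t'E] := (jmE a).1 ma; exists (nu t'); apply: fi.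
  rewrite nuE jpiE lE linearZ /= nuE jpiE t'E -linearZ.
  apply/eqP; rewrite -subr_eq0 -linearB; apply/eqP/piE.
  by have -> : (jj t : R) - c * a = j by rewrite tE; ring.
apply: (annExt_retract nR hI' kNc gNc _ HN (f := al) (g := be)).
move=> x; have [t <-] := p1s x; rewrite alE s2E s1E beE qE p1E //.
Qed.

(** As long as [m] differs from [I], [socle_residue] excludes a nonzero class
    annihilated by [m], so [nzd_ex] turns the first generator into a
    nonzerodivisor; by [residue_mod_nzd], this one can be added to [I]. *)
Lemma residue_regseq xs I n : idl I -> I `<=` m -> (forall x, x \in xs -> m x) ->
  m `<=` adjs I xs ->
  (forall ys : seq R, (forall y, y \in ys -> m y) -> m `<=` adjs I ys -> (size xs <= size ys)%N) ->
  (forall i, (n <= i)%N -> annExt I 1 i k k) ->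
  exists ys : seq R, [/\ size ys = size xs, regseq I ys, forall y, y \in ys -> m y &
                m `<=` adjs I ys].
Proof.
elim: xs I n => [|x xs IH] I n hI Im mxs mgen xmin H; first by exists [::].
have mI : ~ (m `<=` I) by move=> mI; have : (size (x :: xs) <= size ([::] : seq R))%N by apply: xmin.
have mx : m x by apply: mxs; exact: mem_head.
have mxs' y : y \in xs -> m y by move=> yx; apply: mxs; exact: in_tail.
have hT : idl setT by [].
have [|w [sw wP]] := @nzd_ex R nR m pm unit_m setT I x xs hT hI mx mxs'.
- move=> v _ Ixv Ixsv; apply: contrapT => Iv; apply: mI.
  apply: (socle_residue hI Im Iv _ H) => y my.
  have := mgen _ my; rewrite adjs_span // => -[j [z [Ij sz ->]]].
  rewrite mulrDl; apply: idlD => //; first exact: idlMr.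
  apply: (span_min (V := R^o) (S := colon I v)) sz => [|u]; first exact: colon_idl.
  by rewrite inE => /orP[/eqP->|/Ixsv].
set c := x + w in wP.
have mc : m c.
  apply: idlD => //; exact: (span_min (V := R^o) (S := m)) sw.
have hI' : idl (adj I c) by exact: adj_idl.
have mgen' : m `<=` adjs (adj I c) xs.
  move=> y /mgen; rewrite adjs_span // => -[j [z [Ij [a [z' [sz' ->]]] ->]]].
  rewrite adjs_span //; exists (j + a * c), (z' - a *: (w : R^o)); split.
  - by exists j, a.
  - apply: (subB (span_sub _)) => //; exact: (subZ (span_sub _)).
  - by rewrite /c /GRing.scale /=; ring.
have cmin a : adjs I xs (a * c) -> m a.
  move=> Jac; apply: contrapT => ma.
  have hJ : idl (adjs I xs) by exact: adjs_idl.
  have Jc := unit_idl unit_m hJ ma Jac.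
  have /(xmin xs mxs') : m `<=` adjs I xs.
    move=> y /mgen'; rewrite adjs_span // => -[z [u [Az su ->]]]; apply: idlD => //.
      by apply: adj_min Az => //; exact: adjs_sub.
    by rewrite adjs_span //; exists 0, u; rewrite add0r; split=> //; exact: idl0.
  by rewrite ltnn.
have nzd a : I (c * a) -> I a by exact: wP.
have H' := residue_mod_nzd hI Im mc mxs' mgen' cmin nzd H.
have [|ys [sz reg mys ygen]] := IH (adj I c) n.+1 hI' (adj_min hm Im mc) mxs' mgen' _ H'.
  move=> ys ysm mys; rewrite -ltnS; apply: (xmin (c :: ys)) => // y.
  by rewrite inE => /orP[/eqP->|/ysm].
exists (c :: ys); split=> //=; first by rewrite sz.
by move=> y; rewrite inE => /orP[/eqP->|/mys].
Qed.

(** Serre's theorem. By [residue_regseq], a regular sequence generates [m] and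
    has the least possible length; this length is the dimension, by
    [regseq_chain] and [height_le]. *)
Lemma residue_regular n : noetherian R -> (forall i, (n <= i)%N -> annExt zI 1 i k k) ->
  regular_local R.
Proof.
move=> noR H; split=> //; have hz := @zero_ideal R.
have ex : exists d, `[< exists xs : seq R, size xs = d /\ m = span (xs : seq R^o) >].
  by have [l lE] := nR hm; exists (size l); apply/asboolP; exists l.
case: (ex_minnP ex) => d /asboolP[xs [sz mE]] dmin.
have zm : zI `<=` m by move=> x ->; exact: idl0.
have adjE (ys : seq R) : (forall y, y \in ys -> m y) -> m `<=` adjs zI ys -> m = span (ys : seq R^o).
  move=> mys my; apply/seteqP; split=> [y /my/adjs_zI//|].
  exact: (span_min (V := R^o)).
have mxs x : x \in (xs : seq R) -> m x.
  by move=> xxs; rewrite mE; exact: (span_mem (V := R^o) xxs).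
have mgen : m `<=` adjs zI xs by move=> y my; apply/adjs_zI; rewrite -mE.
have xmin (ys : seq R) : (forall y, y \in ys -> m y) -> m `<=` adjs zI ys -> (size xs <= size ys)%N.
  by move=> mys my; rewrite sz; apply: dmin; apply/asboolP; exists ys; split=> //; exact: adjE.
have [ys [ysz reg mys ygen]] := residue_regseq hz zm mxs mgen xmin H.
have [P [_ cP]] := regseq_chain nR pm hz zm mys reg.
have [c [cc cE]] := chain_prime_chain cP.
exists m; split.
- split; [exact/ideal_submodule|exact: prime1|].
  move=> J /ideal_submodule hJ J1 mJ; apply/seteqP; split=> // a Ja.
  apply: contrapT => /unit_m[b ab]; apply: J1; rewrite -ab; exact: idlMr.
- exact: maximal_eq.
- exists d; rewrite -sz; split.
  + split; first by rewrite -ysz; exists c.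
    move=> l c' cc'; have cm : spec_set (c' l) `<=` m.
      have pc := spec_prime (c' l); move=> a ca; apply: contrapT => /unit_m[b ab].
      by apply: (prime1 pc); rewrite -ab; apply: idlMr => //; exact: prime_idl.
    have [P' cP'] := chain_top pm (prime_chain_chain cc') cm.
    have [pP' _] := chain_primes cP'.
    have zP : zI `<=` P' by move=> x ->; apply: idl0; exact: prime_idl.
    exact: (height_le nR zP cP' mgen mxs).
  + by apply/generated_span; exists xs.
  + move=> l /generated_span[zs [zsz zE]]; rewrite sz -zsz; apply: dmin.
    by apply/asboolP; exists zs.
Qed.
End Residue.

(** * The local ring at a prime *)

Section LocalRing.
Variables (R : comPzRingType) (p : Spec R).
Local Notation A := (loc_ring p).

Definition mloc : set A := [set x | exists a s, spec_set p a /\ x = lfrac a s].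

Let hp : submodule (spec_set p : set R^o).
Proof. exact/prime_idl/spec_prime. Qed.

Lemma mlocE a (s : den p) : mloc (lfrac a s) <-> spec_set p a.
Proof.
split=> [[b [t [pb /locfracP[u e]]]]|pa]; last by exists a, s.
have {}e : den_val u * den_val t * a = den_val u * den_val s * b by [].
apply: contrapT => pa.
have nu : ~ spec_set p (den_val u * den_val t * a).
  by do 2!apply: (primeM (spec_prime p)) => //; exact: den_notin.
by apply: nu; rewrite e; exact: idlM.
Qed.

Lemma mloc_prime : prime_ideal mloc.
Proof.
split.
- apply/ideal_submodule; apply: idl_ex => [|x y z].
    by exists 0, (den1 p); split; [exact: idl0|].
  move=> [b [t [pb ->]]] [c [u [pc ->]]].
  have [a [s ->]] := lfrac_ex x; rewrite lfracM.
  have -> : lfrac (a * b) (denM s t) + lfrac c u =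
    lfrac (den_val u * (a * b) + den_val (denM s t) * c) (denM (denM s t) u).
    exact: (@locfracD R p R^o).
  apply/mlocE; apply: idlD => //; last exact: idlM.
  by do 2!apply: idlM => //.
- by rewrite -[1]/(lfrac 1 (den1 p)) => /mlocE; exact: prime1 (spec_prime p).
- move=> x y; have [a [s ->]] := lfrac_ex x; have [b [t ->]] := lfrac_ex y.
  by rewrite lfracM => /mlocE; case: (spec_prime p) => _ _ h /h[] ?; [left|right]; apply/mlocE.
Qed.

Lemma mloc_unit (x : A) : ~ mloc x -> exists y, x * y = 1.
Proof.
have [a [s ->]] := lfrac_ex x => na.
have [|t tE] := @den_ex R p a; first by move=> pa; apply: na; apply/mlocE.
exists (lfrac (den_val s) t); rewrite lfracM -[1]/(lfrac 1 (den1 p)).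
by apply: (@locfrac_eq1 R p R^o); rewrite denME !den1E tE mulrC /GRing.scale /= mulr1 mul1r.
Qed.

(** The residue field of [R_p] is the localization of [R/p]. *)
Lemma residue_ex N : is_quot (spec_set p) N -> exists q : {linear A^o -> loc p N},
  surjective q /\ forall x, q x = 0 <-> mloc x.
Proof.
move=> [pi [pis piE]]; have [q [qs qE]] := loc_quot p pis; exists q; split=> // x.
have [a [s ->]] := lfrac_ex x; rewrite qE mlocE; split=> [[u /piE]|pa].
  by case: (spec_prime p) => _ _ h /h[/den_notin|].
by exists (den1 p); apply/piE; rewrite den1E mul1r.
Qed.

Lemma loc_noetherian : noetherian R -> noetherian A.
Proof.
move=> /noetherian_noeth/(@loc_noeth R p) nA J /ideal_submodule/nA[s sE].
by exists (size s); apply/generated_span; exists s.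
Qed.

End LocalRing.

(** * Modules built from a generator *)

Section Main.
Variable R : comPzRingType.
Hypothesis noR : noetherian R.
Let nR : noeth R^o := noetherian_noeth noR.
Implicit Types (G K P N U V W X Y Z M : lmodType R) (f r : R) (p : Spec R).
Local Notation annExtR := (annExt (@zI R)).
Let hz := @zero_ideal R.

Lemma ffun_single V n : exists e : 'I_n -> {linear V -> {ffun 'I_n -> V}},
  forall i v, e i v = [ffun j => if i == j then v else 0].
Proof.
suff /choice[e eE] : forall i : 'I_n, exists e : {linear V -> {ffun 'I_n -> V}},
    forall v, e v = [ffun j => if i == j then v else 0] by exists e.
move=> i; apply: linear_ex => a x y; apply/ffunP => j; rewrite !ffunE.
by case: eqP => _ //; rewrite scaler0 addr0.
Qed.

Lemma ffun_decomp V n (e : 'I_n -> {linear V -> {ffun 'I_n -> V}}) (x : {ffun 'I_n -> V}) :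
  (forall i v, e i v = [ffun j => if i == j then v else 0]) -> x = \sum_i e i (x i).
Proof.
move=> eE; apply/ffunP => j; rewrite sum_ffunE (bigD1 j) //= eE ffunE eqxx big1 ?addr0 //.
by move=> i /negbTE ij; rewrite eE ffunE ij.
Qed.

Lemma ffun_sum V W n (h : 'I_n -> {linear V -> W}) :
  exists g : {linear {ffun 'I_n -> V} -> W}, forall x, g x = \sum_i h i (x i).
Proof.
apply: linear_ex => a x y; rewrite scaler_sumr -big_split.
by apply: eq_bigr => i _; rewrite !ffunE linearP.
Qed.

Lemma ffun_map V W n (h : {linear V -> W}) :
  exists g : {linear {ffun 'I_n -> V} -> {ffun 'I_n -> W}},
    forall x, g x = [ffun i => h (x i)].
Proof. by apply: linear_ex => a x y; apply/ffunP => i; rewrite !ffunE linearP. Qed.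

Lemma rproj_power P n : rproj (@zI R) P -> rproj (@zI R) {ffun 'I_n -> P}.
Proof.
move=> [_ lP]; split; first exact: killed0.
move=> V W g h _ gs; have [e eE] := ffun_single P n.
have /choice[k kE] : forall i, exists k : {linear P -> V}, forall x, g (k x) = h (e i x).
  move=> i; have [he heE] := lin_comp h (e i); have [k kE] := lP _ _ g he (@killed0 R V) gs.
  by exists k => x; rewrite kE heE.
have [s sE] := ffun_sum k; exists s => x.
rewrite sE linear_sum {2}(ffun_decomp x eE) linear_sum.
by apply: eq_bigr => i _; rewrite kE.
Qed.

Lemma cover_power K P N (f : {linear K -> P}) (g : {linear P -> N}) n :
  cover (@zI R) f g -> exists (f' : {linear {ffun 'I_n -> K} -> {ffun 'I_n -> P}})
    (g' : {linear {ffun 'I_n -> P} -> {ffun 'I_n -> N}}),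
    cover (@zI R) f' g' /\ forall x, f' x = [ffun i => f (x i)].
Proof.
move=> [rP fi fg gs]; have [f' f'E] := ffun_map n f; have [g' g'E] := ffun_map n g.
exists f', g'; split=> //; split.
- exact: rproj_power.
- by move=> x y; rewrite !f'E => /ffunP e; apply/ffunP => i; have := e i; rewrite !ffunE => /fi.
- move=> y; rewrite g'E; split=> [/ffunP e|[x <-]].
    have /choice[s sE] : forall i, exists x, f x = y i.
      by move=> i; apply/fg; have := e i; rewrite !ffunE.
    by exists [ffun i => s i]; rewrite f'E; apply/ffunP => i; rewrite !ffunE sE.
  by rewrite f'E; apply/ffunP => i; rewrite !ffunE; apply/fg; exists (x i).
- move=> y; have /choice[s sE] : forall i, exists x, g x = y i by move=> i; exact: gs.
  by exists [ffun i => s i]; rewrite g'E; apply/ffunP => i; rewrite !ffunE sE.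
Qed.

(** The number of copies does not matter: no power of [r] appears. This makes
    the exponents in [thick_annExt] uniform. *)
Lemma annExt_power r i N M n : fin_gen N -> annExtR r i N M -> annExtR r i {ffun 'I_n -> N} M.
Proof.
elim: i N => [|i IH] N gN H.
all: have [P [K [f [g [c gP gK]]]]] := free_cover nR gN.
all: have [f' [g' [c' f'E]]] := cover_power n c.
- apply: (annExt0_cover c') => h; have [e eE] := ffun_single K n.
  have /choice[k kE] : forall i, exists k : {linear P -> M}, forall x, k (f x) = r *: h (e i x).
    move=> i; have [he heE] := lin_comp h (e i); have [k kE] := H _ _ _ _ c he.
    by exists k => x; rewrite kE heE.
  have [s sE] := ffun_sum k; exists s => x.
  rewrite sE f'E {2}(ffun_decomp x eE) linear_sum scaler_sumr.
  by apply: eq_bigr => i _; rewrite ffunE kE.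
- apply: (annExtS_cover nR hz c' (fin_gen_power n gK)).
  by apply: IH => //; exact: H c.
Qed.

Lemma annExt2_power r i N M n : annExtR r i N M -> annExtR r i N {ffun 'I_n -> M}.
Proof.
elim: i N => [|i IH] N H P K f g c; last by apply: IH; exact: H c.
move=> h; have /choice[k kE] : forall i, exists k : {linear P -> M},
    forall x, k (f x) = r *: (h x i).
  move=> i; have [hi hiE] : exists hi : {linear K -> M}, forall x, hi x = h x i.
    by apply: linear_ex => a x y; rewrite linearP !ffunE.
  by have [k kE] := H _ _ _ _ c hi; exists k => x; rewrite kE hiE.
have [k' k'E] : exists k' : {linear P -> {ffun 'I_n -> M}}, forall x, k' x = [ffun i => k i x].
  by apply: linear_ex => a x y; apply/ffunP => i; rewrite !ffunE linearP.
by exists k' => x; rewrite k'E; apply/ffunP => i; rewrite !ffunE kE.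
Qed.

Lemma summand_retract Y X : summand Y X -> exists (u : {linear Y -> X}) (v : {linear X -> Y}),
  forall y, v (u y) = y.
Proof.
move=> [Z [_ [f [f' ff' f'f]]]].
have [i iE] := lin_inl Y Z.
have [u uE] := lin_comp f i.
have [v vE] : exists v : {linear X -> Y}, forall x, v x = (f' x).1.
  apply: linear_ex => a x y; have -> : f' (a *: x + y) = a *: f' x + f' y; last by [].
  by apply: (can_inj ff'); rewrite linearP !f'f.
by exists u, v => y; rewrite vE uE ff' iE.
Qed.

Lemma prod_retract Y Y' : exists (u : {linear Y -> (Y * Y')%type})
  (v : {linear (Y * Y')%type -> Y}), forall y, v (u y) = y.
Proof.
have [u uE] := lin_inl Y Y'.
have [v vE] := lin_fst Y Y'.
by exists u, v => y; rewrite vE uE.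
Qed.

Lemma summand_fin_gen Y X : summand Y X -> fin_gen X -> fin_gen Y.
Proof.
move=> /summand_retract[u [v vu]]; apply: (fin_gen_surj (f := v)) => y.
by exists (u y).
Qed.

Lemma zero_fin_gen Z : zero_module Z -> fin_gen Z.
Proof. by move=> Z0; apply/fin_gen_span; exists [::] => x; rewrite [x]Z0. Qed.

Lemma zero_annExt r i Z M : zero_module Z -> annExtR r i Z M.
Proof. by move=> Z0; apply: annExt_rproj; exact: zero_rproj. Qed.

Lemma add_closure_fin_gen G Y : fin_gen G -> add_closure G Y -> fin_gen Y.
Proof. by move=> gG [n /summand_fin_gen]; apply; exact: fin_gen_power. Qed.

Lemma add_closure_annExt r i G Y M : fin_gen G -> add_closure G Y -> annExtR r i G M -> annExtR r i Y M.
Proof.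
move=> gG [n /summand_retract[u [v vu]]] H.
exact: (annExt_retract nR hz (@killed0 R _) (fin_gen_power n gG) vu (annExt_power n gG H)).
Qed.

Lemma add_closure_annExt2 r i G Y N : add_closure G Y -> annExtR r i N G -> annExtR r i N Y.
Proof.
move=> [n /summand_retract[u [v vu]]] H.
exact: (annExt2_retract vu (annExt2_power n H)).
Qed.

(** Each extension costs one factor [f]. *)
Lemma ext_ball_annExt G t Y f i M : fin_gen G -> annExtR f i G M -> ext_ball G t Y ->
  annExtR (f ^+ t) i Y M.
Proof.
move=> gG H; elim: t Y => [|[|t] IH] Y; first exact: zero_annExt.
  by move=> HY; rewrite expr1; exact: add_closure_annExt gG HY H.
move=> [gY [Y' [Y1 [Y2 [gY' /IH H1 H2 E]]]]].
have [u [v vu]] := prod_retract Y Y'.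
have gYY := fin_gen_prod gY gY'.
apply: (annExt_retract nR hz (@killed0 R _) gYY vu); rewrite exprSr.
exact: (annExt_mid nR hz (@killed0 R _) gYY E H1 (add_closure_annExt gG H2 H)).
Qed.

Lemma thick_fin_gen G t Y : fin_gen G -> thick G t Y -> fin_gen Y.
Proof.
move=> gG; case: t => [|[|t]]; first exact: zero_fin_gen.
  exact: add_closure_fin_gen.
by move=> [X [U [V [gX /summand_fin_gen + _ _ _]]]]; apply.
Qed.

(** Each step costs one factor [f], and moves the degree by at most one in
    either direction: it is enough to control [G] in the degrees from [a] to
    [b]. *)
Lemma thick_annExt G f M a b t Y i : fin_gen G ->
  (forall j, (a <= j)%N -> (j <= b)%N -> annExtR f j G M) -> thick G t Y ->
  (a + t <= i)%N -> (i + t <= b)%N -> annExtR (f ^+ t) i Y M.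
Proof.
move=> gG H; elim: t Y i => [|[|t] IH] Y i HY; first by move=> _ _; exact: zero_annExt.
  move=> ai ib; rewrite expr1; apply: (add_closure_annExt gG HY); apply: H.
    by apply: leq_trans ai; rewrite leq_addr.
  by apply: leq_trans ib; rewrite leq_addr.
move: HY => [X [U [V [gX /summand_retract[u [v vu]] HU HV E]]]] ai ib.
apply: (annExt_retract nR hz (@killed0 R _) gX vu).
have {}HU : thick G t.+1 U := HU.
have gU := thick_fin_gen gG HU; have gV := add_closure_fin_gen gG HV.
have kU j : (a + t.+2 <= j.+1)%N -> (j + t.+2 <= b.+1)%N -> annExtR (f ^+ t.+1) j U M.
  by rewrite !addnS !ltnS => aj jb; apply: IH HU _ _; rewrite ?addnS.
have kV j : (a + t.+2 <= j.+1)%N -> (j + t.+2 <= b.+1)%N -> annExtR f j V M.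
  rewrite !addnS !ltnS => aj jb; apply: (add_closure_annExt gG HV); apply: H.
    by apply: leq_trans aj; rewrite -addnS leq_addr.
  by apply: leq_trans jb; rewrite -addnS leq_addr.
have ai' : (a + t.+2 <= i.+1)%N by exact: leqW.
have ib' : (i + t.+2 <= b.+1)%N by exact: leqW.
have e1 : f ^+ t.+2 = f * f ^+ t.+1 by rewrite exprS.
have e2 : f ^+ t.+2 = f ^+ t.+1 * f by rewrite exprSr.
case: E => [[]|[]|[]] E.
- rewrite e2; apply: (annExt_left nR hz (@killed0 R _) gU E (kU _ ai' ib')).
  by apply: kV; [exact: leqW|rewrite addSn ltnS].
- rewrite e1; apply: (annExt_left nR hz (@killed0 R _) gV E (kV _ ai' ib')).
  by apply: kU; [exact: leqW|rewrite addSn ltnS].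
- by rewrite e2; apply: (annExt_mid nR hz (@killed0 R _) gX E (kU _ ai' ib') (kV _ ai' ib')).
- by rewrite e1; apply: (annExt_mid nR hz (@killed0 R _) gX E (kV _ ai' ib') (kU _ ai' ib')).
- case: i ai ib ai' ib' => [|i] ai ib ai' ib'; first by rewrite addnS in ai.
  rewrite e2; apply: (annExt_right nR hz (@killed0 R _) gV E _ (kV _ ai' ib')).
  by apply: kU => //; apply: leq_trans ib' ; rewrite addSn.
- case: i ai ib ai' ib' => [|i] ai ib ai' ib'; first by rewrite addnS in ai.
  rewrite e1; apply: (annExt_right nR hz (@killed0 R _) gU E _ (kU _ ai' ib')).
  by apply: kV => //; apply: leq_trans ib' ; rewrite addSn.
Qed.

Lemma annExt_up r n M : (forall N, fin_gen N -> annExtR r n N M) ->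
  forall i N, (n <= i)%N -> fin_gen N -> annExtR r i N M.
Proof.
move=> H i + /subnK <-; elim: (i - n)%N => [|j IH] N gN; first exact: H.
have [P [K [f [g [c gP gK]]]]] := free_cover nR gN.
by rewrite addSn; apply: (annExtS_cover nR hz c gK); exact: IH.
Qed.

Lemma syzygy_ex s X : fin_gen X -> exists Y, [/\ fin_gen Y, syzygy s X Y &
  forall r i M, annExtR r i Y M -> annExtR r (i + s)%N X M].
Proof.
elim: s X => [|s IH] X gX.
  exists X; split=> //=; last by move=> r i M; rewrite addn0.
  have [i iE] := lin_id X.
  by exists i; exists id => x; rewrite iE.
have [P [K [f [g [c gP gK]]]]] := free_cover nR gX.
have [Y [gY sY HY]] := IH K gK; exists Y; split=> //.
  exists P, K; case: c => rP fi fg gs.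
  by split=> //; [exact/rproj_projective|exists f, g; split].
by move=> r i M /HY H; rewrite addnS; exact: (annExtS_cover nR hz c gK H).
Qed.

(** For [s > 0], a projective module is an [s]-th syzygy of the zero module. *)
Lemma projective_syzygy s P : fin_gen P -> projective P ->
  exists X, fin_gen X /\ syzygy s X P.
Proof.
move=> gP pP; have [i iE] := lin_id P.
have isoP : isomorphic P P by exists i; exists id => x; rewrite iE.
case: s => [|s]; first by exists P.
have [Z Z0] := zero_ex R; exists Z; split; first exact: zero_fin_gen.
have [z zE] := lin_zero P Z.
have [o oE] := lin_zero Z Z.
elim: s => [|s IH].
  exists P, P; split=> //; exists i, z; split.
  - by move=> x y; rewrite !iE.
  - by move=> y; rewrite zE; split=> // _; exists y; rewrite iE.
  - by move=> y; exists 0; rewrite [LHS]Z0 [RHS]Z0.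
exists Z, Z; split=> //; first exact: zero_fin_gen.
  by apply/rproj_projective; exact: zero_rproj.
exists o, o; split=> y; rewrite ?[y]Z0.
- by move=> x; rewrite [x]Z0.
- by rewrite oE; split=> // _; exists 0.
- by exists 0.
Qed.

(** * The loci of infinite injective dimension *)

(** Finiteness of the injective dimension of [M_p], expressed with [R]-modules,
    so that it can be followed along exact sequences of [R]-modules. *)
Definition fid_at p M : Prop := exists n, forall i N, (n <= i)%N -> fin_gen N ->
  exists2 r, ~ spec_set p r & annExtR r i N M.

Lemma injdim_fid_at p M n : fin_gen M -> injdim_le (loc p M) n -> fid_at p M.
Proof.
move=> gM /(injdim_loc_annExt nR gM) H; exists n => i + /subnK <-.
elim: (i - n)%N => [|j IH] N gN; first exact: H.
have [P [K [f [g [c gP gK]]]]] := free_cover nR gN.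
have [r pr Hr] := IH K gK; exists r => //.
by rewrite addSn; apply: (annExtS_cover nR hz c gK).
Qed.

Lemma fid_at_mid p M1 M M2 : short_exact M1 M M2 -> fid_at p M1 -> fid_at p M2 -> fid_at p M.
Proof.
move=> E [n1 H1] [n2 H2]; exists (maxn n1 n2) => i N; rewrite geq_max => /andP[i1 i2] gN.
have [r1 p1 h1] := H1 i N i1 gN; have [r2 p2 h2] := H2 i N i2 gN.
exists (r2 * r1); first exact: primeM (spec_prime p) p2 p1.
exact: (annExt2_mid (@killed0 R _) E h2 h1).
Qed.

Lemma fid_at_right p M1 M M2 : short_exact M1 M M2 -> fid_at p M1 -> fid_at p M -> fid_at p M2.
Proof.
move=> E [n1 H1] [n2 H2]; exists (maxn n1 n2) => i N; rewrite geq_max => /andP[i1 i2] gN.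
have [r1 p1 h1] := H1 i.+1 N (leqW i1) gN; have [r2 p2 h2] := H2 i N i2 gN.
exists (r2 * r1); first exact: primeM (spec_prime p) p2 p1.
exact: (annExt2_right nR hz (@killed0 R _) gN (@killed0 R _) E h2 h1).
Qed.

Lemma fid_at_retract p Y X (u : {linear Y -> X}) (v : {linear X -> Y}) :
  (forall y, v (u y) = y) -> fid_at p X -> fid_at p Y.
Proof.
move=> vu [n H]; exists n => i N ni gN; have [r pr Hr] := H i N ni gN.
by exists r => //; exact: annExt2_retract vu Hr.
Qed.

Lemma fid_at_add p G Y : add_closure G Y -> fid_at p G -> fid_at p Y.
Proof.
move=> aY [n H]; exists n => i N ni gN; have [r pr Hr] := H i N ni gN.
by exists r => //; exact: add_closure_annExt2 aY Hr.
Qed.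

Lemma fid_at_ball p G t Y : fid_at p G -> ext_ball G t Y -> fid_at p Y.
Proof.
move=> fG; elim: t Y => [|[|t] IH] Y.
- move=> Y0; exists 0%N => i N _ _; exists 1; first exact: prime1 (spec_prime p).
  elim: i N => [|i IH] N P K f g c; last exact: IH.
  have [z zE] := lin_zero P Y.
  by move=> h; exists z => x; rewrite [LHS]Y0 [RHS]Y0.
- by move=> aY; exact: fid_at_add aY fG.
move=> [gY [Y' [Y1 [Y2 [gY' /IH H1 H2 E]]]]].
have [u [v vu]] := prod_retract Y Y'; apply: (fid_at_retract vu).
exact: fid_at_mid E H1 (fid_at_add H2 fG).
Qed.

(** Finite injective dimension goes up a resolution, one cokernel at a time. *)
Lemma fid_at_syzygy p s X : fin_gen X ->
  (forall P, fin_gen P -> projective P -> fid_at p P) ->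
  (forall Y, syzygy s X Y -> fid_at p Y) -> fid_at p X.
Proof.
move=> + HP; elim: s X => [|s IH] X gX H.
  apply: H; have [i iE] := lin_id X.
  by exists i; exists id => x; rewrite iE.
have [P [K [f [g [[rP fi fg gs] gP gK]]]]] := free_cover nR gX.
have pP : projective P by apply/rproj_projective.
have E : short_exact K P X by exists f, g; split.
apply: (fid_at_right E); last exact: HP.
by apply: IH => // Y sY; apply: H; exists P, K; split.
Qed.

(** All [s]-th syzygies have finite injective dimension at [p], since they are
    built from [G]; so have the projectives, which are themselves [s]-th
    syzygies, and thus all finitely generated modules, in particular [R/p]. *)
Lemma generator_regular G p n : extension_generator G -> injdim_le (loc p G) n ->
  regular_local (loc_ring p).
Proof.
move=> [gG [s genG]] /(injdim_fid_at gG) fG.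
have fin X Y : fin_gen X -> syzygy s X Y -> fid_at p Y.
  by move=> gX sXY; have [t tY] := genG X Y gX sXY; exact: fid_at_ball fG tY.
have finP P : fin_gen P -> projective P -> fid_at p P.
  by move=> gP pP; have [X [gX sX]] := projective_syzygy s gP pP; exact: fin gX sX.
have [N cN] := is_quot_ex (prime_idl (spec_prime p)); have gN := is_quot_fin_gen cN.
have [n' H] : fid_at p N by apply: (@fid_at_syzygy p s) => // Y; exact: fin.
have [q [qs qE]] := residue_ex cN.
apply: (residue_regular (loc_noeth nR) (mloc_prime p) (@mloc_unit R p) qs qE (n := n')).
  exact: loc_noetherian.
by move=> i ni; have [r pr Hr] := H i N ni gN; exact: annExt_loc nR gN pr Hr.
Qed.

Lemma regular_injdim M p : fin_gen M -> regular_local (loc_ring p) ->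
  exists n, injdim_le (loc p M) n.
Proof.
move=> gM reg.
have [n /idim_le_injdim H] := regular_idim_le (loc_noeth nR) (mloc_prime p) (@mloc_unit R p)
  (loc_fin_gen p gM) reg.
by exists n.
Qed.

Lemma notIID M p : ~ IID M p <-> exists n, injdim_le (loc p M) n.
Proof.
split=> [/existsNP[n /contrapT H]|[n H] I]; first by exists n.
exact: I n H.
Qed.

(** Let [f] outside [p] annihilate [Ext^{n+1}(G, M)]. A power of [f] annihilates
    [Ext^{n+1}(Y, M)] for each [s]-th syzygy [Y] of [X], hence also
    [Ext^{n+s+1}(X, M)]; so the injective dimension of [M] is finite wherever
    [f] is invertible. *)
Lemma IID_open G M p : extension_generator G -> fin_gen M -> ~ IID M p ->
  exists2 f, ~ spec_set p f & forall q : Spec R, ~ spec_set q f -> ~ IID M q.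
Proof.
move=> [gG [s genG]] gM /notIID[n /(injdim_loc_annExt nR gM) H].
have [f pf Hf] := H G gG; exists f => // q qf; apply/notIID.
exists (n + s)%N; apply: (annExt_injdim_loc nR) => X gX.
have [Y [gY sY HY]] := syzygy_ex s gX; have [t tY] := genG X Y gX sY.
exists (f ^+ t); first by move=> /(primeX (spec_prime q)).
exact/HY/(ext_ball_annExt gG Hf tY).
Qed.

Lemma IID_closed G M : extension_generator G -> fin_gen M -> closed (IID M).
Proof.
move=> eG gM; rewrite -[IID M]setCK; apply: open_closedC.
exists [set f | forall q : Spec R, ~ spec_set q f -> ~ IID M q]; rewrite setCK.
apply/seteqP; split=> p /=.
  by move=> Ip f fP; apply: contrapT => pf; exact: fP p pf Ip.
move=> Vp; apply: contrapT => Ip; have [f pf fP] := IID_open eG gM Ip.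
by apply: pf; apply: Vp.
Qed.

Lemma coca_notIID M p r : coca M r -> ~ spec_set p r -> ~ IID M p.
Proof.
move=> [n _ H] pr; apply/notIID; exists n; apply: (annExt_injdim_loc nR) => N gN.
by exists r => //; apply: (kills_ext_annExt nR gN); apply: H => //; exact: leqW.
Qed.

(** As in [IID_open], for an [f] that annihilates [Ext(G, M)] in a range of
    degrees wide enough for the [t] steps of [thick]. The exponent [t] is the
    same for all modules, so [f ^+ t] is in [coca M]. *)
Lemma IID_coca G M p : strong_generator G -> fin_gen M -> ~ IID M p ->
  exists2 r, coca M r & ~ spec_set p r.
Proof.
move=> [gG [t genG]] gM /notIID[n /(injdim_fid_at gM)[a H]].
(* one [f] for all the degrees from [a] to [a + 2 t] *)
have [f pf Hf] : exists2 f, ~ spec_set p f &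
    forall j, (a <= j)%N -> (j <= a + t + t)%N -> annExtR f j G M.
  elim: (a + t + t)%N => [|b [f pf Hf]].
    have [r pr Hr] := H a G (leqnn a) gG; exists r => // j aj; rewrite leqn0 => /eqP j0.
    by move: aj; rewrite j0 leqn0 => /eqP a0; rewrite a0 in Hr.
  have [r pr Hr] := H (maxn a b.+1) G (leq_maxl _ _) gG; exists (r * f).
    exact: primeM (spec_prime p) pr pf.
  move=> j aj; rewrite leq_eqVlt => /orP[/eqP jb|]; last first.
    by rewrite ltnS => jb; apply: annExt_mul; exact: Hf.
  by rewrite mulrC; apply: annExt_mul; move: Hr; rewrite -jb (maxn_idPr aj).
exists (f ^+ t); last by move=> /(primeX (spec_prime p)).
have H0 Y : fin_gen Y -> annExtR (f ^+ t) (a + t)%N Y M.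
  by move=> /genG tY; exact: (thick_annExt gG Hf tY).
exists (a + t).+1 => // -[//|i] N ai gN; apply: annExt_kills_ext.
exact: (annExt_up H0 ai gN).
Qed.

End Main.

Theorem theorem1p2 (R : comPzRingType) (noethR : noetherian R)
    (M : lmodType R) (fgM : fin_gen M) :
  ((exists G : lmodType R, extension_generator G) ->
     closed (IID M) /\
     (forall G : lmodType R, extension_generator G -> Sing R = IID G)) /\
  ((exists G : lmodType R, strong_generator G) ->
     IID M = zariski_V (coca M)).
Proof.
split=> [[G eG]|[G sG]].
  split; first exact: IID_closed eG fgM.
  move=> {eG}G eG; have gG := eG.1; apply/seteqP; split=> p /=.
    move=> sing n /(generator_regular noethR eG) reg; exact: sing reg.
  move=> inf reg; have [n] := regular_injdim noethR gG reg; exact: inf.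
apply/seteqP; split=> p /=.
  move=> Ip r rc; apply: contrapT => pr; exact: (coca_notIID noethR rc pr).
move=> Vp; apply: contrapT => /(IID_coca noethR sG fgM)[r /Vp].
by [].
Qed.
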